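(* Let initial data (K) for a K-surface $f$ and initial data (B) for a Bäcklund transform $f^+$ of $f$, with $n^+(0)\neq\pm n(0)$, be given. Let $f^\epsilon$ be the canonical discrete K-surfaces for (K), normalized by $f^\epsilon(0)=f(0)$, and let $(f^\epsilon)^+$ be their discrete Bäcklund transforms with the same initial data (B). Then for some $r>0$ the discrete K-surfaces $(f^\epsilon)^+:\mathcal{B}^\epsilon(r)\to\mathbb{R}^3$ (defined for all sufficiently small $\epsilon>0$) converge, as $\epsilon\to0$, to the unique Bäcklund transform $f^+:\mathcal{B}(r)\to\mathbb{R}^3$ of $f$ with the initial data (B). The convergence is with the order $O(\epsilon)$ in $C^\infty(\mathcal{B}(r))$.
   Context: Put $\mathcal{B}_1=\mathbb{R}\times\{0\}$, $\mathcal{B}_2=\{0\}\times\mathbb{R}$, $\mathcal{B}(r)=[0,r]^2$, $\mathcal{B}^\epsilon(r)=(\epsilon\mathbb{Z})^2\cap[0,r]^2$, $\mathcal{B}_i^\epsilon=\mathcal{B}_i\cap(\epsilon\mathbb{Z})^2$. On $(\epsilon\mathbb{Z})^2$: $(\tau_i f)(u)=f(u+\epsilon e_i)$, $\delta_i=\epsilon^{-1}(\tau_i-1)$, $\delta^\alpha=\delta_1^{\alpha_1}\delta_2^{\alpha_2}$. $\mathbb{S}^2\subset\mathbb{R}^3$ is the unit sphere. A K-surface is a surface in $\mathbb{R}^3$ with Gaussian curvature $K=-1$, parametrized along asymptotic lines. Its Gauss map $n$ with values in $\mathbb{S}^2$ satisfies $\partial_1\partial_2n=-\langle\partial_1n,\partial_2n\rangle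 n$, and $\partial_1f=\partial_1n\times n$, $\partial_2f=n\times\partial_2n$. Initial data (K): two smooth curves $n|_{\mathcal{B}_1}$, $n|_{\mathcal{B}_2}$ in $\mathbb{S}^2$ with a common point $n(0)$ (together with $f(0)$ fixing the translation). Canonical discrete K-surfaces for (K): $n^\epsilon:(\epsilon\mathbb{Z})^2\to\mathbb{S}^2$ solves $\tau_1\tau_2n+n=a_{12}(\tau_1n+\tau_2n)$, $a_{12}=\frac{\langle n,\tau_1n+\tau_2n\rangle}{1+\langle\tau_1n,\tau_2n\rangle}$, with $n^\epsilon=n$ on $\mathcal{B}_i^\epsilon$; and $\delta_1f^\epsilon=\delta_1n^\epsilon\times n^\epsilon$, $\delta_2f^\epsilon=n^\epsilon\times\delta_2n^\epsilon$. Bäcklund transform: a K-surface $f^+$ such that the line through $f(u),f^+(u)$ is tangent to both surfaces at the corresponding points and $|f^+-f|$ is constant. In terms of Gauss maps, $f^+=f+n^+\times n$ with $n^+$ taking values in $\mathbb{S}^2$ and $$\partial_1n^++\partial_1n=p_1(n^+-n),\quad p_1=\frac{\langle\partial_1n,n^+\rangle}{1-\langle n,n^+\rangle},\qquad \partial_2n^+-\partial_2n=p_2(n^++n),\quad p_2=\frac{-\langle\partial_2n,n^+\rangle}{1+\langle n,n^+\rangle}.$$ Initial data (B): a point $n^+(0)\in\mathbb{S}^2$. Discrete Bäcklund transform of $f^\epsilon$ with data (B): $(f^\epsilon)^+=f^\epsilon+(n^\epsilon)^+\times n^\epsilon$, where (dropping $\epsilon$) $$\tau_1n^+-n=b_1(n^+-\tau_1n),\quad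 b_1=\frac{\langle n,\tau_1n-n^+\rangle}{1-\langle\tau_1n,n^+\rangle},\qquad\tau_2n^++n=b_2(n^++\tau_2n),\quad b_2=\frac{\langle n,\tau_2n+n^+\rangle}{1+\langle\tau_2n,n^+\rangle},$$ with $(n^\epsilon)^+(0)=n^+(0)$. Convergence $g^\epsilon\to g$ with the order $O(\epsilon)$ in $C^\infty(\mathcal{B}(r))$ means: for every multi-index $\alpha$ there is $c_\alpha$ such that $|\delta^\alpha(g^\epsilon-g)(u)|\le c_\alpha\epsilon$ for all sufficiently small $\epsilon>0$ and all $u\in\mathcal{B}^\epsilon(r)$ at which this difference quotient is defined on $\mathcal{B}^\epsilon(r)$. *)

(* Defs.v *)
From Stdlib Require Import Reals List.
From Coquelicot Require Import Coquelicot.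
Open Scope R_scope.

(* Coquelicot's product norm on R * R * R is the Euclidean one. *)
Definition vec3 : Type := (R * R * R)%type.
Definition vec2 : Type := (R * R)%type.

Definition vx (v : vec3) : R := fst (fst v).
Definition vy (v : vec3) : R := snd (fst v).
Definition vz (v : vec3) : R := snd v.

Definition dot (v w : vec3) : R := vx v * vx w + vy v * vy w + vz v * vz w.

Definition cross (v w : vec3) : vec3 :=
  (vy v * vz w - vz v * vy w, vz v * vx w - vx v * vz w, vx v * vy w - vy v * vx w).

Definition vadd (v w : vec3) : vec3 := plus v w.
Definition vsub (v w : vec3) : vec3 := minus v w.
Definition vopp (v : vec3) : vec3 := opp v.
Definition vscal (a : R) (v : vec3) : vec3 := scal a v.

Declare Scope vec_scope.
Delimit Scope vec_scope with V.
Bind Scope vec_scope with vec3.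
Infix "+" := vadd : vec_scope.
Infix "-" := vsub : vec_scope.
Notation "- v" := (vopp v) : vec_scope.
Notation "a *: v" := (vscal a v) (at level 40, left associativity) : vec_scope.

Definition sphere (v : vec3) : Prop := norm v = 1.

Inductive axis : Set := ax1 | ax2.

Definition move (i : axis) (h : R) (u : vec2) : vec2 :=
  match i with
  | ax1 => (fst u + h, snd u)
  | ax2 => (fst u, snd u + h)
  end.

Definition square (r : R) (u : vec2) : Prop :=
  0 <= fst u <= r /\ 0 <= snd u <= r.

(* Partial derivatives are taken within D, hence one-sided at the boundary. *)
Definition is_partial (D : vec2 -> Prop) (i : axis) (g : vec2 -> R) (u : vec2) (d : R)
  : Prop :=
  filterlim (fun h : R => (g (move i h u) - g u) / h)
    (within (fun h : R => D (move i h u)) (locally' 0)) (locally d).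

Definition partial (D : vec2 -> Prop) (i : axis) (g : vec2 -> R) (u : vec2) : R :=
  iota (fun d : R => is_partial D i g u d).

Fixpoint partials (D : vec2 -> Prop) (w : list axis) (g : vec2 -> R) : vec2 -> R :=
  match w with
  | nil => g
  | i :: w' => partial D i (partials D w' g)
  end.

Definition smooth_on (D : vec2 -> Prop) (g : vec2 -> R) : Prop :=
  forall (w : list axis) (u : vec2), D u ->
    filterlim (partials D w g) (within D (locally u)) (locally (partials D w g u)) /\
    forall i : axis, exists d : R, is_partial D i (partials D w g) u d.

Definition vsmooth_on (D : vec2 -> Prop) (g : vec2 -> vec3) : Prop :=
  smooth_on D (fun u => vx (g u)) /\
  smooth_on D (fun u => vy (g u)) /\
  smooth_on D (fun u => vz (g u)).

Definition vpartial (D : vec2 -> Prop) (i : axis) (g : vec2 -> vec3) (u : vec2) : vec3 :=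
  (partial D i (fun u => vx (g u)) u,
   partial D i (fun u => vy (g u)) u,
   partial D i (fun u => vz (g u)) u).

Definition smooth_curve (c : R -> vec3) : Prop :=
  forall (k : nat) (t : R),
    ex_derive_n (fun s => vx (c s)) k t /\
    ex_derive_n (fun s => vy (c s)) k t /\
    ex_derive_n (fun s => vz (c s)) k t.

Definition metric_det (D : vec2 -> Prop) (f : vec2 -> vec3) (u : vec2) : R :=
  let f1 := vpartial D ax1 f u in
  let f2 := vpartial D ax2 f u in
  dot f1 f1 * dot f2 f2 - dot f1 f2 * dot f1 f2.

Definition second_form (D : vec2 -> Prop) (n f : vec2 -> vec3) (i j : axis) (u : vec2) : R :=
  dot (vpartial D i (vpartial D j f) u) (n u).

Definition gauss_curvature (D : vec2 -> Prop) (n f : vec2 -> vec3) (u : vec2) : R :=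
  (second_form D n f ax1 ax1 u * second_form D n f ax2 ax2 u
   - second_form D n f ax1 ax2 u * second_form D n f ax1 ax2 u) / metric_det D f u.

(* The surface f, with Gauss map n, may fail to be immersed: the initial curves
   are arbitrary.  The curvature is prescribed where f is immersed. *)
Record K_surface (D : vec2 -> Prop) (n f : vec2 -> vec3) : Prop := {
  K_smooth_n : vsmooth_on D n;
  K_smooth_f : vsmooth_on D f;
  K_sphere : forall u, D u -> sphere (n u);
  K_normal : forall u i, D u -> dot (vpartial D i f u) (n u) = 0;
  K_asymptotic : forall u i, D u -> second_form D n f i i u = 0;
  K_curvature : forall u, D u -> metric_det D f u <> 0 -> gauss_curvature D n f u = -1;
  K_gauss_eq : forall u, D u ->
    vpartial D ax1 (vpartial D ax2 n) u
    = ((- dot (vpartial D ax1 n u) (vpartial D ax2 n u))%R *: n u)%V;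
  K_d1f : forall u, D u -> vpartial D ax1 f u = cross (vpartial D ax1 n u) (n u);
  K_d2f : forall u, D u -> vpartial D ax2 f u = cross (n u) (vpartial D ax2 n u)
}.

Definition K_data (r : R) (n1 n2 : R -> vec3) (f0 : vec3) (n f : vec2 -> vec3) : Prop :=
  (forall t, 0 <= t <= r -> n (t, 0) = n1 t) /\
  (forall t, 0 <= t <= r -> n (0, t) = n2 t) /\
  f (0, 0) = f0.

(* (np, fp) is a Baecklund transform of (n, f): the geometric description first,
   then the equations for the Gauss maps.  The latter also fix the sign of
   fp - f, which the geometric description leaves open. *)
Record backlund (D : vec2 -> Prop) (n f np fp : vec2 -> vec3) : Prop := {
  B_K_surface : K_surface D np fp;
  B_tangent : forall u, D u ->
    dot (fp u - f u)%V (n u) = 0 /\ dot (fp u - f u)%V (np u) = 0;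
  B_distance : exists d : R, forall u, D u -> norm (fp u - f u)%V = d;
  B_formula : forall u, D u -> fp u = (f u + cross (np u) (n u))%V;
  B_d1 : forall u, D u ->
    let p1 := dot (vpartial D ax1 n u) (np u) / (1 - dot (n u) (np u)) in
    1 - dot (n u) (np u) <> 0 /\
    (vpartial D ax1 np u + vpartial D ax1 n u)%V = (p1 *: (np u - n u))%V;
  B_d2 : forall u, D u ->
    let p2 := - dot (vpartial D ax2 n u) (np u) / (1 + dot (n u) (np u)) in
    1 + dot (n u) (np u) <> 0 /\
    (vpartial D ax2 np u - vpartial D ax2 n u)%V = (p2 *: (np u + n u))%V
}.

(* Lattice functions are functions on the plane of which only the values on the
   lattice are ever constrained or used. *)
Definition lattice (eps : R) (u : vec2) : Prop :=
  exists k l : Z, u = (IZR k * eps, IZR l * eps).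

Definition grid (eps r : R) (u : vec2) : Prop := lattice eps u /\ square r u.

Definition tau (eps : R) (i : axis) (g : vec2 -> vec3) (u : vec2) : vec3 :=
  g (move i eps u).

Definition delta (eps : R) (i : axis) (g : vec2 -> vec3) (u : vec2) : vec3 :=
  (/ eps *: (tau eps i g u - g u))%V.

Definition delta_multi (eps : R) (a1 a2 : nat) (g : vec2 -> vec3) : vec2 -> vec3 :=
  Nat.iter a1 (delta eps ax1) (Nat.iter a2 (delta eps ax2) g).

(* Every equation is imposed wherever all the lattice points it involves lie in
   the square; the denominators must not vanish there. *)
Record discrete_K_surface (eps r : R) (n f : vec2 -> vec3) : Prop := {
  dK_sphere : forall u, grid eps r u -> sphere (n u);
  dK_gauss_eq : forall u, grid eps r u -> grid eps r (move ax1 eps (move ax2 eps u)) ->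
    let n1 := tau eps ax1 n u in
    let n2 := tau eps ax2 n u in
    let a12 := dot (n u) (n1 + n2)%V / (1 + dot n1 n2) in
    1 + dot n1 n2 <> 0 /\
    (tau eps ax1 (tau eps ax2 n) u + n u)%V = (a12 *: (n1 + n2))%V;
  dK_d1f : forall u, grid eps r u -> grid eps r (move ax1 eps u) ->
    delta eps ax1 f u = cross (delta eps ax1 n u) (n u);
  dK_d2f : forall u, grid eps r u -> grid eps r (move ax2 eps u) ->
    delta eps ax2 f u = cross (n u) (delta eps ax2 n u)
}.

Definition discrete_K_data (eps r : R) (n1 n2 : R -> vec3) (f0 : vec3)
    (n f : vec2 -> vec3) : Prop :=
  (forall t, grid eps r (t, 0) -> n (t, 0) = n1 t) /\
  (forall t, grid eps r (0, t) -> n (0, t) = n2 t) /\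
  f (0, 0) = f0.

Record discrete_backlund (eps r : R) (n f np fp : vec2 -> vec3) : Prop := {
  dB_sphere : forall u, grid eps r u -> sphere (np u);
  dB_formula : forall u, grid eps r u -> fp u = (f u + cross (np u) (n u))%V;
  dB_1 : forall u, grid eps r u -> grid eps r (move ax1 eps u) ->
    let n1 := tau eps ax1 n u in
    let b1 := dot (n u) (n1 - np u)%V / (1 - dot n1 (np u)) in
    1 - dot n1 (np u) <> 0 /\
    (tau eps ax1 np u - n u)%V = (b1 *: (np u - n1))%V;
  dB_2 : forall u, grid eps r u -> grid eps r (move ax2 eps u) ->
    let n2 := tau eps ax2 n u in
    let b2 := dot (n u) (n2 + np u)%V / (1 + dot n2 (np u)) in
    1 + dot n2 (np u) <> 0 /\
    (tau eps ax2 np u + n u)%V = (b2 *: (np u + n2))%V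
}.

(* The difference quotient of order (a1, a2) at u involves the lattice points
   from u to u + eps (a1, a2), so it is defined when both of these are in the
   square. *)
Definition converges_Oeps_Cinf (r : R) (geps : R -> vec2 -> vec3) (g : vec2 -> vec3)
  : Prop :=
  forall a1 a2 : nat, exists c : R, exists eps1 : R, 0 < eps1 /\
    forall eps : R, 0 < eps < eps1 ->
    forall u : vec2, grid eps r u ->
      grid eps r (move ax1 (INR a1 * eps) (move ax2 (INR a2 * eps) u)) ->
      norm (delta_multi eps a1 a2 (fun v => geps eps v - g v)%V u) <= c * eps.

(* Main.v *)
(** The equations for (n, n+, f) are, on the lattice as well as in the plane, a
    hyperbolic system: with v_i = delta_i n,
      delta_1 delta_2 n = - <v_1, v_2> (tau_1 n + tau_2 n) / (1 + <tau_1 n, tau_2 n>),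
    delta_i n+ is a rational function of n, v_i, n+, and the mesh size enters
    these right-hand sides smoothly.  Three conservation laws make everything
    global: |n| = 1, |v_1| does not change in direction 2 (nor |v_2| in
    direction 1), and <n, n+> is constant; so all denominators stay away from 0
    and r = 1 works.

    A discrete Gronwall estimate for linear Goursat problems, together with the
    Leibniz rule, bounds all difference quotients of the discrete solutions
    uniformly in the mesh.  The limit of the discrete solutions along an
    ultrafilter is therefore smooth, and since this limit is a ring
    homomorphism, the discrete equations become the smooth ones: this is how the
    K-surface and its Baecklund transform are obtained.  Finally, the quotient
    (discrete - smooth) / eps again solves a linear Goursat problem, hence is
    bounded with all its difference quotients; this is the convergence in C^oo,
    and, applied at order 0 to an arbitrary smooth solution, the uniqueness.

    That discrete Baecklund transforms exist and are K-surfaces is the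
    consistency of the three evolutions around a cube. *)

Require Import Defs.
From Stdlib Require Import ZArith Reals Lra Lia List.
From Stdlib Require Import ClassicalEpsilon FunctionalExtensionality.
From Coquelicot Require Import Coquelicot.
From mathcomp.classical Require filter.
Import ListNotations.
Open Scope R_scope.

(** * Families of lattice functions *)

(** The system is nonlinear, so Gronwall alone would bound solutions only for a short time. The
    conservation laws give sup bounds on n, v_i and n+ beforehand; each higher order of difference
    quotients then solves a linear problem whose coefficients are already bounded. All bounds are
    required on every [0, R']^2 with R' < R0, since a shift needs room; the data are used with R0 =
    2 and the theorem with r = 1.

    An ultrafilter gives limits at all points and for all difference quotients simultaneously,
    without extracting subsequences. That it selects special meshes does no harm: the comparison
    afterwards holds for every small mesh.

    Comparison in C^N needs smooth solutions whose mixed derivatives commute in every order. Limits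
    have this for free, since difference quotients commute. An arbitrary smooth solution is compared
    at order 0 only, which costs a single exchange of second derivatives and suffices for
    uniqueness. *)

Definition other (b : axis) : axis := match b with ax1 => ax2 | ax2 => ax1 end.

(* p e i j is the value at the lattice point (i e, j e) for the mesh size e. *)
Definition fam : Type := R -> nat -> nat -> R.

Declare Scope fam_scope.
Delimit Scope fam_scope with fam.
Bind Scope fam_scope with fam.

Definition fcst (c : R) : fam := fun _ _ _ => c.
Definition feps : fam := fun e _ _ => e.
Definition fadd (p q : fam) : fam := fun e i j => p e i j + q e i j.
Definition fopp (p : fam) : fam := fun e i j => - p e i j.
Definition fmul (p q : fam) : fam := fun e i j => p e i j * q e i j.
Definition finv (p : fam) : fam := fun e i j => / p e i j.
Infix "+" := fadd : fam_scope.
Infix "*" := fmul : fam_scope.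
Notation "- p" := (fopp p) : fam_scope.
Notation "p - q" := (fadd p (fopp q)) : fam_scope.

(* tn and dl are the tau and delta of the statement. *)
Definition tn (b : axis) (p : fam) : fam :=
  match b with
  | ax1 => fun e i j => p e (S i) j
  | ax2 => fun e i j => p e i (S j)
  end.
Definition dl (b : axis) (p : fam) : fam := fun e i j => (tn b p e i j - p e i j) / e.

Ltac fam_ext := apply functional_extensionality; intros ?e;
  apply functional_extensionality; intros ?i; apply functional_extensionality; intros ?j.

Lemma dl_add b p q : dl b (p + q)%fam = (dl b p + dl b q)%fam.
Proof. fam_ext. destruct b; unfold dl, fadd, tn, Rdiv; ring. Qed.
Lemma dl_opp b p : dl b (- p)%fam = (- dl b p)%fam.
Proof. fam_ext. destruct b; unfold dl, fopp, tn, Rdiv; ring. Qed.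
Lemma dl_mul b p q : dl b (p * q)%fam = (dl b p * q + tn b p * dl b q)%fam.
Proof. fam_ext. destruct b; unfold dl, fmul, fadd, tn, Rdiv; ring. Qed.
Lemma dl_cst b c : dl b (fcst c) = fcst 0.
Proof. fam_ext. destruct b; unfold dl, fcst, tn, Rdiv; ring. Qed.
Lemma dl_eps b : dl b feps = fcst 0.
Proof. fam_ext. destruct b; unfold dl, fcst, feps, tn, Rdiv; ring. Qed.
Lemma dl_tn b b' p : dl b (tn b' p) = tn b' (dl b p).
Proof. fam_ext. destruct b, b'; reflexivity. Qed.
Lemma dl_comm b b' p : dl b (dl b' p) = dl b' (dl b p).
Proof. fam_ext. destruct b, b'; unfold dl, tn, Rdiv; ring. Qed.

Ltac min_facts a b := lazymatch goal with
  | _ : Rmin a b <= a |- _ => fail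
  | _ => pose proof (Rmin_l a b); pose proof (Rmin_r a b)
  end.
Ltac rmins := repeat match goal with
  | _ : context[Rmin ?a ?b] |- _ => min_facts a b
  | |- context[Rmin ?a ?b] => min_facts a b
  end.

Section Families.
Variable R0 : R.

Definition near (R' : R) (Q : R -> nat -> nat -> Prop) : Prop :=
  exists e1, 0 < e1 /\ forall e, 0 < e < e1 ->
    forall i j, INR i * e <= R' -> INR j * e <= R' -> Q e i j.

(* The bounds hold on every [0, R']^2 with R' < R0, for mesh sizes depending on
   R'; this makes them stable under shifts. *)
Definition ev (Q : R -> nat -> nat -> Prop) : Prop := forall R', R' < R0 -> near R' Q.
Definition bd (p : fam) : Prop :=
  forall R', R' < R0 -> exists C, near R' (fun e i j => Rabs (p e i j) <= C).
Definition feq (p q : fam) : Prop := ev (fun e i j => p e i j = q e i j).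

Lemma near_and R' Q1 Q2 : near R' Q1 -> near R' Q2 -> near R' (fun e i j => Q1 e i j /\ Q2 e i j).
Proof.
intros [a [Ha H1]] [b [Hb H2]]. exists (Rmin a b).
split; [now apply Rmin_glb_lt|]. intros e He i j Hi Hj.
rmins.
split; [apply H1 | apply H2]; auto; lra.
Qed.

Lemma near_mono R' (Q1 Q2 : R -> nat -> nat -> Prop) :
  (forall e i j, 0 < e -> Q1 e i j -> Q2 e i j) -> near R' Q1 -> near R' Q2.
Proof.
intros H [a [Ha H1]]. exists a. split; [easy|]. intros e He i j Hi Hj. apply H; [lra|auto].
Qed.

(** A shift leaves the square of side R' by at most one mesh size, which R' < R'' absorbs as soon as
    e < R'' - R'. *)
Lemma near_tn b (p : fam) (Q : R -> Prop) R' R'' : R' < R'' ->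
  near R'' (fun e i j => Q (p e i j)) -> near R' (fun e i j => Q (tn b p e i j)).
Proof.
intros HR [a [Ha H]]. exists (Rmin a (R'' - R')).
split; [apply Rmin_glb_lt; lra|]. intros e He i j Hi Hj.
rmins.
destruct b; simpl; apply H; rewrite ?S_INR; lra.
Qed.

Lemma ev_and Q1 Q2 : ev Q1 -> ev Q2 -> ev (fun e i j => Q1 e i j /\ Q2 e i j).
Proof. intros H1 H2 R' HR. apply near_and; auto. Qed.

Lemma ev_mono (Q1 Q2 : R -> nat -> nat -> Prop) :
  (forall e i j, 0 < e -> Q1 e i j -> Q2 e i j) -> ev Q1 -> ev Q2.
Proof. intros H H1 R' HR. now apply (near_mono R' Q1), H1. Qed.

Lemma ev_all (Q : R -> nat -> nat -> Prop) : (forall e i j, 0 < e -> Q e i j) -> ev Q.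
Proof. intros H R' HR. exists 1. split; [lra|]. intros e He i j _ _. apply H; lra. Qed.

Definition shq (b : axis) (Q : R -> nat -> nat -> Prop) : R -> nat -> nat -> Prop :=
  match b with ax1 => fun e i j => Q e (S i) j | ax2 => fun e i j => Q e i (S j) end.

Lemma ev_sh b Q : ev Q -> ev (shq b Q).
Proof.
intros H R' HR. destruct (H ((R' + R0) / 2)) as [a [Ha H1]]; [lra|].
exists (Rmin a ((R0 - R') / 2)). split; [apply Rmin_glb_lt; lra|].
intros e He i j Hi Hj.
rmins.
destruct b; simpl; apply H1; rewrite ?S_INR; lra.
Qed.

Lemma feq_refl p : feq p p.
Proof. apply ev_all; reflexivity. Qed.
Lemma feq_sym p q : feq p q -> feq q p.
Proof. apply ev_mono. congruence. Qed.
Lemma feq_tn b p q : feq p q -> feq (tn b p) (tn b q).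
Proof. intros H. generalize (ev_sh b _ H). destruct b; exact (fun h => h). Qed.
Lemma feq_dl b p q : feq p q -> feq (dl b p) (dl b q).
Proof.
intros H. generalize (ev_and _ _ H (feq_tn b _ _ H)). apply ev_mono.
unfold dl. intros e i j _ [-> ->]; reflexivity.
Qed.
Lemma feq_add p p' q q' : feq p p' -> feq q q' -> feq (p + q)%fam (p' + q')%fam.
Proof. intros H1 H2. generalize (ev_and _ _ H1 H2). apply ev_mono. unfold fadd. intros e i j _ [-> ->]; reflexivity. Qed.
Lemma feq_mul p p' q q' : feq p p' -> feq q q' -> feq (p * q)%fam (p' * q')%fam.
Proof. intros H1 H2. generalize (ev_and _ _ H1 H2). apply ev_mono. unfold fmul. intros e i j _ [-> ->]; reflexivity. Qed.
Lemma feq_opp p p' : feq p p' -> feq (- p)%fam (- p')%fam.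
Proof. apply ev_mono. unfold fopp. intros e i j _ ->; reflexivity. Qed.

(** This is why shifts disappear in the limit: they differ from the identity by e times a bounded
    quotient. *)
Lemma tn_dl b p : feq (tn b p) (p + feps * dl b p)%fam.
Proof. apply ev_all. intros e i j He. unfold fadd, fmul, feps, dl. field. lra. Qed.

Lemma bd_feq p q : feq p q -> bd p -> bd q.
Proof.
intros H Hp R' HR. destruct (Hp R' HR) as [C HC]. exists C.
generalize (near_and _ _ _ HC (H R' HR)). apply near_mono. intros e i j _ [h <-]; exact h.
Qed.
Lemma bd_cst c : bd (fcst c).
Proof. intros R' HR. exists (Rabs c). exists 1. split; [lra|]. intros. apply Rle_refl. Qed.
Lemma bd_eps : bd feps.
Proof. intros R' HR. exists 1. exists 1. split; [lra|]. intros e He i j _ _. unfold feps. rewrite Rabs_pos_eq; lra. Qed.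
Lemma bd_add p q : bd p -> bd q -> bd (p + q)%fam.
Proof.
intros Hp Hq R' HR. destruct (Hp R' HR) as [C HC]. destruct (Hq R' HR) as [C' HC'].
exists (C + C'). generalize (near_and _ _ _ HC HC'). apply near_mono.
intros e i j _ [h h']. unfold fadd. pose proof (Rabs_triang (p e i j) (q e i j)). lra.
Qed.
Lemma bd_opp p : bd p -> bd (- p)%fam.
Proof.
intros Hp R' HR. destruct (Hp R' HR) as [C HC]. exists C. revert HC. apply near_mono.
intros e i j _ h. unfold fopp. now rewrite Rabs_Ropp.
Qed.
Lemma bd_mul p q : bd p -> bd q -> bd (p * q)%fam.
Proof.
intros Hp Hq R' HR. destruct (Hp R' HR) as [C HC]. destruct (Hq R' HR) as [C' HC'].
exists (C * C'). generalize (near_and _ _ _ HC HC'). apply near_mono.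
intros e i j _ [h h']. unfold fmul. rewrite Rabs_mult.
apply Rmult_le_compat; auto using Rabs_pos.
Qed.
Lemma bd_tn b p : bd p -> bd (tn b p).
Proof.
intros Hp R' HR. destruct (Hp ((R' + R0) / 2)) as [C HC]; [lra|]. exists C.
apply (near_tn b p (fun x => Rabs x <= C) R' ((R' + R0) / 2)); [lra|exact HC].
Qed.

(* C^N bounds uniform in the mesh: all difference quotients of order at most N
   are bounded. *)
Fixpoint B (N : nat) (p : fam) : Prop :=
  bd p /\ match N with O => True | S N' => forall b, B N' (dl b p) end.

Lemma B_bd N p : B N p -> bd p.
Proof. destruct N; intros [H _]; exact H. Qed.
Lemma B_dl N b p : B (S N) p -> B N (dl b p).
Proof. intros [_ H]; apply H. Qed.
Lemma B_S N p : bd p -> (forall b, B N (dl b p)) -> B (S N) p.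
Proof. now split. Qed.
Lemma B_pred N p : B (S N) p -> B N p.
Proof.
revert p. induction N as [|N IH]; intros p H; [split; [now apply (B_bd 1)|exact I]|].
apply B_S; [now apply (B_bd (S (S N)))|]. intros b. apply IH. now apply B_dl.
Qed.
Lemma B_le N M p : (N <= M)%nat -> B M p -> B N p.
Proof. induction 1 as [|M _ IH]; auto. intros H. apply IH. now apply B_pred. Qed.
Lemma B_feq N p q : feq p q -> B N p -> B N q.
Proof.
revert p q. induction N as [|N IH]; intros p q H HB.
- split; [|exact I]. apply (bd_feq p); [exact H|]. now apply (B_bd 0).
- apply B_S; [apply (bd_feq p); [exact H|now apply (B_bd (S N))]|].
  intros b. apply (IH (dl b p)); [now apply feq_dl | now apply B_dl].
Qed.
Lemma B_cst N c : B N (fcst c).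
Proof.
revert c. induction N as [|N IH]; intros c; (split; [apply bd_cst|]); [exact I|].
intros b. rewrite dl_cst. apply IH.
Qed.
Lemma B_eps N : B N feps.
Proof.
destruct N; (split; [apply bd_eps|]); [exact I|]. intros b. rewrite dl_eps. apply B_cst.
Qed.
Lemma B_add N p q : B N p -> B N q -> B N (p + q)%fam.
Proof.
revert p q. induction N as [|N IH]; intros p q [Hp Hp'] [Hq Hq']; (split; [now apply bd_add|]); [exact I|].
intros b. rewrite dl_add. now apply IH.
Qed.
Lemma B_opp N p : B N p -> B N (- p)%fam.
Proof.
revert p. induction N as [|N IH]; intros p [Hp Hp']; (split; [now apply bd_opp|]); [exact I|].
intros b. rewrite dl_opp. now apply IH.
Qed.
Lemma B_tn N b p : B N p -> B N (tn b p).
Proof.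
revert p. induction N as [|N IH]; intros p [Hp Hp']; (split; [now apply bd_tn|]); [exact I|].
intros b'. rewrite dl_tn. now apply IH.
Qed.
Lemma B_mul N p q : B N p -> B N q -> B N (p * q)%fam.
Proof.
revert p q. induction N as [|N IH]; intros p q Hp Hq;
  (split; [apply bd_mul; eapply B_bd; eassumption|]); [exact I|].
intros b. rewrite dl_mul. apply B_add; apply IH; try (now apply B_dl); try (now apply B_pred).
apply B_tn. now apply B_pred.
Qed.

(** Invertibility in the ring of bounded families: the product equation excludes zeros of p,
    whatever the value of [/ 0], and the bound keeps p at a distance from 0. *)
Definition away (p : fam) : Prop := feq (p * finv p)%fam (fcst 1) /\ bd (finv p).

Lemma away_lower p (c : R) : 0 < c -> ev (fun e i j => c <= Rabs (p e i j)) -> away p.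
Proof.
intros Hc H. split.
- revert H. apply ev_mono. intros e i j _ h. unfold fmul, finv, fcst. field.
  intros h0. rewrite h0, Rabs_R0 in h. lra.
- intros R' HR. exists (/ c). generalize (H R' HR). apply near_mono. intros e i j _ h.
  unfold finv. rewrite Rabs_inv. now apply Rinv_le_contravar.
Qed.

Lemma away_ne p : away p -> ev (fun e i j => p e i j <> 0).
Proof.
intros [H _]. revert H. apply ev_mono. unfold fmul, finv, fcst. intros e i j _ h h0.
rewrite h0 in h. lra.
Qed.

(** The quotient rule on the lattice is dl (1/p) = - dl p / (p tn p), so one order of p gives one
    order of 1/p. *)
Lemma B_inv N p : away p -> B N p -> B N (finv p).
Proof.
intros Ha. induction N as [|N IH]; intros Hp; [split; [apply Ha|exact I]|].
apply B_S; [apply Ha|]. intros b.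
apply (B_feq N (- (finv p * tn b (finv p) * dl b p))%fam).
- generalize (away_ne p Ha). intros Hn. generalize (ev_and _ _ Hn (ev_sh b _ Hn)). apply ev_mono.
  destruct b; unfold shq, fopp, fmul, finv, dl, tn; intros e i j He [h h']; field; repeat split; auto; lra.
- assert (Hi : B N (finv p)) by (apply IH; now apply B_pred).
  apply B_opp, B_mul; [apply B_mul; [exact Hi | now apply B_tn] | now apply B_dl].
Qed.

(** * Linear combinations of families, and linearization *)

Section Span.
Variable N : nat.
Variable Y : fam -> Prop.

(** The affine module generated by Y over the families bounded in C^N, [span_B] being the
    inhomogeneous terms. Thus [span N Y (dl b y)] says that y satisfies a linear difference equation
    in the unknowns Y, without naming its coefficients. *)
Inductive span : fam -> Prop :=
| span_B d : B N d -> span d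
| span_gen y : Y y -> span y
| span_add p q : span p -> span q -> span (p + q)%fam
| span_mul c p : B N c -> span p -> span (c * p)%fam
| span_feq p q : feq p q -> span p -> span q.

Lemma span_opp p : span p -> span (- p)%fam.
Proof.
intros H. apply (span_feq (fcst (-1) * p)%fam); [|apply span_mul; [apply B_cst|exact H]].
apply ev_all. intros. unfold fmul, fcst, fopp. ring.
Qed.

Definition quot (p q : fam) : fam := (finv feps * (p - q))%fam.

(* For Y empty this is p = q + O(e) in C^N.  For q = tn b p the quotient is
   dl b p, so that linearized and differenced equations are treated alike. *)
Definition sim (p q : fam) : Prop := B N p /\ B N q /\ span (quot p q).

Lemma sim_refl p : B N p -> sim p p.
Proof.
intros H. split; [|split]; auto. apply (span_feq (fcst 0)); [|apply span_B, B_cst].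
apply ev_all. intros. unfold quot, fmul, fcst, fadd, fopp. ring.
Qed.
Lemma sim_quot p q r : B N q -> B N r -> feq p (q + feps * r)%fam -> sim p q.
Proof.
intros Hq Hr H. split; [|split]; auto.
- apply (B_feq N (q + feps * r)%fam); [now apply feq_sym|].
  apply B_add; [exact Hq|]. apply B_mul; [apply B_eps|exact Hr].
- apply (span_feq r); [|now apply span_B]. apply feq_sym. revert H. apply ev_mono.
  unfold quot, fmul, fadd, fopp, finv, feps. intros e i j He ->. field. lra.
Qed.
Lemma sim_feq p p' q q' : feq p p' -> feq q q' -> sim p q -> sim p' q'.
Proof.
intros Hp Hq [H1 [H2 H3]]. split; [now apply (B_feq N p)|split; [now apply (B_feq N q)|]].
apply (span_feq (quot p q)); [|exact H3]. unfold quot. apply feq_mul; [apply feq_refl|].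
apply feq_add; [exact Hp|now apply feq_opp].
Qed.
Lemma sim_add p p' q q' : sim p q -> sim p' q' -> sim (p + p')%fam (q + q')%fam.
Proof.
intros [H1 [H2 H3]] [H1' [H2' H3']]. split; [now apply B_add|split; [now apply B_add|]].
apply (span_feq (quot p q + quot p' q')%fam); [|now apply span_add].
apply ev_all. intros. unfold quot, fmul, fadd, fopp. ring.
Qed.
Lemma sim_opp p q : sim p q -> sim (- p)%fam (- q)%fam.
Proof.
intros [H1 [H2 H3]]. split; [now apply B_opp|split; [now apply B_opp|]].
apply (span_feq (- quot p q)%fam); [|now apply span_opp].
apply ev_all. intros. unfold quot, fmul, fadd, fopp. ring.
Qed.
(** By pp' - qq' = p'(p - q) + q(p' - q') a product is linearized with coefficients in B N. With the
    sum and the inverse this linearizes every rational right-hand side by following its syntax. *)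
Lemma sim_mul p p' q q' : sim p q -> sim p' q' -> sim (p * p')%fam (q * q')%fam.
Proof.
intros [H1 [H2 H3]] [H1' [H2' H3']]. split; [now apply B_mul|split; [now apply B_mul|]].
apply (span_feq (p' * quot p q + q * quot p' q')%fam).
- apply ev_all. intros. unfold quot, fmul, fadd, fopp. ring.
- apply span_add; apply span_mul; auto.
Qed.
Lemma sim_inv p q : away p -> away q -> sim p q -> sim (finv p) (finv q).
Proof.
intros Hp Hq [H1 [H2 H3]].
assert (Hp' : B N (finv p)) by now apply B_inv.
assert (Hq' : B N (finv q)) by now apply B_inv.
split; [|split]; auto.
apply (span_feq ((- (finv p * finv q)) * quot p q)%fam).
- generalize (ev_and _ _ (away_ne p Hp) (away_ne q Hq)). apply ev_mono.
  intros e i j He [h h']. unfold quot, fmul, fadd, fopp, finv, feps. field. repeat split; auto; lra.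
- apply span_mul; [|exact H3]. apply B_opp. now apply B_mul.
Qed.
Lemma sim_eps : sim feps (fcst 0).
Proof.
apply (sim_quot _ _ (fcst 1)); try apply B_cst. apply ev_all. intros. unfold fadd, fmul, fcst, feps; ring.
Qed.
Lemma sim_sym p q : sim p q -> sim q p.
Proof.
intros [H1 [H2 H3]]. split; [|split]; auto. apply (span_feq (- quot p q)%fam); [|now apply span_opp].
apply ev_all. intros. unfold quot, fmul, fadd, fopp. ring.
Qed.
End Span.

Lemma quot_tn b p : quot (tn b p) p = dl b p.
Proof. fam_ext. unfold quot, dl, fmul, fadd, fopp, finv, feps, Rdiv. ring. Qed.

Lemma span_B_all N (Y : fam -> Prop) p : (forall y, Y y -> B N y) -> span N Y p -> B N p.
Proof.
intros H. induction 1; auto.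
- now apply B_add.
- now apply B_mul.
- now apply (B_feq N p).
Qed.
Lemma span_le N M Y p : (N <= M)%nat -> span M Y p -> span N Y p.
Proof.
intros HN. induction 1.
- apply span_B. now apply (B_le N M).
- now apply span_gen.
- now apply span_add.
- apply span_mul; [now apply (B_le N M)|assumption].
- now apply (span_feq _ _ p).
Qed.
(** Leibniz rule for a linear equation: a quotient falling on a coefficient leaves a factor from the
    span of Y, already bounded and hence inhomogeneous; one falling on an unknown is expressed
    through Z. *)
Lemma span_dl N b (Y Z : fam -> Prop) p :
  (forall y, Y y -> B N y) -> (forall y, Y y -> span N Z (dl b y)) ->
  span (S N) Y p -> span N Z (dl b p).
Proof.
intros HB HZ. induction 1 as [d Hd|y Hy|p q Hp IHp Hq IHq|c p Hc Hp IHp|p q Hpq Hp IHp].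
- apply span_B. now apply B_dl.
- now apply HZ.
- rewrite dl_add. now apply span_add.
- rewrite dl_mul. apply span_add.
  + apply span_B. apply B_mul; [now apply B_dl|].
    apply (span_B_all N Y); [exact HB|]. now apply (span_le N (S N)); [lia|].
  + apply span_mul; [apply B_tn; now apply B_pred|exact IHp].
- apply (span_feq _ _ (dl b p)); [now apply feq_dl|exact IHp].
Qed.
(** The constant C is chosen before the point and before M, so the estimate can be applied at each
    lattice point with the current bound M of the unknowns. Requiring 1 <= M lets C * M also cover
    the inhomogeneous terms. *)
Lemma span_bound Y p : span 0 Y p -> forall R', R' < R0 -> exists C, near R' (fun e i j =>
  forall M, 1 <= M -> (forall y, Y y -> Rabs (y e i j) <= M) -> Rabs (p e i j) <= C * M).
Proof.
intros H R' HR. induction H as [d Hd|y Hy|p q Hp [C1 H1] Hq [C2 H2]|c p Hc Hp [C1 H1]|p q Hpq Hp [C1 H1]].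
- destruct (B_bd _ _ Hd R' HR) as [C HC]. exists C. revert HC. apply near_mono.
  intros e i j _ h M HM _. pose proof (Rabs_pos (d e i j)). nra.
- exists 1. exists 1. split; [lra|]. intros e _ i j _ _ M _ h. rewrite Rmult_1_l. now apply h.
- exists (C1 + C2). generalize (near_and _ _ _ H1 H2). apply near_mono.
  intros e i j _ [h1 h2] M HM h. unfold fadd.
  pose proof (Rabs_triang (p e i j) (q e i j)). specialize (h1 M HM h). specialize (h2 M HM h). lra.
- destruct (B_bd _ _ Hc R' HR) as [C HC]. exists (C * C1). generalize (near_and _ _ _ H1 HC).
  apply near_mono. intros e i j _ [h1 h2] M HM h. unfold fmul. rewrite Rabs_mult, Rmult_assoc.
  apply Rmult_le_compat; auto using Rabs_pos.
- exists C1. generalize (near_and _ _ _ H1 (Hpq R' HR)). apply near_mono. intros e i j _ [h <-]. exact h.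
Qed.

End Families.

(** * Linear Goursat problems *)

Definition coord (b : axis) (i j : nat) : nat := match b with ax1 => i | ax2 => j end.

Section Goursat.
Variable R0 : R.
Notation ev := (ev R0).
Notation bd := (bd R0).
Notation B := (B R0).
Notation span := (span R0).
Notation feq := (feq R0).

Definition members (l : list (axis * fam)) (y : fam) : Prop := exists b, In (b, y) l.

(* Each y in l is propagated in a direction b; its data on the line where
   coordinate b vanishes are in B N, unless y is propagated in both directions. *)
Definition initial (N : nat) (l : list (axis * fam)) (b : axis) (y : fam) : Prop :=
  (exists p, B N p /\ ev (fun e i j => coord b i j = 0%nat -> y e i j = p e i j)) \/
  (In (other b, y) l /\ exists p, bd p /\ ev (fun e i j => i = 0%nat -> j = 0%nat -> y e i j = p e i j)).

Lemma near_list {A : Type} (l : list A) (Q : A -> R -> R -> nat -> nat -> Prop) R' :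
  (forall a C C' e i j, C <= C' -> Q a C e i j -> Q a C' e i j) ->
  (forall a, In a l -> exists C, near R' (Q a C)) ->
  exists C, 0 <= C /\ near R' (fun e i j => forall a, In a l -> Q a C e i j).
Proof.
intros Hm. induction l as [|a l IH]; intros H.
- exists 0. split; [lra|]. exists 1. split; [lra|]. intros e _ i j _ _ a [].
- destruct IH as [C [HC0 HC]]; [intros; apply H; now right|].
  destruct (H a) as [C' HC']; [now left|].
  exists (Rmax C C'). pose proof (Rmax_l C C'). pose proof (Rmax_r C C').
  split; [lra|]. generalize (near_and _ _ _ HC HC'). apply near_mono.
  intros e i j _ [h1 h2] a' [<-|Ha']; [now apply (Hm a C')|].
  apply (Hm a' C); auto.
Qed.

Lemma pow_INR_bound q L s e : 0 <= L -> 0 < e -> q = 1 + L * e -> q ^ s <= exp (L * (INR s * e)).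
Proof.
intros HL He ->. induction s as [|s IH]; [simpl; rewrite Rmult_0_l, Rmult_0_r, exp_0; lra|].
rewrite S_INR. replace (L * ((INR s + 1) * e)) with (L * e + L * (INR s * e)) by ring.
rewrite exp_plus. simpl. apply Rmult_le_compat; auto; try (apply pow_le); try nra.
apply exp_ineq1_le.
Qed.

(** Induction over the antidiagonals i + j = s with the bound K' (1 + C e)^s: a point is reached by
    one step in its direction of propagation from the previous antidiagonal. Since s e <= 2 R', the
    power stays below an exponential independent of the mesh. *)
Lemma gronwall (l : list (axis * fam)) :
  (forall b y, In (b, y) l -> span 0 (members l) (dl b y) /\ initial 0 l b y) ->
  forall b y, In (b, y) l -> bd y.
Proof.
intros H b0 y0 H0 R' HR.
destruct (near_list l (fun a C e i j => forall M, 1 <= M ->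
   (forall y, members l y -> Rabs (y e i j) <= M) -> Rabs (dl (fst a) (snd a) e i j) <= C * M) R')
  as [C [HC0 HC]].
{ intros a C C' e i j HCC h M HM hM. specialize (h M HM hM). nra. }
{ intros [b y] Hb. apply span_bound with R0; [now apply H|exact HR]. }
destruct (near_list l (fun a K e i j =>
    (coord (fst a) i j = 0%nat -> In (other (fst a), snd a) l \/ Rabs (snd a e i j) <= K) /\
    (i = 0%nat -> j = 0%nat -> Rabs (snd a e i j) <= K)) R')
  as [K [HK0 HK]].
{ intros a C1 C2 e i j HCC [h1 h2]. split; intros.
  - destruct h1; auto. right; lra.
  - specialize (h2 H1 H2). lra. }
{ intros [b y] Hb. destruct (H b y Hb) as [_ [[p [Hp1 Hp2]]|[Hp0 [p [Hp1 Hp2]]]]].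
  - destruct (B_bd _ _ _ Hp1 R' HR) as [K HK]. exists K. generalize (near_and _ _ _ HK (Hp2 R' HR)).
    apply near_mono. simpl. intros e i j _ [h1 h2]. split; intros.
    + right. now rewrite h2.
    + rewrite h2; auto. destruct b; auto.
  - destruct (Hp1 R' HR) as [K HK]. exists K. generalize (near_and _ _ _ HK (Hp2 R' HR)).
    apply near_mono. simpl. intros e i j _ [h1 h2]. split; intros; [now left|]. now rewrite h2. }
(* K bounds the initial data; the maximum with 1 meets the requirement 1 <= M of [span_bound]. *)
exists (Rmax 1 K * exp (C * (R' + R'))).
destruct (near_and _ _ _ HC HK) as [e1 [He1 He]]. exists e1. split; [exact He1|].
intros e Hee. specialize (He e Hee). clear HC HK.
set (K' := Rmax 1 K). assert (HK1 : 1 <= K') by apply Rmax_l. assert (HK2 : K <= K') by apply Rmax_r.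
set (q := 1 + C * e). assert (Hq : 1 <= q) by (unfold q; nra).
assert (Hpow : forall s, 1 <= q ^ s) by (intros s; now apply pow_R1_Rle).
assert (main : forall s i j, (i + j = s)%nat -> INR i * e <= R' -> INR j * e <= R' ->
   forall y, members l y -> Rabs (y e i j) <= K' * q ^ s).
{ induction s as [|s IH]; intros i j Hs Hi Hj y [b Hb].
  - assert (i = 0%nat) by lia. assert (j = 0%nat) by lia.
    destruct (He i j Hi Hj) as [_ h]. destruct (h (b, y) Hb) as [_ h2]. simpl in h2.
    specialize (h2 ltac:(auto) ltac:(auto)). simpl; lra.
  - assert (step : forall b, In (b, y) l -> coord b i j <> 0%nat -> Rabs (y e i j) <= K' * q ^ S s).
    { clear b Hb. intros b Hb Hc.
      assert (pr : exists i' j', (i' + j' = s)%nat /\ INR i' * e <= R' /\ INR j' * e <= R' /\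
                     y e i j = y e i' j' + e * dl b y e i' j').
      { destruct b; simpl in Hc; [destruct i as [|i]|destruct j as [|j]]; try lia;
         rewrite S_INR in *; [exists i, j|exists i, j]; (split; [lia|split; [nra|split; [nra|]]]);
         unfold dl, tn; field; lra. }
      destruct pr as [i' [j' [Hs' [Hi' [Hj' ->]]]]].
      destruct (He i' j' Hi' Hj') as [h _]. specialize (h (b, y) Hb). simpl in h.
      assert (HM : 1 <= K' * q ^ s) by (specialize (Hpow s); nra).
      specialize (h (K' * q ^ s) HM (IH i' j' Hs' Hi' Hj')).
      assert (h' : Rabs (y e i' j') <= K' * q ^ s) by (apply IH; auto; now exists b).
      apply Rle_trans with (1 := Rabs_triang _ _). rewrite Rabs_mult, (Rabs_pos_eq e) by lra.
      assert (e * Rabs (dl b y e i' j') <= e * (C * (K' * q ^ s))) by (apply Rmult_le_compat_l; lra).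
      replace (K' * q ^ S s) with (K' * q ^ s + e * (C * (K' * q ^ s))) by (unfold q; simpl; ring).
      lra. }
    destruct (Nat.eq_dec (coord b i j) 0) as [Hc|Hc]; [|now apply (step b)].
    destruct (He i j Hi Hj) as [_ h]. destruct (h (b, y) Hb) as [h1 _]. simpl in h1.
    destruct (h1 Hc) as [h3|h3].
    (* The unknown is propagated in both directions, and as i + j > 0 the other coordinate is
       nonzero on this axis, so one can step back along it. *)
    + apply (step (other b) h3). destruct b; simpl in *; lia.
    + specialize (Hpow (S s)). nra. }
intros i j Hi Hj. apply Rle_trans with (1 := main _ i j eq_refl Hi Hj y0 (ex_intro _ b0 H0)).
apply Rmult_le_compat_l; [lra|].
apply Rle_trans with (1 := pow_INR_bound q C (i + j) e HC0 (proj1 Hee) eq_refl).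
rewrite plus_INR.
assert (hle : C * ((INR i + INR j) * e) <= C * (R' + R')) by (apply Rmult_le_compat_l; lra).
destruct hle as [hlt| ->]; [left; now apply exp_increasing|lra].
Qed.

(* Apply the difference operator across the direction of propagation: the
   quotients solve a Goursat problem of the same kind, one order lower. *)
Theorem goursat N (l : list (axis * fam)) :
  (forall b y, In (b, y) l -> span N (members l) (dl b y) /\ initial N l b y) ->
  forall b y, In (b, y) l -> B N y.
Proof.
revert l. induction N as [|N IH]; intros l H.
- intros b y Hb. split; [|exact I]. now apply (gronwall l H b).
- assert (HB : forall b y, In (b, y) l -> B N y).
  { apply IH. intros b y Hb. destruct (H b y Hb) as [H1 H2]. split; [apply (span_le _ N (S N)); auto|].
    destruct H2 as [[p [Hp1 Hp2]]|H2]; [left|right; exact H2]. exists p. split; [now apply B_pred|exact Hp2]. }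
  assert (HB' : forall y, members l y -> B N y) by (intros y [b Hb]; now apply (HB b)).
  assert (Hd : forall b y, In (b, y) l -> B N (dl b y)).
  { intros b y Hb. apply (span_B_all _ N (members l)); [exact HB'|].
    apply (span_le _ N (S N)); [lia|]. now apply H. }
  (* Since difference operators commute, the transversal quotient of an unknown is propagated in the
     same direction as the unknown itself. *)
  pose (l' := map (fun a : axis * fam => (fst a, dl (other (fst a)) (snd a))) l).
  assert (HZ : forall b y, In (b, y) l -> B N (dl (other b) y)).
  { intros b y Hb. apply (IH l') with b; [|exact (in_map (fun a : axis * fam => (fst a, dl (other (fst a)) (snd a))) l (b, y) Hb)].
    clear b y Hb. intros b z Hz. apply in_map_iff in Hz. destruct Hz as [[b' y] [Hz Hy]].
    simpl in Hz. injection Hz as <- <-. rename b' into b.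
    split.
    - rewrite dl_comm. apply (span_dl _ N (other b) (members l)); [exact HB'| |now apply H].
      intros y' [b' Hb'].
      assert (Hbb : b' = b \/ b' = other b) by (destruct b, b'; auto).
      destruct Hbb as [->| ->].
      + apply span_gen. exists b. apply in_map_iff. exists (b, y'). auto.
      + apply span_B. now apply Hd.
    - left. destruct (H b y Hy) as [_ [[p [Hp1 Hp2]]|[Hp _]]].
      + exists (dl (other b) p). split; [now apply B_dl|].
        generalize (ev_and _ _ _ Hp2 (ev_sh _ (other b) _ Hp2)). apply ev_mono.
        intros e i j _ [h1 h2] Hc. unfold dl. rewrite h1 by exact Hc.
        destruct b; simpl in *; now rewrite h2.
      (* An unknown propagated in both directions has its transversal quotient given by its second
         equation, which supplies the data on the whole axis. *)
      + exists (dl (other b) y). split; [now apply Hd|]. apply ev_all. reflexivity. }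
  intros b y Hb. apply B_S; [now apply (B_bd _ N), (HB b)|].
  intros b'. assert (Hbb : b' = b \/ b' = other b) by (destruct b, b'; auto).
  destruct Hbb as [->| ->]; auto.
Qed.
End Goursat.

(** * Smooth functions restricted to the lattice *)

(** The derivative within the square in increment form. Neither a division nor the exclusion of h =
    0 is left, which suits linear combinations and limits better than [is_partial], to which it is
    equivalent on the square. *)
Definition pd (r : R) (b : axis) (g : vec2 -> R) (u : vec2) (d : R) : Prop :=
  forall eta, 0 < eta -> exists del, 0 < del /\
    forall h, Rabs h < del -> square r (move b h u) ->
      Rabs (g (move b h u) - g u - h * d) <= eta * Rabs h.

Lemma move_0 b u : move b 0 u = u.
Proof. destruct b, u; simpl; f_equal; ring. Qed.
Lemma move_move b h h' u : move b h (move b h' u) = move b (h + h') u.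
Proof. destruct b, u; simpl; f_equal; ring. Qed.
Lemma move_comm b b' h h' u : move b h (move b' h' u) = move b' h' (move b h u).
Proof. destruct b, b', u; simpl; f_equal; ring. Qed.

Lemma square_le r r' u : r <= r' -> square r u -> square r' u.
Proof. unfold square. lra. Qed.
Lemma square_move r r' b h u : 0 <= h -> h <= r' - r -> square r u -> square r' (move b h u).
Proof. destruct b; unfold square; simpl; lra. Qed.
Lemma square_between r b t h u : 0 <= t <= h -> square r u -> square r (move b h u) ->
  square r (move b t u).
Proof. destruct b; unfold square; simpl; lra. Qed.

Lemma pd_is_partial r b g u d : square r u -> pd r b g u d -> is_partial (square r) b g u d.
Proof.
intros Hu H P [eps HP]. destruct (H (eps / 2)) as [del [Hd Hh]]; [destruct eps; simpl; lra|].
exists (mkposreal del Hd). intros h Hb Hh0 Hs. apply HP.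
assert (Hb' : Rabs h < del).
{ change (Rabs (h - 0) < del) in Hb. now rewrite Rminus_0_r in Hb. }
specialize (Hh h Hb' Hs).
change (Rabs ((g (move b h u) - g u) / h - d) < eps).
replace ((g (move b h u) - g u) / h - d) with ((g (move b h u) - g u - h * d) / h) by (field; auto).
unfold Rdiv. rewrite Rabs_mult, Rabs_inv.
assert (0 < Rabs h) by now apply Rabs_pos_lt.
apply Rle_lt_trans with (eps / 2 * Rabs h * / Rabs h).
- apply Rmult_le_compat_r; [left; now apply Rinv_0_lt_compat|exact Hh].
- rewrite Rmult_assoc, Rinv_r by lra. destruct eps; simpl; lra.
Qed.

Lemma is_partial_pd r b g u d : square r u -> is_partial (square r) b g u d -> pd r b g u d.
Proof.
intros Hu H eta He.
destruct (H (fun x => Rabs (x - d) < eta)) as [del Hd].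
{ exists (mkposreal eta He). intros y Hy. exact Hy. }
exists del. split; [apply cond_pos|]. intros h Hh Hs.
destruct (Req_dec h 0) as [->|H0].
- rewrite move_0. replace (g u - g u - 0 * d) with 0 by ring. rewrite Rabs_R0. lra.
- assert (Hb : ball 0 del h).
  { change (Rabs (h - 0) < del). now rewrite Rminus_0_r. }
  specialize (Hd h Hb H0 Hs). simpl in Hd.
  replace (g (move b h u) - g u - h * d) with (((g (move b h u) - g u) / h - d) * h) by (field; auto).
  rewrite Rabs_mult. apply Rmult_le_compat_r; [apply Rabs_pos|lra].
Qed.

(* The square leaves room on at least one side of u in each direction. *)
Lemma pd_unique r b g u d d' : 0 < r -> square r u -> pd r b g u d -> pd r b g u d' -> d = d'.
Proof.
intros Hr Hu H H'. apply Rminus_diag_uniq. apply cond_eq. intros eta He.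
destruct (H (eta / 4)) as [x [Hx H1]]; [lra|]. destruct (H' (eta / 4)) as [y [Hy H2]]; [lra|].
set (m := Rmin (Rmin x y) r / 2).
assert (Hm : 0 < m /\ m < x /\ m < y /\ m <= r / 2).
{ unfold m. rmins.
assert (0 < Rmin (Rmin x y) r) by (repeat apply Rmin_glb_lt; lra). lra. }
assert (Hh : exists h, Rabs h = m /\ square r (move b h u)).
{ destruct (Rle_dec (match b with ax1 => fst u | ax2 => snd u end) (r / 2)).
  - exists m. split; [apply Rabs_pos_eq; lra|]. destruct b; unfold square in *; simpl; lra.
  - exists (- m). split; [rewrite Rabs_Ropp; apply Rabs_pos_eq; lra|]. destruct b; unfold square in *; simpl; lra. }
destruct Hh as [h [Hhm Hs]].
specialize (H1 h ltac:(lra) Hs). specialize (H2 h ltac:(lra) Hs). rewrite Hhm in *.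
assert (Rabs (h * (d - d')) <= eta / 2 * m).
{ replace (h * (d - d')) with ((g (move b h u) - g u - h * d') - (g (move b h u) - g u - h * d)) by ring.
  apply Rle_trans with (1 := Rabs_triang _ (- _)). rewrite Rabs_Ropp. lra. }
rewrite Rabs_mult, Hhm in *. replace (d - d' - 0) with (d - d') by ring. nra.
Qed.

Lemma partial_pd r b g u d : 0 < r -> square r u -> pd r b g u d -> partial (square r) b g u = d.
Proof.
intros Hr Hu H. unfold partial. apply (iota_unique (V := R_CompleteNormedModule)).
- intros d' H'. symmetry. apply (pd_unique r b g u); auto. now apply is_partial_pd.
- now apply pd_is_partial.
Qed.

Lemma pd_ext r b g g' u d : square r u -> (forall v, square r v -> g v = g' v) -> pd r b g u d -> pd r b g' u d.
Proof.
intros Hu H Hg eta He. destruct (Hg eta He) as [x [Hx Hh]]. exists x. split; [exact Hx|].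
intros h H1 H2. rewrite <- (H u Hu), <- (H _ H2). now apply Hh.
Qed.
Lemma pd_le r r' b g u d : r <= r' -> pd r' b g u d -> pd r b g u d.
Proof.
intros Hr H eta He. destruct (H eta He) as [x [Hx Hh]]. exists x. split; [exact Hx|].
intros h H1 H2. apply Hh; [exact H1|]. now apply (square_le r).
Qed.
Lemma pd_lin r b g g' u d d' k k' : pd r b g u d -> pd r b g' u d' ->
  pd r b (fun v => k * g v + k' * g' v) u (k * d + k' * d').
Proof.
intros H H' eta He.
assert (HK : 0 < Rabs k + Rabs k' + 1) by (pose proof (Rabs_pos k); pose proof (Rabs_pos k'); lra).
destruct (H (eta / (Rabs k + Rabs k' + 1))) as [x [Hx H1]]; [now apply Rdiv_lt_0_compat|].
destruct (H' (eta / (Rabs k + Rabs k' + 1))) as [y [Hy H2]]; [now apply Rdiv_lt_0_compat|].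
exists (Rmin x y). split; [now apply Rmin_glb_lt|]. intros h Hh Hs.
rmins.
specialize (H1 h ltac:(lra) Hs). specialize (H2 h ltac:(lra) Hs).
set (z := eta / (Rabs k + Rabs k' + 1)) in *.
assert (Hz : z * (Rabs k + Rabs k' + 1) = eta) by (unfold z; field; lra).
assert (Hz0 : 0 < z) by now apply Rdiv_lt_0_compat.
replace (k * g (move b h u) + k' * g' (move b h u) - (k * g u + k' * g' u) - h * (k * d + k' * d'))
  with (k * (g (move b h u) - g u - h * d) + k' * (g' (move b h u) - g' u - h * d')) by ring.
apply Rle_trans with (1 := Rabs_triang _ _). rewrite !Rabs_mult.
pose proof (Rabs_pos k). pose proof (Rabs_pos k'). pose proof (Rabs_pos h).
assert (Rabs k * Rabs (g (move b h u) - g u - h * d) <= Rabs k * (z * Rabs h)) by (apply Rmult_le_compat_l; lra).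
assert (Rabs k' * Rabs (g' (move b h u) - g' u - h * d') <= Rabs k' * (z * Rabs h)) by (apply Rmult_le_compat_l; lra).
assert (0 <= z * Rabs h) by nra.
rewrite <- Hz. lra.
Qed.
Lemma pd_shift r r' b b' g u d e : 0 <= e <= r' - r ->
  pd r' b g (move b' e u) d -> pd r b (fun v => g (move b' e v)) u d.
Proof.
intros He H eta Heta. destruct (H eta Heta) as [x [Hx Hh]]. exists x. split; [exact Hx|].
intros h H1 H2. rewrite move_comm. apply Hh; [exact H1|]. rewrite move_comm. apply (square_move r); lra || auto.
Qed.

Section MeanValue.
Variables (r : R) (b : axis) (g g' : vec2 -> R).
Hypothesis Hg : forall v, square r v -> pd r b g v (g' v).

Lemma mean_value u h M : 0 <= h -> square r u -> square r (move b h u) ->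
  (forall t, 0 <= t <= h -> Rabs (g' (move b t u)) <= M) ->
  Rabs (g (move b h u) - g u) <= M * h.
Proof.
intros Hh Hu Hu' HM.
destruct (Req_dec h 0) as [->|H0]; [rewrite move_0, Rminus_diag, Rabs_R0; lra|].
(* The mean value theorem asks for continuity on both sides of 0 and h, where the segment may leave
   the square; clamping the parameter extends the function beyond both ends. *)
set (cl := fun t => Rmax 0 (Rmin h t)).
assert (Hcl : forall t, 0 <= cl t <= h).
{ intros t. unfold cl, Rmax, Rmin. destruct (Rle_dec h t); destruct (Rle_dec 0 _); lra. }
assert (Hid : forall t, 0 <= t <= h -> cl t = t).
{ intros t Ht. unfold cl, Rmax, Rmin. destruct (Rle_dec h t); destruct (Rle_dec 0 _); lra. }
assert (Hlip : forall s t, Rabs (cl s - cl t) <= Rabs (s - t)).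
{ intros s t. unfold cl, Rmax, Rmin. destruct (Rle_dec h t); destruct (Rle_dec h s);
  repeat destruct (Rle_dec 0 _); unfold Rabs; repeat destruct (Rcase_abs _); lra. }
assert (Hsq : forall t, 0 <= t <= h -> square r (move b t u)) by (intros; now apply (square_between r b _ h)).
destruct (MVT_gen (fun t => g (move b (cl t) u)) 0 h (fun t => g' (move b t u))) as [c [Hc1 Hc2]].
- rewrite Rmin_left, Rmax_right by lra. intros t Ht. apply is_derive_Reals. intros eta He.
  destruct (Hg (move b t u) (Hsq t ltac:(lra)) (eta / 2)) as [x [Hx H1]]; [lra|].
  assert (Hm : 0 < Rmin x (Rmin t (h - t))) by (repeat apply Rmin_glb_lt; lra).
  exists (mkposreal _ Hm). intros s Hs0 Hs. simpl in Hs.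
  rmins.
assert (0 <= t + s <= h) by (revert Hs; unfold Rabs; destruct (Rcase_abs s); lra).
  rewrite !Hid by lra. specialize (H1 s ltac:(lra)). rewrite move_move in H1.
  replace (s + t) with (t + s) in H1 by ring. specialize (H1 (Hsq (t + s) ltac:(lra))).
  replace ((g (move b (t + s) u) - g (move b t u)) / s - g' (move b t u))
   with ((g (move b (t + s) u) - g (move b t u) - s * g' (move b t u)) / s) by (field; auto).
  unfold Rdiv at 1. rewrite Rabs_mult, Rabs_inv.
  assert (0 < Rabs s) by now apply Rabs_pos_lt.
  apply Rle_lt_trans with (eta / 2 * Rabs s * / Rabs s).
  + apply Rmult_le_compat_r; [left; now apply Rinv_0_lt_compat|exact H1].
  + rewrite Rmult_assoc, Rinv_r by lra. lra.
- rewrite Rmin_left, Rmax_right by lra. intros t Ht.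
  destruct (Hg (move b t u) (Hsq t Ht) 1) as [x [Hx H1]]; [lra|].
  intros eta He. set (K := 1 + Rabs (g' (move b t u))).
  assert (HK : 0 < K) by (unfold K; pose proof (Rabs_pos (g' (move b t u))); lra).
  exists (Rmin x (eta / K)). split; [apply Rmin_glb_lt; [exact Hx|now apply Rdiv_lt_0_compat]|].
  intros s [_ Hs]. simpl in *. unfold Rdist in *.
  rmins.
pose proof (Hlip s t) as Hl. rewrite (Hid t Ht) in *.
  specialize (H1 (cl s - t) ltac:(lra)). rewrite move_move in H1.
  replace (cl s - t + t) with (cl s) in H1 by ring. specialize (H1 (Hsq _ (Hcl s))).
  assert (H3 : Rabs (g (move b (cl s) u) - g (move b t u)) <= K * Rabs (cl s - t)).
  { replace (g (move b (cl s) u) - g (move b t u)) with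
     ((g (move b (cl s) u) - g (move b t u) - (cl s - t) * g' (move b t u)) + (cl s - t) * g' (move b t u)) by ring.
    apply Rle_trans with (1 := Rabs_triang _ _). rewrite Rabs_mult. unfold K. lra. }
  apply Rle_lt_trans with (1 := H3).
  apply Rlt_le_trans with (K * (eta / K)); [apply Rmult_lt_compat_l; lra|]. right. field. lra.
- rewrite Rmin_left, Rmax_right in Hc1 by lra.
  rewrite !Hid in Hc2 by lra. rewrite move_0 in Hc2. rewrite Hc2, Rabs_mult, (Rabs_pos_eq (h - 0)) by lra.
  specialize (HM c Hc1). nra.
Qed.

End MeanValue.

Definition axval (b : axis) (u : vec2) : R := match b with ax1 => fst u | ax2 => snd u end.

Lemma pd_axval r b u : pd r b (axval b) u 1.
Proof.
intros eta He. exists 1. split; [lra|]. intros h _ _. destruct b; simpl;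
match goal with |- Rabs ?x <= _ => replace x with 0 by ring end; rewrite Rabs_R0; pose proof (Rabs_pos h); nra.
Qed.

(** The mean value theorem for g minus its tangent, whose derivative g' - g'(u) is bounded by M t
    through a second application. The factor 1/2 is given up. *)
Lemma taylor1 r b (g g' g'' : vec2 -> R) u h M :
  (forall v, square r v -> pd r b g v (g' v)) ->
  (forall v, square r v -> pd r b g' v (g'' v)) ->
  0 <= h -> square r u -> square r (move b h u) ->
  (forall t, 0 <= t <= h -> Rabs (g'' (move b t u)) <= M) ->
  Rabs (g (move b h u) - g u - h * g' u) <= M * h * h.
Proof.
intros Hg Hg' Hh Hu Hu' HM.
pose proof (mean_value r b (fun v => 1 * g v + (- g' u) * axval b v) (fun v => 1 * g' v + (- g' u) * 1)) as H.
specialize (H ltac:(intros v Hv; apply pd_lin; [now apply Hg|apply pd_axval]) u h (M * h) Hh Hu Hu').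
replace (g (move b h u) - g u - h * g' u) with
 (1 * g (move b h u) + - g' u * axval b (move b h u) - (1 * g u + - g' u * axval b u)) by (destruct b; simpl; ring).
apply H. intros t Ht.
replace (1 * g' (move b t u) + - g' u * 1) with (g' (move b t u) - g' u) by ring.
assert (HM0 : 0 <= M).
{ apply Rle_trans with (2 := HM t Ht). apply Rabs_pos. }
apply Rle_trans with (M * t); [|apply Rmult_le_compat_l; lra].
apply (mean_value r b g' g''); auto; [lra|now apply (square_between r b t h)|]. intros s Hs. apply HM. lra.
Qed.

(* J e w stands for the derivative along the word w of a function which may
   depend on the mesh size e, so that jets are closed under difference quotients. *)
Definition jet : Type := R -> list axis -> vec2 -> R.

Section Jets.
Variable R0 : R.

Definition smooth_jet (J : jet) : Prop :=
  forall R' w, R' < R0 -> exists C e1, 0 < e1 /\ forall e, 0 < e < e1 -> forall u, square R' u ->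
    Rabs (J e w u) <= C /\ forall b, pd R' b (J e w) u (J e (b :: w) u).

Definition commuting (J : jet) : Prop :=
  forall e b b' w u, J e (b :: b' :: w) u = J e (b' :: b :: w) u.

Definition rho (g : R -> vec2 -> R) : fam := fun e i j => g e (INR i * e, INR j * e).

Definition jdiff (b : axis) (J : jet) : jet := fun e w u => (J e w (move b e u) - J e w u) / e.
Definition jerr (b : axis) (J : jet) : jet := fun e w u => (jdiff b J e w u - J e (b :: w) u) / e.

Lemma dl_rho b J w : dl b (rho (fun e => J e w)) = rho (fun e => jdiff b J e w).
Proof.
fam_ext. unfold dl, rho, jdiff. assert (H : tn b (fun e i j => J e w (INR i * e, INR j * e)) e i j = J e w (move b e (INR i * e, INR j * e))).
{ destruct b; cbn [tn move fst snd]; rewrite S_INR; do 2 f_equal; ring. }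
now rewrite H.
Qed.

Lemma jdiff_smooth b J : smooth_jet J -> smooth_jet (jdiff b J).
Proof.
intros HJ R' w HR. set (R'' := (R' + R0) / 2).
destruct (HJ R'' w) as [C [e1 [He1 H]]]; [unfold R''; lra|].
destruct (HJ R'' (b :: w)) as [C' [e2 [He2 H']]]; [unfold R''; lra|].
exists C', (Rmin (Rmin e1 e2) (R'' - R')). split; [repeat apply Rmin_glb_lt; auto; unfold R''; lra|].
intros e He u Hu.
rmins.
assert (Hu' : square R'' u) by (apply (square_le R'); [unfold R''; lra|exact Hu]).
assert (Hm : square R'' (move b e u)) by (apply (square_move R'); lra || auto).
split.
- unfold jdiff, Rdiv. rewrite Rabs_mult, Rabs_inv, (Rabs_pos_eq e) by lra.
  apply Rmult_le_reg_r with e; [lra|]. rewrite Rmult_assoc, Rinv_l, Rmult_1_r by lra.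
  apply (mean_value R'' b _ (J e (b :: w))); auto; [intros v Hv; now apply H; [lra|]|lra|].
  intros t Ht. apply H'; [lra|]. now apply (square_between R'' b t e).
- intros b'. unfold jdiff.
  replace (fun u0 => (J e w (move b e u0) - J e w u0) / e) with
    (fun u0 => / e * (fun v => J e w (move b e v)) u0 + (- / e) * J e w u0)
    by (apply functional_extensionality; intros; unfold Rdiv; ring).
  replace ((J e (b' :: w) (move b e u) - J e (b' :: w) u) / e) with
    (/ e * J e (b' :: w) (move b e u) + - / e * J e (b' :: w) u) by (unfold Rdiv; ring).
  apply pd_lin.
  + apply (pd_shift R' R''); [lra|]. now apply H; [lra|].
  + apply (pd_le R' R''); [lra|]. now apply H; [lra|].
Qed.

Lemma jerr_bound b J w : smooth_jet J -> forall R', R' < R0 ->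
  exists C e1, 0 < e1 /\ forall e, 0 < e < e1 -> forall u, square R' u -> Rabs (jerr b J e w u) <= C.
Proof.
intros HJ R' HR. set (R'' := (R' + R0) / 2).
destruct (HJ R'' w) as [C1 [e1 [He1 H1]]]; [unfold R''; lra|].
destruct (HJ R'' (b :: w)) as [C2 [e2 [He2 H2]]]; [unfold R''; lra|].
destruct (HJ R'' (b :: b :: w)) as [C3 [e3 [He3 H3]]]; [unfold R''; lra|].
exists C3, (Rmin (Rmin e1 (Rmin e2 e3)) (R'' - R')).
split; [repeat apply Rmin_glb_lt; auto; unfold R''; lra|].
intros e He u Hu.
rmins.
assert (Hu' : square R'' u) by (apply (square_le R'); [unfold R''; lra|exact Hu]).
assert (Hm : square R'' (move b e u)) by (apply (square_move R'); lra || auto).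
unfold jerr, jdiff.
replace (((J e w (move b e u) - J e w u) / e - J e (b :: w) u) / e) with
  ((J e w (move b e u) - J e w u - e * J e (b :: w) u) * / (e * e)) by (field; lra).
assert (0 < e * e) by nra.
rewrite Rabs_mult, Rabs_inv, (Rabs_pos_eq (e * e)) by lra.
apply Rmult_le_reg_r with (e * e); [lra|]. rewrite Rmult_assoc, Rinv_l, Rmult_1_r by lra.
rewrite <- Rmult_assoc.
apply (taylor1 R'' b _ _ (J e (b :: b :: w))); auto.
- intros v Hv. now apply H1; [lra|].
- intros v Hv. now apply H2; [lra|].
- lra.
- intros t Ht. apply H3; [lra|]. now apply (square_between R'' b t e).
Qed.

(** Differentiating the term J (b :: w) along b' puts b' in front of b, whereas the jet of [jerr]
    has b in front of b'. Commutation reconciles the two words. *)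
Lemma jerr_smooth b J : commuting J -> smooth_jet J -> smooth_jet (jerr b J).
Proof.
intros HC HJ R' w HR.
destruct (jdiff_smooth b J HJ R' w HR) as [C0 [e0 [He0 H0]]].
destruct (HJ R' (b :: w) HR) as [C2 [e2 [He2 H2]]].
destruct (jerr_bound b J w HJ R' HR) as [C3 [e3 [He3 H3]]].
exists C3, (Rmin e0 (Rmin e2 e3)).
split; [repeat apply Rmin_glb_lt; auto|].
intros e He u Hu.
rmins.
split; [apply H3; auto; lra|].
intros b'.
replace (jerr b J e w) with (fun v => / e * jdiff b J e w v + (- / e) * J e (b :: w) v)
  by (apply functional_extensionality; intros; unfold jerr, Rdiv; ring).
replace (jerr b J e (b' :: w) u) with (/ e * jdiff b J e (b' :: w) u + (- / e) * J e (b' :: b :: w) u)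
  by (unfold jerr, Rdiv; rewrite (HC e b b'); ring).
apply pd_lin.
- now apply H0; [lra|].
- now apply H2; [lra|].
Qed.

Lemma square_grid R' e i j : 0 < e -> INR i * e <= R' -> INR j * e <= R' -> square R' (INR i * e, INR j * e).
Proof.
intros He Hi Hj. pose proof (pos_INR i). pose proof (pos_INR j).
split; simpl; split; try assumption; apply Rmult_le_pos; lra.
Qed.

Lemma rho_bd J w : smooth_jet J -> bd R0 (rho (fun e => J e w)).
Proof.
intros HJ R' HR. destruct (HJ R' w HR) as [C [e1 [He1 H]]]. exists C, e1. split; [exact He1|].
intros e He i j Hi Hj. apply H; [exact He|]. now apply square_grid.
Qed.

Lemma rho_B N J w : smooth_jet J -> B R0 N (rho (fun e => J e w)).
Proof.
revert J. induction N as [|N IH]; intros J HJ; (split; [now apply rho_bd|]); [exact I|].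
intros b. rewrite dl_rho. apply IH. now apply jdiff_smooth.
Qed.

Lemma rho_err N J b w : commuting J -> smooth_jet J ->
  sim R0 N (fun _ => False) (dl b (rho (fun e => J e w))) (rho (fun e => J e (b :: w))).
Proof.
intros HC HJ. apply (sim_quot _ _ _ _ _ (rho (fun e => jerr b J e w))).
- now apply rho_B.
- now apply rho_B, jerr_smooth.
- apply ev_all. intros e i j He. rewrite dl_rho. unfold rho, fadd, fmul, feps, jerr. field. lra.
Qed.

(* Without commutation only the bound of order zero survives. *)
Lemma rho_err0 J b w : smooth_jet J ->
  sim R0 0 (fun _ => False) (dl b (rho (fun e => J e w))) (rho (fun e => J e (b :: w))).
Proof.
intros HJ. apply (sim_quot _ _ _ _ _ (rho (fun e => jerr b J e w))).
- now apply rho_B.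
- split; [|exact I]. intros R' HR.
  destruct (jerr_bound b J w HJ R' HR) as [C [e1 [He1 H]]]. exists C, e1. split; [exact He1|].
  intros e He i j Hi Hj. apply H; [exact He|]. now apply square_grid.
- apply ev_all. intros e i j He. rewrite dl_rho. unfold rho, fadd, fmul, feps, jerr. field. lra.
Qed.

End Jets.

(** * Limits along an ultrafilter *)

(** The filter of cofinite sets extends to an ultrafilter; the result is repackaged as a Coquelicot
    [ProperFilter], so that [filterlim] and its algebra apply to it. *)
Lemma ultrafilter_exists : exists U : (nat -> Prop) -> Prop,
  ProperFilter U /\ (forall P, U P \/ U (fun k => ~ P k)) /\ (forall m, U (fun k => (m <= k)%nat)).
Proof.
assert (H : filter.ProperFilter (fun P : nat -> Prop => eventually P)).
{ constructor.
  - intros [N HN]. exact (HN N (Nat.le_refl _)).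
  - constructor.
    + now exists 0%nat.
    + intros P Q [a Ha] [b Hb]. exists (a + b)%nat. intros n Hn. split; [apply Ha | apply Hb]; lia.
    + intros P Q HPQ [a Ha]. exists a. intros n Hn. apply HPQ. now apply Ha. }
destruct (filter.ultraFilterLemma H) as [G [HG HE]].
exists G. split; [|split].
- destruct HG as [[HG0 [HGT HGI HGS]] _]. constructor.
  + intros P HP. destruct (classic (exists x, P x)) as [h | h]; [exact h|].
    exfalso. apply HG0. apply (HGS P); [|exact HP]. intros x Hx. apply h. now exists x.
  + constructor.
    * exact HGT.
    * intros P Q HP HQ. exact (HGI P Q HP HQ).
    * intros P Q HPQ HP. exact (HGS P Q HPQ HP).
- intros P. exact (filter.in_ultra_setVsetC P HG).
- intros m. apply HE. exists m. auto.
Qed.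

Definition hyper : (nat -> Prop) -> Prop := proj1_sig (constructive_indefinite_description _ ultrafilter_exists).
Global Instance hyper_proper : ProperFilter hyper.
Proof. exact (proj1 (proj2_sig (constructive_indefinite_description _ ultrafilter_exists))). Qed.
Lemma hyper_ultra P : hyper P \/ hyper (fun k => ~ P k).
Proof. exact (proj1 (proj2 (proj2_sig (constructive_indefinite_description _ ultrafilter_exists))) P). Qed.
Lemma hyper_large m : hyper (fun k => (m <= k)%nat).
Proof. exact (proj2 (proj2 (proj2_sig (constructive_indefinite_description _ ultrafilter_exists))) m). Qed.

Lemma hyper_and (P Q : nat -> Prop) : hyper P -> hyper Q -> hyper (fun k => P k /\ Q k).
Proof. apply (filter_and (F := hyper)). Qed.
Lemma hyper_imp (P Q : nat -> Prop) : (forall k, P k -> Q k) -> hyper P -> hyper Q.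
Proof. apply (filter_imp (F := hyper)). Qed.
Lemma hyper_ex (P : nat -> Prop) : hyper P -> exists k, P k.
Proof. apply (filter_ex (F := hyper)). Qed.
Lemma hyper_all (P : nat -> Prop) : (forall k, P k) -> hyper P.
Proof. apply (filter_forall (F := hyper)). Qed.

Definition tends (x : nat -> R) (l : R) : Prop := filterlim x hyper (locally l).

Lemma tends_iff x l : tends x l <-> forall eta, 0 < eta -> hyper (fun k => Rabs (x k - l) < eta).
Proof.
split.
- intros H eta He. apply (H (fun y => Rabs (y - l) < eta)). exists (mkposreal eta He). intros y Hy. exact Hy.
- intros H P [eps HP]. change (hyper (fun k => P (x k))). generalize (H eps (cond_pos eps)). apply hyper_imp. intros k Hk. apply HP. exact Hk.
Qed.
Lemma tends_unique x l l' : tends x l -> tends x l' -> l = l'.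
Proof. intros H H'. exact (filterlim_locally_unique x l l' H H'). Qed.
Lemma tends_le x y l l' : hyper (fun k => x k <= y k) -> tends x l -> tends y l' -> l <= l'.
Proof.
intros H Hx Hy. destruct (Rle_dec l l') as [h|h]; [exact h|exfalso].
rewrite tends_iff in Hx, Hy.
assert (H3 := hyper_and _ _ H (hyper_and _ _ (Hx ((l - l') / 2) ltac:(lra)) (Hy ((l - l') / 2) ltac:(lra)))).
destruct (hyper_ex _ H3) as [k [h1 [h2 h3]]]. apply Rabs_def2 in h2. apply Rabs_def2 in h3. lra.
Qed.
Lemma tends_eq x y l : hyper (fun k => x k = y k) -> tends x l -> tends y l.
Proof. intros H Hx. now apply (filterlim_ext_loc x). Qed.
Lemma tends_const l : tends (fun _ => l) l.
Proof. apply filterlim_const. Qed.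
Lemma tends_add x y l l' : tends x l -> tends y l' -> tends (fun k => x k + y k) (l + l').
Proof. intros Hx Hy. exact (filterlim_comp_2 _ _ _ Hx Hy (filterlim_plus l l')). Qed.
Lemma tends_mul x y l l' : tends x l -> tends y l' -> tends (fun k => x k * y k) (l * l').
Proof. intros Hx Hy. exact (filterlim_comp_2 _ _ _ Hx Hy (filterlim_mult (K := R_AbsRing) l l')). Qed.
Lemma tends_opp x l : tends x l -> tends (fun k => - x k) (- l).
Proof. intros Hx. exact (filterlim_comp _ _ _ _ _ _ _ _ Hx (filterlim_opp l)). Qed.
Lemma tends_abs x l : tends x l -> tends (fun k => Rabs (x k)) (Rabs l).
Proof.
rewrite !tends_iff. intros H eta He. generalize (H eta He). apply hyper_imp. intros k Hk.
apply Rle_lt_trans with (2 := Hk). apply Rabs_triang_inv2.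
Qed.
Lemma tends_squeeze x y l : tends y 0 -> hyper (fun k => Rabs (x k - l) <= y k) -> tends x l.
Proof.
rewrite !tends_iff. intros H Hxy eta He. generalize (hyper_and _ _ Hxy (H eta He)). apply hyper_imp.
intros k [h1 h2]. rewrite Rminus_0_r in h2. pose proof (Rle_abs (y k)). lra.
Qed.

(** The limit is the supremum of the numbers a that lie below x k for almost all k. Maximality of
    the ultrafilter decides each strict inequality, hence confines x k on both sides of the
    supremum. *)
Lemma tends_exists x C : hyper (fun k => Rabs (x k) <= C) -> exists l, tends x l.
Proof.
intros H.
destruct (completeness (fun a => hyper (fun k => a <= x k))) as [l [Hl1 Hl2]].
- exists C. intros a Ha. destruct (hyper_ex _ (hyper_and _ _ H Ha)) as [k [h1 h2]].
  pose proof (Rle_abs (x k)). lra.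
- exists (- C). generalize H. apply hyper_imp. intros k Hk. pose proof (Rle_abs (- x k)).
  rewrite Rabs_Ropp in *. lra.
- exists l. apply tends_iff. intros eta He.
  assert (h1 : hyper (fun k => x k < l + eta)).
  { destruct (hyper_ultra (fun k => x k < l + eta)) as [h|h]; [exact h|exfalso].
    assert (l + eta <= l); [|lra]. apply Hl1. generalize h. apply hyper_imp. intros k Hk. lra. }
  assert (h2 : hyper (fun k => l - eta < x k)).
  { destruct (hyper_ultra (fun k => l - eta < x k)) as [h|h]; [exact h|exfalso].
    assert (l <= l - eta); [|lra]. apply Hl2. intros a Ha.
    destruct (hyper_ex _ (hyper_and _ _ h Ha)) as [k [h3 h4]]. lra. }
  generalize (hyper_and _ _ h1 h2). apply hyper_imp. intros k [h3 h4]. apply Rabs_def1; lra.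
Qed.

Definition ek (k : nat) : R := / (INR k + 1).
Lemma ek_pos k : 0 < ek k.
Proof. unfold ek. apply Rinv_0_lt_compat. pose proof (pos_INR k). lra. Qed.
Lemma ek_small eta : 0 < eta -> hyper (fun k => ek k < eta).
Proof.
intros He. destruct (archimed_cor1 eta He) as [m [Hm1 Hm2]].
generalize (hyper_large m). apply hyper_imp. intros k Hk.
apply Rlt_trans with (2 := Hm1). unfold ek. apply Rinv_lt_contravar.
- apply Rmult_lt_0_compat; [now apply lt_0_INR|]. pose proof (pos_INR k). lra.
- apply le_INR in Hk. lra.
Qed.
Lemma ek_tends : tends ek 0.
Proof.
apply tends_iff. intros eta He. generalize (ek_small eta He). apply hyper_imp. intros k Hk.
rewrite Rminus_0_r, Rabs_pos_eq; [exact Hk|]. left. apply ek_pos.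
Qed.

Definition idx (x : R) (k : nat) : nat := Z.to_nat (Int_part (x / ek k)).
Lemma idx_spec x k : 0 <= x -> INR (idx x k) * ek k <= x < (INR (idx x k) + 1) * ek k.
Proof.
intros Hx. pose proof (ek_pos k) as He. destruct (base_Int_part (x / ek k)) as [h1 h2].
assert (Hq : 0 <= x / ek k) by (apply Rdiv_le_0_compat; auto).
assert (Hz : (0 <= Int_part (x / ek k))%Z).
{ apply Z.lt_succ_r. apply lt_IZR. rewrite succ_IZR. lra. }
unfold idx. rewrite INR_IZR_INZ, Z2Nat.id by exact Hz.
split.
- apply Rmult_le_reg_r with (/ ek k); [now apply Rinv_0_lt_compat|].
  rewrite Rmult_assoc, Rinv_r by lra. rewrite Rmult_1_r. exact h1.
- apply Rmult_lt_reg_r with (/ ek k); [now apply Rinv_0_lt_compat|].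
  rewrite Rmult_assoc, Rinv_r by lra. rewrite Rmult_1_r. unfold Rdiv in *. lra.
Qed.

Lemma tends_idx z : 0 <= z -> tends (fun k => INR (idx z k) * ek k) z.
Proof.
intros Hz. apply (tends_squeeze _ ek); [apply ek_tends|]. apply hyper_all. intros k.
destruct (idx_spec z k Hz). apply Rabs_le. lra.
Qed.
Lemma idx_0 k : idx 0 k = 0%nat.
Proof.
destruct (idx_spec 0 k (Rle_refl 0)) as [h _]. pose proof (ek_pos k). pose proof (pos_INR (idx 0 k)).
apply INR_eq. simpl. nra.
Qed.

(* The value at the lattice point below u, for the mesh size 1/(k+1). *)
Definition val (p : fam) (u : vec2) (k : nat) : R := p (ek k) (idx (fst u) k) (idx (snd u) k).
(** For bounded p the limit exists at every point of the half-open square, so the choice operator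
    returns it; elsewhere the value is arbitrary. *)
Definition flim (p : fam) (u : vec2) : R := epsilon (inhabits 0) (tends (val p u)).

Section Limits.
Variable R0 : R.
Notation ev := (ev R0).
Notation bd := (bd R0).
Notation B := (B R0).
Notation feq := (feq R0).

(** Half-open because it is the union of the squares [0, R']^2 with R' < R0, on which the bounds are
    available. *)
Definition inq (u : vec2) : Prop := 0 <= fst u < R0 /\ 0 <= snd u < R0.

Lemma square_inq r u : r < R0 -> square r u -> inq u.
Proof. unfold square, inq. lra. Qed.

Lemma near_hyper R' Q u : square R' u -> near R' Q ->
  hyper (fun k => Q (ek k) (idx (fst u) k) (idx (snd u) k)).
Proof.
intros [[H1 H1'] [H2 H2']] [e1 [He H]]. generalize (ek_small e1 He). apply hyper_imp. intros k Hk.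
destruct (idx_spec (fst u) k H1). destruct (idx_spec (snd u) k H2). pose proof (ek_pos k).
apply H; lra.
Qed.
Lemma inq_square u : inq u -> exists R', R' < R0 /\ square R' u.
Proof.
intros [H1 H2]. exists (Rmax (fst u) (snd u)). pose proof (Rmax_l (fst u) (snd u)).
pose proof (Rmax_r (fst u) (snd u)). split; [apply Rmax_lub_lt; lra|unfold square; lra].
Qed.
Lemma ev_hyper Q u : inq u -> ev Q -> hyper (fun k => Q (ek k) (idx (fst u) k) (idx (snd u) k)).
Proof.
intros Hu H. destruct (inq_square u Hu) as [R' [HR Hs]]. now apply (near_hyper R'); [|apply H].
Qed.

Lemma flim_tends p u : inq u -> bd p -> tends (val p u) (flim p u).
Proof.
intros Hu Hp. unfold flim. apply epsilon_spec. destruct (inq_square u Hu) as [R' [HR Hs]].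
destruct (Hp R' HR) as [C HC]. apply (tends_exists _ C).
exact (near_hyper R' (fun e i j => Rabs (p e i j) <= C) u Hs HC).
Qed.
Lemma flim_eq p u l : inq u -> bd p -> tends (val p u) l -> flim p u = l.
Proof. intros Hu Hp H. now apply (tends_unique (val p u)); [apply flim_tends|]. Qed.

Lemma flim_feq p q u : inq u -> bd p -> feq p q -> flim p u = flim q u.
Proof.
intros Hu Hp H. symmetry. apply flim_eq; [exact Hu|now apply (bd_feq R0 p)|].
apply tends_eq with (val p u); [|now apply flim_tends].
exact (ev_hyper (fun e i j => p e i j = q e i j) u Hu H).
Qed.
Lemma flim_cst c u : inq u -> flim (fcst c) u = c.
Proof. intros Hu. apply flim_eq; [exact Hu|apply bd_cst|apply tends_const]. Qed.
Lemma flim_eps u : inq u -> flim feps u = 0.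
Proof. intros Hu. apply flim_eq; [exact Hu|apply bd_eps|apply ek_tends]. Qed.
Lemma flim_add p q u : inq u -> bd p -> bd q -> flim (p + q)%fam u = flim p u + flim q u.
Proof. intros Hu Hp Hq. apply flim_eq; [exact Hu|now apply bd_add|]. apply tends_add; now apply flim_tends. Qed.
Lemma flim_mul p q u : inq u -> bd p -> bd q -> flim (p * q)%fam u = flim p u * flim q u.
Proof. intros Hu Hp Hq. apply flim_eq; [exact Hu|now apply bd_mul|]. apply tends_mul; now apply flim_tends. Qed.
Lemma flim_opp p u : inq u -> bd p -> flim (- p)%fam u = - flim p u.
Proof. intros Hu Hp. apply flim_eq; [exact Hu|now apply bd_opp|]. apply tends_opp; now apply flim_tends. Qed.
Lemma flim_inv p u : inq u -> bd p -> away R0 p -> flim (finv p) u = / flim p u /\ flim p u <> 0.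
Proof.
intros Hu Hp [H1 H2].
assert (H : flim p u * flim (finv p) u = 1).
{ rewrite <- flim_mul by auto. rewrite (flim_feq _ (fcst 1)) by (auto using bd_mul). now apply flim_cst. }
assert (H0 : flim p u <> 0) by (intros h; rewrite h in H; lra).
split; [|exact H0]. apply Rmult_eq_reg_l with (flim p u); [|exact H0]. now rewrite H, Rinv_r.
Qed.
Lemma flim_tn b p u : inq u -> B 1 p -> flim (tn b p) u = flim p u.
Proof.
intros Hu Hp. assert (H1 := B_bd _ _ _ Hp). assert (H2 := B_bd _ _ _ (B_dl _ _ b _ Hp)).
rewrite (flim_feq _ (p + feps * dl b p)%fam); [|exact Hu|now apply bd_tn|apply tn_dl].
rewrite flim_add, flim_mul, flim_eps by (auto using bd_mul, bd_eps). ring.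
Qed.
Lemma flim_dl_mul b p q u : inq u -> B 1 p -> B 1 q ->
  flim (dl b (p * q)%fam) u = flim (dl b p) u * flim q u + flim p u * flim (dl b q) u.
Proof.
intros Hu Hp Hq.
assert (H1 := B_bd _ _ _ Hp). assert (H2 := B_bd _ _ _ (B_dl _ _ b _ Hp)).
assert (H1' := B_bd _ _ _ Hq). assert (H2' := B_bd _ _ _ (B_dl _ _ b _ Hq)).
rewrite dl_mul, flim_add, !flim_mul, flim_tn by (auto using bd_mul, bd_tn). reflexivity.
Qed.
Lemma flim_bound p C R' u : R' < R0 -> square R' u -> bd p ->
  near R' (fun e i j => Rabs (p e i j) <= C) -> Rabs (flim p u) <= C.
Proof.
intros HR Hu Hp HC. apply (tends_le (fun k => Rabs (val p u k)) (fun _ => C)).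
- exact (near_hyper R' (fun e i j => Rabs (p e i j) <= C) u Hu HC).
- apply tends_abs, flim_tends; [now apply (square_inq R')|exact Hp].
- apply tends_const.
Qed.

Definition tnm (b : axis) (m i j : nat) : nat * nat :=
  match b with ax1 => ((i + m)%nat, j) | ax2 => (i, (j + m)%nat) end.
Definition ap (p : fam) (e : R) (ij : nat * nat) : R := p e (fst ij) (snd ij).

Lemma discrete_lip b p C e i j m : 0 < e ->
  (forall m', (m' < m)%nat -> Rabs (ap (dl b p) e (tnm b m' i j)) <= C) ->
  Rabs (ap p e (tnm b m i j) - p e i j) <= C * (INR m * e).
Proof.
intros He. induction m as [|m IH]; intros H.
- destruct b; unfold ap, tnm; simpl; rewrite Nat.add_0_r, Rminus_diag, Rabs_R0; lra.
- assert (Hs : ap p e (tnm b (S m) i j) = ap p e (tnm b m i j) + e * ap (dl b p) e (tnm b m i j)).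
  { destruct b; unfold ap, tnm, dl, tn; cbn [fst snd]; rewrite Nat.add_succ_r; field; lra. }
  rewrite Hs, S_INR.
  replace (ap p e (tnm b m i j) + e * ap (dl b p) e (tnm b m i j) - p e i j) with
    ((ap p e (tnm b m i j) - p e i j) + e * ap (dl b p) e (tnm b m i j)) by ring.
  apply Rle_trans with (1 := Rabs_triang _ _). rewrite Rabs_mult, (Rabs_pos_eq e) by lra.
  assert (h1 : Rabs (ap p e (tnm b m i j) - p e i j) <= C * (INR m * e)) by (apply IH; intros; apply H; lia).
  assert (h2 : Rabs (ap (dl b p) e (tnm b m i j)) <= C) by (apply H; lia).
  assert (e * Rabs (ap (dl b p) e (tnm b m i j)) <= e * C) by (apply Rmult_le_compat_l; lra).
  lra.
Qed.

(** Each step adds e times the drift of [dl b p], which is at most C m e; as m^2 + m <= (m + 1)^2,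
    the constant C survives the induction. *)
Lemma discrete_taylor b p C e i j m : 0 < e -> 0 <= C ->
  (forall m', (m' < m)%nat -> Rabs (ap (dl b (dl b p)) e (tnm b m' i j)) <= C) ->
  Rabs (ap p e (tnm b m i j) - p e i j - INR m * e * dl b p e i j) <= C * (INR m * e) * (INR m * e).
Proof.
intros He HC. induction m as [|m IH]; intros H.
- destruct b; unfold ap, tnm; cbn [fst snd]; rewrite Nat.add_0_r;
  replace (p e i j - p e i j - INR 0 * e * _) with 0 by (simpl; ring); rewrite Rabs_R0; simpl; lra.
- assert (Hs : ap p e (tnm b (S m) i j) = ap p e (tnm b m i j) + e * ap (dl b p) e (tnm b m i j)).
  { destruct b; unfold ap, tnm, dl, tn; cbn [fst snd]; rewrite Nat.add_succ_r; field; lra. }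
  rewrite Hs, S_INR.
  replace (ap p e (tnm b m i j) + e * ap (dl b p) e (tnm b m i j) - p e i j - (INR m + 1) * e * dl b p e i j) with
    ((ap p e (tnm b m i j) - p e i j - INR m * e * dl b p e i j)
     + e * (ap (dl b p) e (tnm b m i j) - dl b p e i j)) by ring.
  apply Rle_trans with (1 := Rabs_triang _ _). rewrite Rabs_mult, (Rabs_pos_eq e) by lra.
  assert (h1 := IH ltac:(intros; apply H; lia)).
  assert (h2 := discrete_lip b (dl b p) C e i j m He ltac:(intros; apply H; lia)).
  assert (e * Rabs (ap (dl b p) e (tnm b m i j) - dl b p e i j) <= e * (C * (INR m * e))) by (apply Rmult_le_compat_l; lra).
  pose proof (pos_INR m). assert (0 <= C * (e * e)) by nra. nra.
Qed.

(** The number of lattice steps between the nodes below u and below u + h. For 0 <= h the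
    subtraction of naturals does not truncate. *)
Definition steps (b : axis) (u : vec2) (h : R) (k : nat) : nat := idx (axval b u + h) k - idx (axval b u) k.

Lemma steps_spec b u h k : 0 <= axval b u -> 0 <= h ->
  (forall p, val p (move b h u) k = ap p (ek k) (tnm b (steps b u h k) (idx (fst u) k) (idx (snd u) k))) /\
  Rabs (INR (steps b u h k) * ek k - h) <= ek k /\ INR (steps b u h k) * ek k <= h + ek k.
Proof.
intros Hu Hh. pose proof (ek_pos k) as He.
destruct (idx_spec (axval b u) k Hu) as [h1 h2].
destruct (idx_spec (axval b u + h) k ltac:(lra)) as [h3 h4].
assert (hle : (idx (axval b u) k <= idx (axval b u + h) k)%nat).
{ destruct (le_lt_dec (idx (axval b u) k) (idx (axval b u + h) k)) as [l|l]; [exact l|exfalso].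
  apply le_INR in l. rewrite S_INR in l. nra. }
split; [|].
- intros p. unfold val, ap, steps. destruct b; cbn [tnm fst snd move axval] in *; f_equal; lia.
- unfold steps. rewrite minus_INR by exact hle. split; [apply Rabs_le|]; nra.
Qed.

Lemma axval_pos r b u : square r u -> 0 <= axval b u.
Proof. destruct b; unfold square; simpl; lra. Qed.

Lemma steps_inside R' b u h k m : square R' u -> square R' (move b h u) -> 0 <= h ->
  (m <= steps b u h k)%nat ->
  let ij := tnm b m (idx (fst u) k) (idx (snd u) k) in
  INR (fst ij) * ek k <= R' /\ INR (snd ij) * ek k <= R'.
Proof.
intros Hu Hu' Hh Hm. pose proof (ek_pos k) as He.
destruct (idx_spec (fst u) k (axval_pos R' ax1 u Hu)) as [h1 _].
destruct (idx_spec (snd u) k (axval_pos R' ax2 u Hu)) as [h2 _].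
destruct (idx_spec (axval b u) k (axval_pos R' b u Hu)) as [h5 _].
destruct (idx_spec (axval b u + h) k) as [h3 _]; [pose proof (axval_pos R' b u Hu); lra|].
assert (h4 : INR (idx (axval b u) k + m) * ek k <= axval b u + h).
{ destruct (le_lt_dec m 0) as [Hm0|Hm0].
  - replace m with 0%nat by lia. rewrite Nat.add_0_r. lra.
  - apply Rle_trans with (2 := h3). apply Rmult_le_compat_r; [lra|]. apply le_INR.
    unfold steps in Hm. lia. }
destruct b; cbn [tnm fst snd axval] in *; unfold square in *; cbn [move fst snd] in *; lra.
Qed.

(** The discrete Taylor estimate passes to the limit because the number of steps times the mesh size
    tends to h. Only h >= 0 is covered, as the lattice estimate runs forward. *)
Lemma flim_taylor b p : B 2 p -> forall R', R' < R0 -> exists C, 0 <= C /\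
  forall u h, square R' u -> square R' (move b h u) -> 0 <= h ->
  Rabs (flim p (move b h u) - flim p u - h * flim (dl b p) u) <= C * h * h.
Proof.
intros Hp R' HR.
destruct (B_bd _ _ _ (B_dl _ _ b _ (B_dl _ _ b _ Hp)) R' HR) as [C HC]. exists (Rabs C). split; [apply Rabs_pos|].
intros u h Hu Hu' Hh. destruct HC as [e1 [He1 H1]].
assert (Hq : inq u) by now apply (square_inq R').
assert (Hq' : inq (move b h u)) by now apply (square_inq R').
assert (Hb : bd p) by now apply (B_bd _ 2). assert (Hdb : bd (dl b p)) by now apply (B_bd _ 1), B_dl.
apply (tends_le (fun k => Rabs (val p (move b h u) k - val p u k - INR (steps b u h k) * ek k * val (dl b p) u k))
   (fun k => Rabs C * (h + ek k) * (h + ek k))).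
- generalize (ek_small e1 He1). apply hyper_imp. intros k Hk. pose proof (ek_pos k) as He.
  destruct (steps_spec b u h k (axval_pos R' b u Hu) Hh) as [h1 [h2 h3]]. rewrite h1.
  assert (h4 : 0 <= INR (steps b u h k) * ek k) by (apply Rmult_le_pos; [apply pos_INR|lra]).
  apply Rle_trans with (Rabs C * (INR (steps b u h k) * ek k) * (INR (steps b u h k) * ek k)).
  + apply discrete_taylor; [exact He|apply Rabs_pos|]. intros m Hm. apply Rle_trans with C; [|apply Rle_abs].
    destruct (steps_inside R' b u h k m Hu Hu' Hh ltac:(lia)). apply H1; auto.
  + pose proof (Rabs_pos C). apply Rmult_le_compat; auto; [apply Rmult_le_pos; auto|].
    now apply Rmult_le_compat_l.
- apply tends_abs. apply tends_add; [apply tends_add; [|apply tends_opp]; now apply flim_tends|].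
  apply tends_opp. apply tends_mul; [|now apply flim_tends].
  apply (tends_squeeze _ ek); [apply ek_tends|]. apply hyper_all. intros k.
  now apply (steps_spec b u h k (axval_pos R' b u Hu) Hh).
- replace (Rabs C * h * h) with (Rabs C * (h + 0) * (h + 0)) by ring.
  apply tends_mul; [apply tends_mul; [apply tends_const|]|];
  (apply tends_add; [apply tends_const|apply ek_tends]).
Qed.

Lemma flim_lip b p : B 2 p -> forall R', R' < R0 -> exists C, 0 <= C /\
  forall u h, square R' u -> square R' (move b h u) -> 0 <= h ->
  Rabs (flim p (move b h u) - flim p u) <= C * h.
Proof.
intros Hp R' HR. destruct (flim_taylor b p Hp R' HR) as [C [HC H]].
assert (Hd := B_bd _ _ _ (B_dl _ _ b _ Hp)). destruct (Hd R' HR) as [C' HC'].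
exists (C * Rabs R' + Rabs C'). pose proof (Rabs_pos R'). pose proof (Rabs_pos C'). split; [nra|].
intros u h Hu Hu' Hh. specialize (H u h Hu Hu' Hh).
assert (HhR : h <= Rabs R').
{ apply Rle_trans with R'; [|apply Rle_abs]. destruct b; unfold square in *; simpl in *; lra. }
assert (Hb : Rabs (flim (dl b p) u) <= Rabs C').
{ apply Rle_trans with C'; [|apply Rle_abs]. now apply (flim_bound _ C' R'). }
replace (flim p (move b h u) - flim p u) with
  ((flim p (move b h u) - flim p u - h * flim (dl b p) u) + h * flim (dl b p) u) by ring.
apply Rle_trans with (1 := Rabs_triang _ _). rewrite Rabs_mult, (Rabs_pos_eq h Hh).
assert (C * h * h <= C * h * Rabs R') by (apply Rmult_le_compat_l; nra). nra.
Qed.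

Lemma flim_pd b p R' u : B 3 p -> R' < R0 -> square R' u -> pd R' b (flim p) u (flim (dl b p) u).
Proof.
intros Hp HR Hu.
destruct (flim_taylor b p (B_pred _ _ _ Hp) R' HR) as [C [HC H]].
destruct (flim_lip b (dl b p) (B_dl _ _ b _ Hp) R' HR) as [C' [HC' H']].
intros eta He. exists (eta / (C + C' + 1)). split; [apply Rdiv_lt_0_compat; lra|]. intros h Hh Hs.
assert (Hd : (C + C') * Rabs h <= eta).
{ apply Rle_trans with ((C + C' + 1) * (eta / (C + C' + 1))); [|right; field; lra].
  pose proof (Rabs_pos h). apply Rmult_le_compat; lra. }
destruct (Rle_dec 0 h) as [h0|h0].
- rewrite (Rabs_pos_eq h h0) in *. specialize (H u h Hu Hs h0). nra.
(* For negative h one expands forward from the displaced point and replaces the derivative there by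
   the one at u, at the price of the Lipschitz constant C'. This is what uses the third order of
   p. *)
- rewrite (Rabs_left h) in * by lra.
  assert (Hm : move b (- h) (move b h u) = u).
  { rewrite move_move. replace (- h + h) with 0 by ring. apply move_0. }
  assert (H1 := H (move b h u) (- h) Hs). rewrite Hm in H1. specialize (H1 Hu ltac:(lra)).
  assert (H2 := H' (move b h u) (- h) Hs). rewrite Hm in H2. specialize (H2 Hu ltac:(lra)).
  replace (flim p (move b h u) - flim p u - h * flim (dl b p) u) with
   (- (flim p u - flim p (move b h u) - - h * flim (dl b p) (move b h u)) +
     - h * (flim (dl b p) u - flim (dl b p) (move b h u))) by ring.
  apply Rle_trans with (1 := Rabs_triang _ _). rewrite Rabs_Ropp, Rabs_mult, (Rabs_pos_eq (- h)) by lra.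
  assert (- h * Rabs (flim (dl b p) u - flim (dl b p) (move b h u)) <= - h * (C' * - h)) by (apply Rmult_le_compat_l; lra).
  nra.
Qed.

Definition dlw (w : list axis) (p : fam) : fam := fold_right dl p w.
Lemma dlw_B p : (forall N, B N p) -> forall w N, B N (dlw w p).
Proof. intros Hp w. induction w as [|b w IH]; intros N; [apply Hp|]. apply B_dl. apply IH. Qed.

Definition flim_jet (p : fam) : jet := fun _ w u => flim (dlw w p) u.
Lemma flim_jet_smooth p : (forall N, B N p) -> smooth_jet R0 (flim_jet p).
Proof.
intros Hp R' w HR. destruct (B_bd _ 0 _ (dlw_B p Hp w 0) R' HR) as [C HC].
exists C, 1. split; [lra|]. intros e _ u Hu. split.
- apply (flim_bound _ C R'); auto. now apply (B_bd _ 0), dlw_B.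
- intros b. apply (flim_pd b (dlw w p)); auto. now apply dlw_B.
Qed.
(** The derivatives of a limit are limits of difference quotients and inherit their commutation; no
    theorem on mixed derivatives is involved. *)
Lemma flim_jet_commuting p : commuting (flim_jet p).
Proof. intros e b b' w u. unfold flim_jet. simpl. now rewrite dl_comm. Qed.

Lemma move_to (u v : vec2) : v = move ax2 (snd v - snd u) (move ax1 (fst v - fst u) u).
Proof. destruct u, v; simpl; f_equal; ring. Qed.

Lemma flim_continuous p r : B 2 p -> r < R0 -> forall u, square r u ->
  filterlim (flim p) (within (square r) (locally u)) (locally (flim p u)).
Proof.
intros Hp Hr u Hu P [eps HP].
destruct (flim_lip ax1 p Hp r Hr) as [C1 [HC1 H1]].
destruct (flim_lip ax2 p Hp r Hr) as [C2 [HC2 H2]].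
assert (H : forall b C, (forall u h, square r u -> square r (move b h u) -> 0 <= h ->
  Rabs (flim p (move b h u) - flim p u) <= C * h) -> forall u h, square r u -> square r (move b h u) ->
  Rabs (flim p (move b h u) - flim p u) <= C * Rabs h).
{ intros b C Hb v h Hv Hv'. destruct (Rle_dec 0 h) as [h0|h0].
  - rewrite (Rabs_pos_eq h h0). now apply Hb.
  - rewrite (Rabs_left h) by lra. rewrite Rabs_minus_sym.
    assert (Hm : move b (- h) (move b h v) = v).
    { rewrite move_move. replace (- h + h) with 0 by ring. apply move_0. }
    rewrite <- Hm at 1. apply Hb; auto; [now rewrite Hm|lra]. }
assert (Hd : 0 < eps / (C1 + C2 + 1)) by (apply Rdiv_lt_0_compat; [apply cond_pos|lra]).
exists (mkposreal _ Hd). intros v [Hv1 Hv2] Hv. apply HP.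
change (Rabs (fst v - fst u) < eps / (C1 + C2 + 1)) in Hv1.
change (Rabs (snd v - snd u) < eps / (C1 + C2 + 1)) in Hv2.
change (Rabs (flim p v - flim p u) < eps).
(* The corner of an L-shaped path from u to v; it stays in the square, and each leg is parallel to
   an axis. *)
pose (m := move ax1 (fst v - fst u) u).
assert (Em : m = (fst v, snd u)) by (unfold m; simpl; f_equal; ring).
assert (Ev : v = move ax2 (snd v - snd u) m) by apply move_to.
assert (Hm : square r m) by (rewrite Em; unfold square in *; simpl; lra).
assert (h1 := H ax1 C1 H1 u (fst v - fst u) Hu Hm).
assert (h2 := H ax2 C2 H2 m (snd v - snd u) Hm ltac:(rewrite <- Ev; exact Hv)). rewrite <- Ev in h2.
fold m in h1.
assert (h0 : flim p v - flim p u = (flim p v - flim p m) + (flim p m - flim p u)) by ring.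
rewrite h0.
apply Rle_lt_trans with (1 := Rabs_triang _ _).
assert (C1 * Rabs (fst v - fst u) <= C1 * (eps / (C1 + C2 + 1))) by (apply Rmult_le_compat_l; lra).
assert (C2 * Rabs (snd v - snd u) <= C2 * (eps / (C1 + C2 + 1))) by (apply Rmult_le_compat_l; lra).
assert ((C1 + C2 + 1) * (eps / (C1 + C2 + 1)) = eps) by (field; lra).
lra.
Qed.

Lemma partials_flim p r : (forall N, B N p) -> 0 < r < R0 -> forall w u, square r u ->
  partials (square r) w (flim p) u = flim (dlw w p) u.
Proof.
intros Hp Hr w. induction w as [|b w IH]; intros u Hu; [reflexivity|].
simpl. apply partial_pd; [lra|exact Hu|].
apply (pd_ext r b (flim (dlw w p))); [exact Hu|intros; symmetry; now apply IH|].
apply flim_pd; [now apply dlw_B|lra|exact Hu].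
Qed.

Lemma flim_smooth_on p r : (forall N, B N p) -> 0 < r < R0 -> smooth_on (square r) (flim p).
Proof.
intros Hp Hr w u Hu. split.
- rewrite partials_flim by auto.
  intros P HP. generalize (flim_continuous (dlw w p) r (dlw_B p Hp w 2) ltac:(lra) u Hu P HP).
  unfold filtermap, within. apply filter_imp. intros v h Hv. rewrite partials_flim by auto. now apply h.
- intros b. exists (flim (dl b (dlw w p)) u). apply pd_is_partial; [exact Hu|].
  apply (pd_ext r b (flim (dlw w p))); [exact Hu|intros; symmetry; now apply partials_flim|].
  apply flim_pd; [now apply dlw_B|lra|exact Hu].
Qed.

End Limits.

(** * Discrete K-surfaces and their Baecklund transforms *)

Inductive c3 : Set := cx | cy | cz.
Definition co (k : c3) (v : vec3) : R := match k with cx => vx v | cy => vy v | cz => vz v end.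

Lemma vec_ext (v w : vec3) : (forall k, co k v = co k w) -> v = w.
Proof.
intros H. destruct v as [[v1 v2] v3], w as [[w1 w2] w3].
pose proof (H cx) as H1. pose proof (H cy) as H2. pose proof (H cz) as H3.
cbv in H1, H2, H3. congruence.
Qed.
Lemma co_add k v w : co k (v + w)%V = co k v + co k w.
Proof. destruct k; reflexivity. Qed.
Lemma co_sub k v w : co k (v - w)%V = co k v - co k w.
Proof. destruct k; reflexivity. Qed.
Lemma co_opp k v : co k (- v)%V = - co k v.
Proof. destruct k; reflexivity. Qed.
Lemma co_scal k a v : co k (a *: v)%V = a * co k v.
Proof. destruct k; reflexivity. Qed.
Lemma dot_co v w : dot v w = co cx v * co cx w + co cy v * co cy w + co cz v * co cz w.
Proof. reflexivity. Qed.
Lemma co_cross k v w : co k (cross v w) =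
  match k with
  | cx => co cy v * co cz w - co cz v * co cy w
  | cy => co cz v * co cx w - co cx v * co cz w
  | cz => co cx v * co cy w - co cy v * co cx w
  end.
Proof. destruct k; reflexivity. Qed.
Hint Rewrite co_add co_sub co_opp co_scal : vec.

Ltac vec := apply vec_ext; intros k; autorewrite with vec;
  try (rewrite !co_cross; destruct k; autorewrite with vec); try ring.

Lemma dot_comm v w : dot v w = dot w v.
Proof. rewrite !dot_co; ring. Qed.
Lemma dot_add_l u v w : dot (u + v)%V w = dot u w + dot v w.
Proof. rewrite !dot_co; autorewrite with vec; ring. Qed.
Lemma dot_add_r u v w : dot w (u + v)%V = dot w u + dot w v.
Proof. rewrite !dot_co; autorewrite with vec; ring. Qed.
Lemma dot_sub_l u v w : dot (u - v)%V w = dot u w - dot v w.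
Proof. rewrite !dot_co; autorewrite with vec; ring. Qed.
Lemma dot_sub_r u v w : dot w (u - v)%V = dot w u - dot w v.
Proof. rewrite !dot_co; autorewrite with vec; ring. Qed.
Lemma dot_scal_l a v w : dot (a *: v)%V w = a * dot v w.
Proof. rewrite !dot_co; autorewrite with vec; ring. Qed.
Lemma dot_scal_r a v w : dot w (a *: v)%V = a * dot w v.
Proof. rewrite !dot_co; autorewrite with vec; ring. Qed.
Lemma dot_opp_r v w : dot w (- v)%V = - dot w v.
Proof. rewrite !dot_co; autorewrite with vec; ring. Qed.
Lemma dot_opp_l v w : dot (- v)%V w = - dot v w.
Proof. rewrite !dot_co; autorewrite with vec; ring. Qed.
Hint Rewrite dot_add_l dot_add_r dot_sub_l dot_sub_r dot_scal_l dot_scal_r dot_opp_l dot_opp_r : dot.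

Lemma dot_pos v : 0 <= dot v v.
Proof. rewrite dot_co. nra. Qed.
Lemma dot_zero v : dot v v = 0 -> v = (0, 0, 0).
Proof.
intros H. rewrite dot_co in H. apply vec_ext. intros k. 
assert (co cx v = 0 /\ co cy v = 0 /\ co cz v = 0) as [h1 [h2 h3]] by (repeat split; nra).
destruct k; assumption.
Qed.

Lemma norm_dot (v : vec3) : norm v = sqrt (dot v v).
Proof.
destruct v as [[x y] z].
change (norm ((x, y, z) : vec3)) with (sqrt (sqrt (Rabs x ^ 2 + Rabs y ^ 2) ^ 2 + Rabs z ^ 2)).
rewrite !pow2_abs, pow2_sqrt by nra. f_equal. unfold dot, vx, vy, vz; simpl. ring.
Qed.
Lemma sphere_dot v : sphere v <-> dot v v = 1.
Proof.
unfold sphere. rewrite norm_dot. split; intros H.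
- rewrite <- (sqrt_sqrt (dot v v)) by apply dot_pos. rewrite H. ring.
- rewrite H. apply sqrt_1.
Qed.
Lemma norm_le_sum v : norm v <= Rabs (co cx v) + Rabs (co cy v) + Rabs (co cz v).
Proof.
rewrite norm_dot. pose proof (Rabs_pos (co cx v)). pose proof (Rabs_pos (co cy v)). pose proof (Rabs_pos (co cz v)).
rewrite <- (sqrt_Rsqr (Rabs (co cx v) + Rabs (co cy v) + Rabs (co cz v))) by lra.
apply sqrt_le_1_alt. rewrite dot_co. unfold Rsqr.
assert (h : forall x, x * x = Rabs x * Rabs x) by (intros x; rewrite <- Rabs_mult; symmetry; apply Rabs_pos_eq; nra).
rewrite (h (co cx v)), (h (co cy v)), (h (co cz v)). nra.
Qed.
(** This is 0 <= |v - <v,w> w|^2. *)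
Lemma cauchy_schwarz_unit v w : dot w w = 1 -> dot v w * dot v w <= dot v v.
Proof.
intros H. pose proof (dot_pos (v - dot v w *: w)%V) as h. autorewrite with dot in h.
rewrite (dot_comm w v), H in h. nra.
Qed.

(** For unit n1 and n2 one has 1 + <n1,n2> = |n1 + n2|^2 / 2, so this is the image of n under the
    half-turn about n1 + n2. It exchanges n1 and n2, whence the preserved products of opposite
    edges; [step_B2] is the same with np for n1. *)
Definition step_K (n n1 n2 : vec3) : vec3 :=
  ((dot n (n1 + n2)%V / (1 + dot n1 n2)) *: (n1 + n2) - n)%V.
(** For unit n1 and np this is the image of n under the reflection that exchanges n1 and np. *)
Definition step_B1 (n n1 np : vec3) : vec3 :=
  (n + (dot n (n1 - np)%V / (1 - dot n1 np)) *: (np - n1))%V.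
Definition step_B2 (n n2 np : vec3) : vec3 :=
  ((dot n (n2 + np)%V / (1 + dot n2 np)) *: (np + n2) - n)%V.
Definition step_B (b : axis) : vec3 -> vec3 -> vec3 -> vec3 :=
  match b with ax1 => step_B1 | ax2 => step_B2 end.

(** * Elementary quadrilaterals and the cube *)

Section Quads.
Variables n n1 n2 np : vec3.
Hypothesis (Un : dot n n = 1) (Un1 : dot n1 n1 = 1) (Un2 : dot n2 n2 = 1) (Unp : dot np np = 1).

Lemma step_K_facts : 1 + dot n1 n2 <> 0 ->
  dot (step_K n n1 n2) (step_K n n1 n2) = 1 /\
  dot n2 (step_K n n1 n2) = dot n n1 /\ dot n1 (step_K n n1 n2) = dot n n2.
Proof.
intros H. unfold step_K. set (a := dot n (n1 + n2)%V / (1 + dot n1 n2)).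
assert (Ha : a * (1 + dot n1 n2) = dot n n1 + dot n n2).
{ unfold a. rewrite dot_add_r. field. exact H. }
autorewrite with dot. rewrite ?(dot_comm n2 n1), ?(dot_comm n1 n), ?(dot_comm n2 n), Un, Un1, Un2.
repeat split; nra.
Qed.

Lemma step_B1_facts : 1 - dot n1 np <> 0 ->
  dot (step_B1 n n1 np) (step_B1 n n1 np) = 1 /\
  dot n1 (step_B1 n n1 np) = dot n np /\ dot np (step_B1 n n1 np) = dot n n1.
Proof.
intros H. unfold step_B1. set (a := dot n (n1 - np)%V / (1 - dot n1 np)).
assert (Ha : a * (1 - dot n1 np) = dot n n1 - dot n np).
{ unfold a. rewrite dot_sub_r. field. exact H. }
autorewrite with dot. rewrite ?(dot_comm np n1), ?(dot_comm n1 n), ?(dot_comm np n), Un, Un1, Unp.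
repeat split; nra.
Qed.

Lemma step_B2_facts : 1 + dot n2 np <> 0 ->
  dot (step_B2 n n2 np) (step_B2 n n2 np) = 1 /\
  dot n2 (step_B2 n n2 np) = dot n np /\ dot np (step_B2 n n2 np) = dot n n2.
Proof.
intros H. unfold step_B2. set (a := dot n (n2 + np)%V / (1 + dot n2 np)).
assert (Ha : a * (1 + dot n2 np) = dot n n2 + dot n np).
{ unfold a. rewrite dot_add_r. field. exact H. }
autorewrite with dot. rewrite ?(dot_comm np n2), ?(dot_comm n2 n), ?(dot_comm np n), Un, Un2, Unp.
repeat split; nra.
Qed.

(* With a, b, c the coefficients of the three faces at n and
   d = ab + ac - bc, the three opposite faces have coefficients a/d, b/d, c/d. *)
Lemma cube_consistent :
  let n12 := step_K n n1 n2 in let np1 := step_B1 n n1 np in let np2 := step_B2 n n2 np in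
  1 + dot n1 n2 <> 0 -> 1 - dot n1 np <> 0 -> 1 + dot n2 np <> 0 -> 1 + dot n12 np1 <> 0 ->
  1 - dot n12 np2 <> 0 /\ 1 + dot np1 np2 <> 0 /\
  step_B2 n1 n12 np1 = step_B1 n2 n12 np2 /\ step_B2 n1 n12 np1 = step_K np np1 np2.
Proof.
intros n12 np1 np2 H1 H2 H3 H4.
set (a := dot n (n1 + n2)%V / (1 + dot n1 n2)).
set (b := dot n (n1 - np)%V / (1 - dot n1 np)).
set (c := dot n (n2 + np)%V / (1 + dot n2 np)).
assert (Ea : n12 = (a *: (n1 + n2) - n)%V) by reflexivity.
assert (Eb : np1 = (n + b *: (np - n1))%V) by reflexivity.
assert (Ec : np2 = (c *: (np + n2) - n)%V) by reflexivity.
assert (Ha : dot n n2 = a * (1 + dot n1 n2) - dot n n1).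
{ unfold a. rewrite dot_add_r. field. exact H1. }
assert (Hb : dot n np = dot n n1 - b * (1 - dot n1 np)).
{ unfold b. rewrite dot_sub_r. field. exact H2. }
assert (Hc : c * (1 + dot n2 np) = dot n n2 + dot n np).
{ unfold c. rewrite dot_add_r. field. exact H3. }
rewrite Hb, Ha in Hc.
(* The single linear relation between a, b and c: after expansion, each of the three opposite
   denominators is d times the original one up to a multiple of this expression. *)
assert (Hc' : a * (1 + dot n1 n2) - b * (1 - dot n1 np) - c * (1 + dot n2 np) = 0) by lra.
set (d := a * b + a * c - b * c).
assert (D1 : 1 + dot n12 np1 = (1 + dot n2 np) * d).
{ rewrite Ea, Eb. autorewrite with dot. rewrite ?(dot_comm n2 n1), ?(dot_comm n1 n), ?(dot_comm n2 n), ?(dot_comm np n), Un, Un1, Hb, Ha.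
  unfold d. match goal with |- ?l = ?r => replace l with (r + (a - b) * (a * (1 + dot n1 n2) - b * (1 - dot n1 np) - c * (1 + dot n2 np))) by ring end.
  rewrite Hc'. ring. }
assert (D2 : 1 - dot n12 np2 = (1 - dot n1 np) * d).
{ rewrite Ea, Ec. autorewrite with dot. rewrite ?(dot_comm n2 n1), ?(dot_comm n1 n), ?(dot_comm n2 n), ?(dot_comm np n), Un, Un2, Hb, Ha.
  unfold d. match goal with |- ?l = ?r => replace l with (r + a * (a * (1 + dot n1 n2) - b * (1 - dot n1 np) - c * (1 + dot n2 np))) by ring end.
  rewrite Hc'. ring. }
assert (D3 : 1 + dot np1 np2 = (1 + dot n1 n2) * d).
{ rewrite Eb, Ec. autorewrite with dot. rewrite ?(dot_comm n2 n1), ?(dot_comm n1 n), ?(dot_comm n2 n), ?(dot_comm np n), ?(dot_comm np n2), Un, Unp, Hb, Ha.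
  unfold d. match goal with |- ?l = ?r => replace l with (r - b * (a * (1 + dot n1 n2) - b * (1 - dot n1 np) - c * (1 + dot n2 np))) by ring end.
  rewrite Hc'. ring. }
(* One nonzero denominator on an opposite face forces d <> 0, and then the other two opposite faces
   are nondegenerate as well. *)
assert (Hd : d <> 0) by (intros h; rewrite h in D1; lra).
assert (H5 : 1 - dot n12 np2 <> 0) by (rewrite D2; now apply Rmult_integral_contrapositive_currified).
assert (H6 : 1 + dot np1 np2 <> 0) by (rewrite D3; now apply Rmult_integral_contrapositive_currified).
split; [exact H5|split; [exact H6|]].
destruct (step_K_facts H1) as [_ [K1 K2]]. fold n12 in K1, K2.
destruct (step_B1_facts H2) as [_ [P1 P2]]. fold np1 in P1, P2.
destruct (step_B2_facts H3) as [_ [Q1 Q2]]. fold np2 in Q1, Q2.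
assert (E1 : dot n1 (n12 + np1)%V / (1 + dot n12 np1) = c / d).
{ rewrite D1, dot_add_r, K2, P1.
  replace (dot n n2 + dot n np) with (c * (1 + dot n2 np)) by (rewrite Ha, Hb; lra). field. split; assumption. }
assert (E2 : dot n2 (n12 - np2)%V / (1 - dot n12 np2) = b / d).
{ rewrite D2, dot_sub_r, K1, Q1, Hb. field. split; assumption. }
assert (E3 : dot np (np1 + np2)%V / (1 + dot np1 np2) = a / d).
{ rewrite D3, dot_add_r, P2, Q2, Ha. field. split; assumption. }
assert (Hs : d = a * b + a * c - b * c) by reflexivity. clearbody d.
unfold step_B2 at 1, step_B1 at 1. unfold step_B2 at 1, step_K at 1. rewrite E1, E2, E3, Ea, Eb, Ec.
clear - Hs Hd.
split; apply vec_ext; intros k; autorewrite with vec; subst d; field; exact Hd.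
Qed.
End Quads.

(** * Arrays generated by the discrete evolutions *)

Section Arrays.
Variables (x y : nat -> vec3) (I J : nat) (eta : R).
Hypothesis Hxy : x 0%nat = y 0%nat.
Hypothesis (Ux : forall i, dot (x i) (x i) = 1) (Uy : forall j, dot (y j) (y j) = 1).
Hypothesis Heta : eta <= 1 / 8.
Hypothesis Hx : forall i, (i < I)%nat -> 1 - dot (x i) (x (S i)) <= eta.
Hypothesis Hy : forall j, (j < J)%nat -> 1 - dot (y j) (y (S j)) <= eta.

(** A cell needs the previous row at j and j + 1 and the current row at j, hence the inner recursion
    along a row. Row 0 is y, so the value x 0 is recovered only through [Hxy]. *)
Fixpoint arrN (i : nat) : nat -> vec3 :=
  match i with
  | O => y
  | S i' => fix go (j : nat) : vec3 :=
      match j with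
      | O => x (S i')
      | S j' => step_K (arrN i' j') (go j') (arrN i' (S j'))
      end
  end.
Lemma arrN_x i : arrN i 0 = x i.
Proof. destruct i; [now symmetry|reflexivity]. Qed.
Lemma arrN_SS i j : arrN (S i) (S j) = step_K (arrN i j) (arrN (S i) j) (arrN i (S j)).
Proof. reflexivity. Qed.

(** Expanding 0 <= |n1 + n2 - 2 n|^2 gives <n1,n2> >= 1 - 4 eta, which is at least 1/2 for eta <=
    1/8. *)
Lemma three_points n n1 n2 : dot n n = 1 -> dot n1 n1 = 1 -> dot n2 n2 = 1 ->
  1 - dot n n1 <= eta -> 1 - dot n n2 <= eta -> 1 <= 1 + dot n1 n2.
Proof.
intros H H1 H2 h1 h2. pose proof (dot_pos (n1 + n2 - 2 *: n)%V) as h. autorewrite with dot in h.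
rewrite (dot_comm n2 n1), (dot_comm n1 n), (dot_comm n2 n), H, H1, H2 in h. lra.
Qed.

Lemma arrN_cell i j : (i < I)%nat -> (j < J)%nat ->
  dot (arrN i j) (arrN i j) = 1 -> dot (arrN (S i) j) (arrN (S i) j) = 1 ->
  dot (arrN i (S j)) (arrN i (S j)) = 1 ->
  dot (arrN i j) (arrN (S i) j) = dot (x i) (x (S i)) ->
  dot (arrN i j) (arrN i (S j)) = dot (y j) (y (S j)) ->
  dot (arrN (S i) (S j)) (arrN (S i) (S j)) = 1 /\
  dot (arrN i (S j)) (arrN (S i) (S j)) = dot (x i) (x (S i)) /\
  dot (arrN (S i) j) (arrN (S i) (S j)) = dot (y j) (y (S j)).
Proof.
intros Hi Hj U U1 U2 E1 E2. rewrite arrN_SS.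
assert (hn : 1 <= 1 + dot (arrN (S i) j) (arrN i (S j))).
{ apply (three_points (arrN i j)); auto; [rewrite E1; now apply Hx|rewrite E2; now apply Hy]. }
destruct (step_K_facts _ _ _ U U1 U2 ltac:(lra)) as [k1 [k2 k3]].
split; [exact k1|split]; congruence.
Qed.

(** The bounds on edges are assumed on the axes only. Opposite edges of a cell have equal products,
    so smallness of the edges and with it the nondegeneracy of the next cell propagate together; the
    three clauses are what that cell consumes. *)
Lemma arrN_facts : forall i j, (i <= I)%nat -> (j <= J)%nat ->
  dot (arrN i j) (arrN i j) = 1 /\
  ((i < I)%nat -> dot (arrN (S i) j) (arrN (S i) j) = 1 /\ dot (arrN i j) (arrN (S i) j) = dot (x i) (x (S i))) /\
  ((j < J)%nat -> dot (arrN i j) (arrN i (S j)) = dot (y j) (y (S j))).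
Proof.
induction i as [|i IHi]; (induction j as [|j IHj]; intros Hi Hj).
- split; [apply Uy|split]; intros h; [|reflexivity]. rewrite !arrN_x. now split.
- destruct IHj as [h1 [h2 h3]]; [lia|lia|]. split; [apply Uy|split]; intros h; [|reflexivity].
  destruct (h2 h) as [h4 h5].
  destruct (arrN_cell 0 j h Hj h1 h4 (Uy (S j)) h5 (h3 Hj)) as [k1 [k2 _]]. now split.
- rewrite !arrN_x. split; [apply Ux|split]; intros h; [now split|].
  destruct (IHi 0%nat) as [h1 [h2 h3]]; [lia|lia|]. destruct (h2 Hi) as [h4 h5].
  destruct (IHi 1%nat) as [h6 _]; [lia|lia|].
  rewrite <- (arrN_x (S i)). exact (proj2 (proj2 (arrN_cell i 0 Hi h h1 h4 h6 h5 (h3 h)))).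
- destruct (IHj Hi ltac:(lia)) as [h1 [h2 h3]].
  destruct (IHi (S j)) as [g1 [g2 g3]]; [lia|lia|]. destruct (g2 Hi) as [U g5].
  split; [exact U|split]; intros h.
  + destruct (h2 h) as [h4 h5].
    destruct (arrN_cell (S i) j h Hj h1 h4 U h5 (h3 Hj)) as [k1 [k2 _]]. now split.
  + destruct (IHi (S (S j))) as [g6 _]; [lia|lia|].
    exact (proj2 (proj2 (arrN_cell i (S j) Hi h g1 U g6 g5 (g3 h)))).
Qed.

Lemma arrN_unit i j : (i <= I)%nat -> (j <= J)%nat -> dot (arrN i j) (arrN i j) = 1.
Proof. intros Hi Hj. now apply arrN_facts. Qed.
Lemma arrN_chord1 i j : (i < I)%nat -> (j <= J)%nat -> dot (arrN i j) (arrN (S i) j) = dot (x i) (x (S i)).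
Proof. intros Hi Hj. now apply arrN_facts; [lia| |]. Qed.
Lemma arrN_chord2 i j : (i <= I)%nat -> (j < J)%nat -> dot (arrN i j) (arrN i (S j)) = dot (y j) (y (S j)).
Proof. intros Hi Hj. now apply arrN_facts; [|lia|]. Qed.
Lemma arrN_den i j : (i < I)%nat -> (j < J)%nat -> 1 <= 1 + dot (arrN (S i) j) (arrN i (S j)).
Proof.
intros Hi Hj. apply (three_points (arrN i j)); try (apply arrN_unit; lia).
- rewrite arrN_chord1 by lia. now apply Hx.
- rewrite arrN_chord2 by lia. now apply Hy.
Qed.

Variable f0 : vec3.
Fixpoint arrF (i j : nat) : vec3 :=
  match j with
  | O => (fix go (i : nat) : vec3 :=
      match i with
      | O => f0
      | S i' => (go i' + cross (arrN (S i') 0) (arrN i' 0))%V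
      end) i
  | S j' => (arrF i j' + cross (arrN i j') (arrN i (S j')))%V
  end.
Lemma arrF_2 i j : arrF i (S j) = (arrF i j + cross (arrN i j) (arrN i (S j)))%V.
Proof. destruct i; reflexivity. Qed.
(** f is summed along axis 1 and then upwards, so this equation is the closing condition around a
    cell. Both paths give a n1 x n2, because n + n12 = a (n1 + n2). *)
Lemma arrF_1 i j : arrF (S i) j = (arrF i j + cross (arrN (S i) j) (arrN i j))%V.
Proof.
induction j as [|j IH]; [reflexivity|].
rewrite !arrF_2, IH, arrN_SS. unfold step_K. generalize (dot (arrN i j) (arrN (S i) j + arrN i (S j))%V / (1 + dot (arrN (S i) j) (arrN i (S j)))). intros a. vec.
Qed.

Variable np0 : vec3.
Fixpoint arrP (i j : nat) : vec3 :=
  match j with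
  | O => (fix go (i : nat) : vec3 :=
      match i with
      | O => np0
      | S i' => step_B1 (arrN i' 0) (arrN (S i') 0) (go i')
      end) i
  | S j' => step_B2 (arrN i j') (arrN i (S j')) (arrP i j')
  end.
Lemma arrP_2 i j : arrP i (S j) = step_B2 (arrN i j) (arrN i (S j)) (arrP i j).
Proof. destruct i; reflexivity. Qed.
Lemma arrP_10 i : arrP (S i) 0 = step_B1 (arrN i 0) (arrN (S i) 0) (arrP i 0).
Proof. reflexivity. Qed.

Variable kappa : R.
Hypothesis Unp0 : dot np0 np0 = 1.
Hypothesis Hk : 0 < kappa.
Hypothesis Hk1 : kappa <= 1 - dot (x 0%nat) np0.
Hypothesis Hk2 : kappa <= 1 + dot (x 0%nat) np0.
Hypothesis Hke : 8 * eta <= kappa * kappa.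

(* <n, p> is conserved and n' is close to n, hence the denominators at n' are
   bounded below. *)
Lemma dens_B n n' p : dot n n = 1 -> dot n' n' = 1 -> dot p p = 1 -> dot n p = dot (x 0%nat) np0 ->
  1 - dot n n' <= eta -> kappa / 2 <= 1 - dot n' p /\ kappa / 2 <= 1 + dot n' p.
Proof.
(* Here |<n' - n, p>|^2 <= 2 (1 - <n,n'>) <= 2 eta <= (kappa/2)^2, so half of kappa remains. *)
intros H H' Hp Ht He. pose proof (cauchy_schwarz_unit (n' - n)%V p Hp) as h.
autorewrite with dot in h. rewrite (dot_comm n' n), H, H', Ht in h. split; nra.
Qed.

Lemma arrP_facts : forall j i, (i <= I)%nat -> (j <= J)%nat ->
  dot (arrP i j) (arrP i j) = 1 /\ dot (arrN i j) (arrP i j) = dot (x 0%nat) np0.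
Proof.
induction j as [|j IHj].
- induction i as [|i IHi]; intros Hi Hj.
  + split; [exact Unp0|]. now rewrite arrN_x.
  + destruct IHi as [h1 h2]; [lia|lia|]. rewrite arrP_10.
    assert (u := arrN_unit i 0 ltac:(lia) ltac:(lia)). assert (u1 := arrN_unit (S i) 0 ltac:(lia) ltac:(lia)).
    destruct (dens_B (arrN i 0) (arrN (S i) 0) (arrP i 0) u u1 h1 h2) as [d _].
    { rewrite arrN_chord1 by lia. apply Hx; lia. }
    destruct (step_B1_facts _ _ _ u u1 h1 ltac:(lra)) as [k1 [k2 k3]].
    split; [exact k1|]. now rewrite k2.
- intros i Hi Hj. destruct (IHj i) as [h1 h2]; [lia|lia|]. rewrite arrP_2.
  assert (u := arrN_unit i j ltac:(lia) ltac:(lia)). assert (u1 := arrN_unit i (S j) ltac:(lia) ltac:(lia)).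
  destruct (dens_B (arrN i j) (arrN i (S j)) (arrP i j) u u1 h1 h2) as [_ d].
  { rewrite arrN_chord2 by lia. apply Hy; lia. }
  destruct (step_B2_facts _ _ _ u u1 h1 ltac:(lra)) as [k1 [k2 k3]].
  split; [exact k1|]. now rewrite k2.
Qed.
Lemma arrP_unit i j : (i <= I)%nat -> (j <= J)%nat -> dot (arrP i j) (arrP i j) = 1.
Proof. intros Hi Hj. now apply arrP_facts. Qed.
Lemma arrP_dot i j : (i <= I)%nat -> (j <= J)%nat -> dot (arrN i j) (arrP i j) = dot (x 0%nat) np0.
Proof. intros Hi Hj. now apply arrP_facts. Qed.

Lemma arrP_den1 i j : (i < I)%nat -> (j <= J)%nat -> kappa / 2 <= 1 - dot (arrN (S i) j) (arrP i j).
Proof.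
intros Hi Hj. apply (dens_B (arrN i j)); try (apply arrN_unit; lia).
- apply arrP_unit; lia.
- apply arrP_dot; lia.
- rewrite arrN_chord1 by lia. now apply Hx.
Qed.
Lemma arrP_den2 i j : (i <= I)%nat -> (j < J)%nat -> kappa / 2 <= 1 + dot (arrN i (S j)) (arrP i j).
Proof.
intros Hi Hj. apply (dens_B (arrN i j)); try (apply arrN_unit; lia).
- apply arrP_unit; lia.
- apply arrP_dot; lia.
- rewrite arrN_chord2 by lia. now apply Hy.
Qed.

(** n+ is built along axis 1 and then upwards, so off the axis the first evolution has to be proved:
    it is carried from row j to row j + 1 by the consistency of the cube. *)
Lemma arrP_1 : forall j i, (i < I)%nat -> (j <= J)%nat ->
  arrP (S i) j = step_B1 (arrN i j) (arrN (S i) j) (arrP i j).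
Proof.
induction j as [|j IH]; intros i Hi Hj; [reflexivity|].
rewrite arrP_2, (IH i Hi) by lia.
pose proof (arrN_den i j Hi ltac:(lia)). pose proof (arrP_den1 i j Hi ltac:(lia)).
pose proof (arrP_den2 i j ltac:(lia) ltac:(lia)).
pose proof (arrP_den2 (S i) j ltac:(lia) ltac:(lia)) as h4. rewrite (IH i Hi ltac:(lia)), arrN_SS in h4.
destruct (cube_consistent (arrN i j) (arrN (S i) j) (arrN i (S j)) (arrP i j)) as [_ [_ [h _]]]; try lra;
 try (apply arrN_unit; lia); try (apply arrP_unit; lia).
rewrite (arrN_SS i j), h. now rewrite arrP_2.
Qed.
(** The remaining face of the same cube: the transformed Gauss map satisfies the equation of
    discrete K-surfaces. *)
Lemma arrP_gauss i j : (i < I)%nat -> (j < J)%nat ->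
  1 + dot (arrP (S i) j) (arrP i (S j)) <> 0 /\
  arrP (S i) (S j) = step_K (arrP i j) (arrP (S i) j) (arrP i (S j)).
Proof.
intros Hi Hj.
pose proof (arrN_den i j Hi ltac:(lia)). pose proof (arrP_den1 i j Hi ltac:(lia)).
pose proof (arrP_den2 i j ltac:(lia) ltac:(lia)).
pose proof (arrP_den2 (S i) j ltac:(lia) ltac:(lia)) as h4. rewrite (arrP_1 j i Hi ltac:(lia)), arrN_SS in h4.
destruct (cube_consistent (arrN i j) (arrN (S i) j) (arrN i (S j)) (arrP i j)) as [_ [h1 [_ h2]]]; try lra;
 try (apply arrN_unit; lia); try (apply arrP_unit; lia).
rewrite (arrP_2 (S i) j), (arrP_1 j i Hi ltac:(lia)), (arrN_SS i j), h2, (arrP_2 i j). split; [exact h1|reflexivity].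
Qed.

Definition arrG (i j : nat) : vec3 := (arrF i j + cross (arrP i j) (arrN i j))%V.
(** tau_1 n+ - n is a multiple of n+ - tau_1 n, so its cross product with tau_1 n - n+ vanishes; the
    rest is bilinearity. *)
Lemma arrG_1 i j : (i < I)%nat -> (j <= J)%nat -> arrG (S i) j = (arrG i j + cross (arrP (S i) j) (arrP i j))%V.
Proof.
intros Hi Hj. unfold arrG. rewrite (arrP_1 j i Hi Hj), arrF_1. unfold step_B1.
generalize (dot (arrN i j) (arrN (S i) j - arrP i j)%V / (1 - dot (arrN (S i) j) (arrP i j))). intros a. vec.
Qed.
Lemma arrG_2 i j : arrG i (S j) = (arrG i j + cross (arrP i j) (arrP i (S j)))%V.
Proof.
unfold arrG. rewrite arrP_2, arrF_2. unfold step_B2.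
generalize (dot (arrN i j) (arrN i (S j) + arrP i j)%V / (1 + dot (arrN i (S j)) (arrP i j))). intros a. vec.
Qed.

Record arr_cell (i j : nat) : Prop := {
  c_N : dot (arrN i j) (arrN i j) = 1;
  c_N1 : dot (arrN (S i) j) (arrN (S i) j) = 1;
  c_N2 : dot (arrN i (S j)) (arrN i (S j)) = 1;
  c_P : dot (arrP i j) (arrP i j) = 1;
  c_NP : dot (arrN i j) (arrP i j) = dot (x 0%nat) np0;
  c_ch1 : dot (arrN i j) (arrN (S i) j) = dot (x i) (x (S i));
  c_ch2 : dot (arrN i j) (arrN i (S j)) = dot (y j) (y (S j));
  c_Nd : 1 + dot (arrN (S i) j) (arrN i (S j)) <> 0;
  c_NK : arrN (S i) (S j) = step_K (arrN i j) (arrN (S i) j) (arrN i (S j));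
  c_Pd : 1 + dot (arrP (S i) j) (arrP i (S j)) <> 0;
  c_PK : arrP (S i) (S j) = step_K (arrP i j) (arrP (S i) j) (arrP i (S j));
  c_Bd1 : 1 - dot (arrN (S i) j) (arrP i j) <> 0;
  c_B1 : arrP (S i) j = step_B1 (arrN i j) (arrN (S i) j) (arrP i j);
  c_Bd2 : 1 + dot (arrN i (S j)) (arrP i j) <> 0;
  c_B2 : arrP i (S j) = step_B2 (arrN i j) (arrN i (S j)) (arrP i j);
  c_F1 : arrF (S i) j = (arrF i j + cross (arrN (S i) j) (arrN i j))%V;
  c_F2 : arrF i (S j) = (arrF i j + cross (arrN i j) (arrN i (S j)))%V;
  c_G1 : arrG (S i) j = (arrG i j + cross (arrP (S i) j) (arrP i j))%V;
  c_G2 : arrG i (S j) = (arrG i j + cross (arrP i j) (arrP i (S j)))%V }.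

Lemma arr_cells i j : (i < I)%nat -> (j < J)%nat -> arr_cell i j.
Proof.
intros Hi Hj. assert (D := arrN_den i j Hi Hj).
assert (D1 := arrP_den1 i j Hi ltac:(lia)). assert (D2 := arrP_den2 i j ltac:(lia) Hj).
destruct (arrP_gauss i j Hi Hj) as [g1 g2].
constructor; try (apply arrN_unit; lia); try lra; auto using arrN_SS, arrP_2, arrF_1, arrF_2, arrG_2.
- apply arrP_unit; lia.
- apply arrP_dot; lia.
- apply arrN_chord1; lia.
- apply arrN_chord2; lia.
- apply arrP_1; lia.
- apply arrG_1; lia.
Qed.
End Arrays.

(** * The equations as hyperbolic systems *)

Definition vfam : Type := c3 -> fam.
Definition fdot (a b : vfam) : fam := (a cx * b cx + a cy * b cy + a cz * b cz)%fam.
Definition fcross (a b : vfam) : vfam := fun k =>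
  match k with
  | cx => (a cy * b cz - a cz * b cy)%fam
  | cy => (a cz * b cx - a cx * b cz)%fam
  | cz => (a cx * b cy - a cy * b cx)%fam
  end.
Definition vdl (b : axis) (n : vfam) : vfam := fun k => dl b (n k).
Definition vtn (b : axis) (n : vfam) : vfam := fun k => tn b (n k).
Definition vstep (s : fam) (n v : vfam) : vfam := fun k => (n k + s * v k)%fam.

(* Right-hand sides of the difference equations, with the mesh size s as a
   parameter: s = feps in the discrete equations, s = 0 in the smooth ones. *)
Definition den_K (s : fam) (n v1 v2 : vfam) : fam :=
  (fcst 1 + fdot (vstep s n v1) (vstep s n v2))%fam.
Definition rhs_K (s : fam) (n v1 v2 : vfam) : vfam := fun k =>
  (- (fdot v1 v2) * finv (den_K s n v1 v2) * (vstep s n v1 k + vstep s n v2 k))%fam.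
(** With this sign the Baecklund equations of the two directions become a single formula. *)
Definition sg (b : axis) : R := match b with ax1 => -1 | ax2 => 1 end.
Definition den_B (b : axis) (s : fam) (n v p : vfam) : fam :=
  (fcst 1 + fcst (sg b) * fdot (vstep s n v) p)%fam.
(** The division by the mesh size has been carried out: on the sphere 1 - <n, tau n> = s^2 |v|^2 /
    2, which leaves the term with [/ 2]. The expression therefore remains meaningful at s = 0. *)
Definition rhs_B (b : axis) (s : fam) (n v p : vfam) : vfam := fun k =>
  (fcst (sg b) * v k +
   (- (fcst (sg b) * fdot v p + fcst (/ 2) * s * fdot v v) * finv (den_B b s n v p)) *
   (p k + fcst (sg b) * vstep s n v k))%fam.
Definition rhs_F (b : axis) (n v : vfam) : vfam :=
  match b with ax1 => fcross v n | ax2 => fcross n v end.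

Section Systems.
Variable R0 : R.
Notation ev := (ev R0).
Notation bd := (bd R0).
Notation B := (B R0).
Notation feq := (feq R0).
Notation span := (span R0).
Notation sim := (sim R0).
Notation away := (away R0).
Notation none := (fun _ : fam => False).

Ltac simstep := match goal with
  | |- ?P (fadd _ _) (fadd _ _) => apply sim_add
  | |- ?P (fopp _) (fopp _) => apply sim_opp
  | |- ?P (fmul _ _) (fmul _ _) => apply sim_mul
  | |- ?P (fcst _) (fcst _) => apply sim_refl, B_cst
  end.

Lemma sim_fdot N Y a a' b b' : (forall k, sim N Y (a k) (a' k)) -> (forall k, sim N Y (b k) (b' k)) ->
  sim N Y (fdot a b) (fdot a' b').
Proof. intros Ha Hb. unfold fdot. repeat simstep; auto. Qed.
Lemma sim_fcross N Y a a' b b' : (forall k, sim N Y (a k) (a' k)) -> (forall k, sim N Y (b k) (b' k)) ->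
  forall k, sim N Y (fcross a b k) (fcross a' b' k).
Proof. intros Ha Hb k. destruct k; unfold fcross; repeat simstep; auto. Qed.
Lemma sim_vstep N Y s s' n n' v v' : sim N Y s s' -> (forall k, sim N Y (n k) (n' k)) -> (forall k, sim N Y (v k) (v' k)) ->
  forall k, sim N Y (vstep s n v k) (vstep s' n' v' k).
Proof. intros Hs Ha Hb k. unfold vstep. repeat simstep; auto. Qed.
Lemma sim_rhs_K N Y s s' n n' v1 v1' v2 v2' : away (den_K s n v1 v2) -> away (den_K s' n' v1' v2') ->
  sim N Y s s' -> (forall k, sim N Y (n k) (n' k)) ->
  (forall k, sim N Y (v1 k) (v1' k)) -> (forall k, sim N Y (v2 k) (v2' k)) ->
  forall k, sim N Y (rhs_K s n v1 v2 k) (rhs_K s' n' v1' v2' k).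
Proof.
intros Ha Ha' Hs Hn H1 H2 k. unfold rhs_K. simstep; [simstep; [simstep; now apply sim_fdot|]|simstep; now apply sim_vstep].
apply sim_inv; auto. unfold den_K. simstep; [simstep|]. apply sim_fdot; now apply sim_vstep.
Qed.
Lemma sim_rhs_B N Y b s s' n n' v v' p p' : away (den_B b s n v p) -> away (den_B b s' n' v' p') ->
  sim N Y s s' -> (forall k, sim N Y (n k) (n' k)) ->
  (forall k, sim N Y (v k) (v' k)) -> (forall k, sim N Y (p k) (p' k)) ->
  forall k, sim N Y (rhs_B b s n v p k) (rhs_B b s' n' v' p' k).
Proof.
intros Ha Ha' Hs Hn Hv Hp k. unfold rhs_B. repeat simstep; auto; try now apply sim_fdot.
- apply sim_inv; auto. unfold den_B. repeat simstep. apply sim_fdot; [now apply sim_vstep|assumption].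
- now apply sim_vstep.
Qed.
Lemma sim_rhs_F N Y b n n' v v' : (forall k, sim N Y (n k) (n' k)) -> (forall k, sim N Y (v k) (v' k)) ->
  forall k, sim N Y (rhs_F b n v k) (rhs_F b n' v' k).
Proof. intros Hn Hv k. destruct b; now apply sim_fcross. Qed.

(** A bound in B N is the first component of the similarity of an expression with itself, so the
    linearization lemmas also yield the bounds. *)
Ltac via_sim L := intros; eapply proj1; apply L with (Y := none); intros; try apply sim_refl; auto.
Lemma B_fdot N a b : (forall k, B N (a k)) -> (forall k, B N (b k)) -> B N (fdot a b).
Proof. via_sim sim_fdot. Qed.
Lemma B_rhs_K N s n v1 v2 : away (den_K s n v1 v2) -> B N s ->
  (forall k, B N (n k)) -> (forall k, B N (v1 k)) -> (forall k, B N (v2 k)) -> forall k, B N (rhs_K s n v1 v2 k).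
Proof. via_sim sim_rhs_K. Qed.
Lemma B_rhs_B N b s n v p : away (den_B b s n v p) -> B N s ->
  (forall k, B N (n k)) -> (forall k, B N (v k)) -> (forall k, B N (p k)) -> forall k, B N (rhs_B b s n v p k).
Proof. via_sim sim_rhs_B. Qed.
Lemma B_rhs_F N b n v : (forall k, B N (n k)) -> (forall k, B N (v k)) -> forall k, B N (rhs_F b n v k).
Proof. via_sim sim_rhs_F. Qed.

Lemma away_perturb p c r : c <> 0 -> bd r -> feq p (fcst c + feps * r)%fam -> away p.
Proof.
intros Hc Hr H. apply (away_lower R0 p (Rabs c / 2)); [pose proof (Rabs_pos_lt c Hc); lra|].
intros R' HR. destruct (Hr R' HR) as [C HC].
assert (Hn : near R' (fun e i j => e * Rabs C <= Rabs c / 2)).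
{ pose proof (Rabs_pos_lt c Hc). pose proof (Rabs_pos C).
  exists (Rabs c / 2 / (Rabs C + 1)). split; [apply Rdiv_lt_0_compat; lra|].
  intros e He i j _ _. apply Rle_trans with (Rabs c / 2 / (Rabs C + 1) * (Rabs C + 1)).
  - apply Rmult_le_compat; lra.
  - right. field. lra. }
generalize (near_and _ _ _ (near_and _ _ _ HC Hn) (H R' HR)). apply near_mono.
intros e i j He [[h1 h2] ->]. unfold fadd, fmul, fcst, feps.
assert (e * Rabs (r e i j) <= e * Rabs C).
{ apply Rmult_le_compat_l; [lra|]. apply Rle_trans with (1 := h1). apply Rle_abs. }
pose proof (Rabs_triang (c + e * r e i j) (- (e * r e i j))) as h3.
replace (c + e * r e i j + - (e * r e i j)) with c in h3 by ring.
rewrite Rabs_Ropp, Rabs_mult, (Rabs_pos_eq e) in h3 by lra. lra.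
Qed.

Lemma span_none N p : span N none p -> B N p.
Proof. apply span_B_all. intros y []. Qed.
Lemma sim_none N Y p q : sim N none p q -> sim N Y p q.
Proof. intros [H1 [H2 H3]]. repeat split; auto. apply span_B. now apply span_none. Qed.
Lemma span_quot_eq N Y p p' q q' : feq p p' -> feq q q' -> span N Y (quot p q) -> span N Y (quot p' q').
Proof.
intros Hp Hq. apply span_feq. unfold quot. apply feq_mul; [apply feq_refl|].
apply feq_add; [exact Hp|now apply feq_opp].
Qed.
Lemma quot_trans_span N Y p q r : span N Y (quot p q) -> span N Y (quot q r) -> span N Y (quot p r).
Proof.
intros H1 H2. apply (span_feq _ _ _ (quot p q + quot q r)%fam); [|now apply span_add].
apply ev_all. intros. unfold quot, fmul, fadd, fopp. ring.
Qed.
Lemma dl_quot b p q : dl b (quot p q) = quot (dl b p) (dl b q).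
Proof. fam_ext. unfold quot, dl, fmul, fadd, fopp, finv, feps. destruct b; unfold tn, Rdiv; ring. Qed.
Lemma sim_of_quot N p q : B N p -> B N q -> B N (quot p q) -> sim N none p q.
Proof. intros. repeat split; auto. now apply span_B. Qed.

Definition units (n : vfam) : Prop := feq (fdot n n) (fcst 1).

Lemma units_bd n : units n -> forall k, bd (n k).
Proof.
intros H k R' HR. exists 1. generalize (H R' HR). apply near_mono.
unfold fdot, fadd, fmul, fcst. intros e i j _ h. apply Rabs_le. destruct k; nra.
Qed.

(** At mesh size 0 the denominator is 1 + |n|^2 = 2, and bounded quotients change it by O(e). *)
Lemma den_K_away n v1 v2 : units n -> (forall k, bd (v1 k)) -> (forall k, bd (v2 k)) -> away (den_K feps n v1 v2).
Proof.
intros Hu H1 H2. pose proof (units_bd n Hu) as Hn.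
apply (away_perturb _ 2 (fdot n v2 + fdot v1 n + feps * fdot v1 v2)%fam); [lra| |].
- unfold fdot. repeat match goal with
   | |- ?P (fadd _ _) => apply bd_add | |- ?P (fmul _ _) => apply bd_mul
   | |- ?P feps => apply bd_eps end; auto.
- revert Hu. apply ev_mono. unfold den_K, vstep, fdot, fadd, fmul, fcst, feps. intros e i j He h. lra.
Qed.
Lemma den_K_away0 n v1 v2 : units n -> away (den_K (fcst 0) n v1 v2).
Proof.
intros Hu. apply (away_perturb _ 2 (fcst 0)); [lra|apply bd_cst|].
revert Hu. apply ev_mono. unfold den_K, vstep, fdot, fadd, fmul, fcst, feps. intros e i j He h. lra.
Qed.
(** By conservation of <n, n+> the denominator is 1 + t or 1 - t up to O(e). The excluded values of
    t are those for n+ = n and n+ = - n. *)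
Lemma den_B_away b n v p t : t <> 1 -> t <> -1 -> feq (fdot n p) (fcst t) ->
  (forall k, bd (v k)) -> (forall k, bd (p k)) -> away (den_B b feps n v p).
Proof.
intros Ht Ht' Hnp Hv Hp.
apply (away_perturb _ (1 + sg b * t) (fcst (sg b) * fdot v p)%fam); [destruct b; simpl; lra| |].
- unfold fdot. repeat match goal with
   | |- ?P (fadd _ _) => apply bd_add | |- ?P (fmul _ _) => apply bd_mul
   | |- ?P (fcst _) => apply bd_cst end; auto.
- revert Hnp. apply ev_mono. unfold den_B, vstep, fdot, fadd, fmul, fcst, feps. intros e i j He <-. ring.
Qed.

Lemma units_tn b n : units n -> units (vtn b n).
Proof. intros H. generalize (feq_tn R0 b _ _ H). destruct b; exact (fun h => h). Qed.

Definition gauss_eq (n : vfam) : Prop := forall k,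
  feq (dl ax1 (dl ax2 (n k))) (rhs_K feps n (vdl ax1 n) (vdl ax2 n) k).

Lemma gauss_eq_b n b : gauss_eq n -> forall k,
  feq (dl (other b) (dl b (n k))) (rhs_K feps n (vdl ax1 n) (vdl ax2 n) k).
Proof. intros H k. destruct b; simpl; [rewrite dl_comm|]; apply H. Qed.

Definition ks : list c3 := [cx; cy; cz].
Lemma in_ks k : In k ks.
Proof. destruct k; simpl; auto. Qed.

(* If n and the dl b n are in B N, then dl b (dl b n) solves a linear Goursat
   problem in the other direction. *)
Theorem K_regular (n : vfam) (c : axis -> vfam) :
  units n -> (forall b k, bd (dl b (n k))) -> gauss_eq n ->
  (forall N b k, B N (c b k)) ->
  (forall b k, ev (fun e i j => coord (other b) i j = 0%nat -> n k e i j = c b k e i j)) ->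
  forall N k, B N (n k).
Proof.
intros Hu Hv Hg Hc Hn.
assert (Haw : away (den_K feps n (vdl ax1 n) (vdl ax2 n))) by (apply den_K_away; auto; intros; apply Hv).
assert (main : forall N, (forall k, B N (n k)) /\ (forall b k, B N (dl b (n k)))).
{ induction N as [|N [IHn IHv]].
  { split; intros; (split; [|exact I]); auto. now apply units_bd. }
  assert (Hrhs : forall k, B N (rhs_K feps n (vdl ax1 n) (vdl ax2 n) k)).
  { apply B_rhs_K; auto; try (intros; apply IHv). apply B_eps. }
  assert (Hoth : forall b k, B N (dl (other b) (dl b (n k)))).
  { intros b k. apply (B_feq R0 N (rhs_K feps n (vdl ax1 n) (vdl ax2 n) k)); [|apply Hrhs].
    apply feq_sym. now apply gauss_eq_b. }
  split; [intros k; apply B_S; [now apply units_bd|intros b; apply IHv]|].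
  intros b k. apply B_S; [apply Hv|]. intros b'.
  assert (Hbb : b' = b \/ b' = other b) by (destruct b, b'; auto). destruct Hbb as [->| ->]; [|apply Hoth].
  set (l := map (fun k => (other b, dl b (dl b (n k)))) ks).
  apply (goursat R0 N l) with (other b);
    [|exact (in_map (fun k => (other b, dl b (dl b (n k)))) ks k (in_ks k))].
  clear k. intros b1 y Hy. apply in_map_iff in Hy. destruct Hy as [k [Hy _]]. injection Hy as <- <-.
  split.
  - rewrite dl_comm.
    apply (span_feq _ _ _ (dl b (rhs_K feps n (vdl ax1 n) (vdl ax2 n) k))).
    { apply feq_dl, feq_sym. now apply gauss_eq_b. }
    (* Differencing the right-hand side is comparing it with its own shift, so its linear form comes
       from [sim_rhs_K]. *)
    rewrite <- quot_tn.
    assert (E : tn b (rhs_K feps n (vdl ax1 n) (vdl ax2 n) k) =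
      rhs_K feps (vtn b n) (vtn b (vdl ax1 n)) (vtn b (vdl ax2 n)) k) by (destruct b; reflexivity).
    rewrite E.
    assert (Hvv : forall b' k, sim N (members l) (vtn b (vdl b' n) k) (vdl b' n k)).
    { intros b' k'. split; [apply B_tn, IHv|split; [apply IHv|]]. unfold vtn, vdl. rewrite quot_tn.
      (* The second quotient in direction b is the unknown; the mixed one is given by the Gauss
         equation and bounded by induction. *)
      assert (Hbb : b' = b \/ b = other b') by (destruct b, b'; auto). destruct Hbb as [->|Hb].
      - apply span_gen. exists (other b). apply in_map_iff. exists k'. split; [reflexivity|apply in_ks].
      - apply span_B. rewrite Hb. apply Hoth. }
    apply sim_rhs_K; auto; try apply sim_refl, B_eps.
    + apply den_K_away; [now apply units_tn| |]; intros k'; apply bd_tn, Hv.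
    + intros k'. split; [apply B_tn, IHn|split; [apply IHn|]]. unfold vtn. rewrite quot_tn. apply span_B, IHv.
  - left. exists (dl b (dl b (c b k))). split; [apply B_dl, B_dl, Hc|].
    assert (Hsh : forall p q : fam, ev (fun e i j => coord (other b) i j = 0%nat -> p e i j = q e i j) ->
       ev (fun e i j => coord (other b) i j = 0%nat -> dl b p e i j = dl b q e i j)).
    { intros p q H. generalize (ev_and _ _ _ H (ev_sh _ b _ H)). apply ev_mono.
      intros e i j _ [h1 h2] h. unfold dl. rewrite h1 by exact h. destruct b; simpl in *; now rewrite h2. }
    apply Hsh, Hsh, Hn. }
intros N k. apply main.
Qed.

Definition B_eq (b : axis) (n p : vfam) : Prop := forall k,
  feq (dl b (p k)) (rhs_B b feps n (vdl b n) p k).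

(** No Goursat problem is needed: both first quotients of n+ are functions of n, v_i and n+, so
    order N of n+ gives order N + 1 at once. *)
Theorem B_regular (n p : vfam) t : t <> 1 -> t <> -1 ->
  (forall N k, B N (n k)) -> units p -> feq (fdot n p) (fcst t) -> (forall b, B_eq b n p) ->
  forall N k, B N (p k).
Proof.
intros Ht Ht' Hn Hp Hnp He.
assert (Hb := units_bd p Hp).
induction N as [|N IH]; intros k; (split; [apply Hb|]); [exact I|].
intros b. apply (B_feq R0 N (rhs_B b feps n (vdl b n) p k)); [apply feq_sym, He|].
apply B_rhs_B; auto.
- apply (den_B_away b n (vdl b n) p t); auto. intros k'. apply (B_bd _ 0), B_dl, Hn.
- apply B_eps.
- intros k'. apply B_dl, Hn.
Qed.

Lemma both_axes N (l : list (axis * fam)) y : (forall b, In (b, y) l) -> forall p, bd p ->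
  ev (fun e i j => i = 0%nat -> j = 0%nat -> y e i j = p e i j) -> forall b, initial R0 N l b y.
Proof. intros Hy p Hp H b. right. split; [apply Hy|]. now exists p. Qed.

Lemma integrate N (y p : fam) : (forall b, B N (dl b y)) -> bd p ->
  ev (fun e i j => i = 0%nat -> j = 0%nat -> y e i j = p e i j) -> B N y.
Proof.
intros Hd Hp H0. apply (goursat R0 N [(ax1, y); (ax2, y)]) with ax1; [|now left].
intros b y' Hy. assert (E : y' = y) by (destruct Hy as [h|[h|[]]]; congruence). subst y'.
split; [apply span_B, Hd|]. apply (both_axes N _ y) with p; auto. intros []; simpl; auto.
Qed.

Theorem F_regular (n f : vfam) (f0 : vec3) : (forall N k, B N (n k)) ->
  (forall b k, feq (dl b (f k)) (rhs_F b n (vdl b n) k)) ->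
  (forall k e, f k e 0%nat 0%nat = co k f0) -> forall N k, B N (f k).
Proof.
intros Hn Hf H0 N k. apply (integrate N (f k) (fcst (co k f0))).
- intros b. apply (B_feq R0 N (rhs_F b n (vdl b n) k)); [apply feq_sym, Hf|].
  apply B_rhs_F; auto. intros. apply B_dl, Hn.
- apply bd_cst.
- apply ev_all. intros e i j _ -> ->. apply H0.
Qed.

(** The unknowns are the errors of n and of its two quotients, divided by e. The family n' is only
    required to solve the smooth system up to O(e) in C^N, with v' in the place of its first
    derivatives. The error of n follows that of v_2, and the error of v_b runs across direction b by
    the Gauss equation. *)
Theorem K_compare N (n n' : vfam) (v' : axis -> vfam) :
  (forall M k, B M (n k)) -> units n -> gauss_eq n ->
  units n' -> (forall b k, sim N none (dl b (n' k)) (v' b k)) -> (forall k, B N (n' k)) ->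
  (forall b k, sim N none (dl (other b) (v' b k)) (rhs_K (fcst 0) n' (v' ax1) (v' ax2) k)) ->
  (forall b k, ev (fun e i j => coord (other b) i j = 0%nat -> n k e i j = n' k e i j)) ->
  (forall k, sim N none (n k) (n' k)) /\ (forall b k, sim N none (dl b (n k)) (v' b k)).
Proof.
intros Hn Hu Hg Hu' Hd' Hn' Hg' H0.
pose (l := map (fun k => (ax2, quot (n k) (n' k))) ks ++
           map (fun k => (ax2, quot (dl ax1 (n k)) (v' ax1 k))) ks ++
           map (fun k => (ax1, quot (dl ax2 (n k)) (v' ax2 k))) ks).
assert (I1 : forall k, In (ax2, quot (n k) (n' k)) l).
{ intros k. apply in_or_app. left. exact (in_map (fun k => (ax2, quot (n k) (n' k))) ks k (in_ks k)). }
assert (I2 : forall b k, In (other b, quot (dl b (n k)) (v' b k)) l).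
{ intros b k. apply in_or_app. right. apply in_or_app. destruct b; [left|right].
  - exact (in_map (fun k => (ax2, quot (dl ax1 (n k)) (v' ax1 k))) ks k (in_ks k)).
  - exact (in_map (fun k => (ax1, quot (dl ax2 (n k)) (v' ax2 k))) ks k (in_ks k)). }
assert (S1 : forall k, sim N (members l) (n k) (n' k)).
{ intros k. split; [apply Hn|split; [apply Hn'|]]. apply span_gen. exists ax2. apply I1. }
assert (S2 : forall b k, sim N (members l) (dl b (n k)) (v' b k)).
{ intros b k. split; [apply B_dl, Hn|split; [apply Hd'|]]. apply span_gen. exists (other b). apply I2. }
assert (main : forall b y, In (b, y) l -> B N y).
{ apply goursat. intros b y Hy. apply in_app_or in Hy. destruct Hy as [Hy|Hy].
  - apply in_map_iff in Hy. destruct Hy as [k [Hy _]]. injection Hy as <- <-. split.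
    + rewrite dl_quot. apply quot_trans_span with (v' ax2 k); [apply S2|].
      apply sim_none, sim_sym, Hd'.
    + left. exists (fcst 0). split; [apply B_cst|]. generalize (H0 ax1 k). apply ev_mono.
      intros e i j _ h hc. unfold quot, fmul, fadd, fopp. rewrite (h hc). unfold fcst. ring.
  - assert (Hy' : exists b' k, b = other b' /\ y = quot (dl b' (n k)) (v' b' k)).
    { apply in_app_or in Hy. destruct Hy as [Hy|Hy]; apply in_map_iff in Hy; destruct Hy as [k [Hy _]];
      injection Hy as <- <-; [exists ax1|exists ax2]; exists k; auto. }
    destruct Hy' as [b' [k [-> ->]]]. clear Hy. split.
    + rewrite dl_quot.
      apply (quot_trans_span _ _ _ (rhs_K (fcst 0) n' (v' ax1) (v' ax2) k)); [|apply sim_none, sim_sym, Hg'].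
      apply (span_quot_eq _ _ (rhs_K feps n (vdl ax1 n) (vdl ax2 n) k) _ (rhs_K (fcst 0) n' (v' ax1) (v' ax2) k) _).
      * apply feq_sym. now apply gauss_eq_b.
      * apply feq_refl.
      * apply sim_rhs_K; auto; try (intros; apply S2); [| |apply sim_eps].
        -- apply den_K_away; auto; intros k'; apply (B_bd _ 0), B_dl, Hn.
        -- now apply den_K_away0.
    (* On the axis n and n' coincide, so there the error of the quotient of n is the consistency
       error of n', bounded by hypothesis. *)
    + left. exists (quot (dl b' (n' k)) (v' b' k)). split; [apply span_none, Hd'|].
      generalize (ev_and _ _ _ (H0 b' k) (ev_sh _ b' _ (H0 b' k))). apply ev_mono.
      intros e i j _ [h h'] hc. unfold quot, fmul, fadd, fopp, dl. rewrite h by (destruct b'; exact hc).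
      assert (E : tn b' (n k) e i j = tn b' (n' k) e i j) by (destruct b'; simpl in *; now apply h').
      now rewrite E. }
split.
- intros k. apply sim_of_quot; auto. apply (main ax2), I1.
- intros b k. apply sim_of_quot; [apply B_dl, Hn|apply Hd'|]. apply (main (other b)), I2.
Qed.

(** The error of n+ is propagated in both directions, so equality at the origin is all the data it
    needs; the errors of n and v enter as inhomogeneous terms. *)
Theorem B_compare N (n n' p p' : vfam) (v' : axis -> vfam) t : t <> 1 -> t <> -1 ->
  (forall M k, B M (n k)) -> (forall M k, B M (p k)) -> feq (fdot n p) (fcst t) ->
  (forall b, B_eq b n p) ->
  (forall k, sim N none (n k) (n' k)) -> (forall b k, sim N none (dl b (n k)) (v' b k)) ->
  (forall k, B N (p' k)) -> (forall b, away (den_B b (fcst 0) n' (v' b) p')) ->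
  (forall b k, sim N none (dl b (p' k)) (rhs_B b (fcst 0) n' (v' b) p' k)) ->
  (forall k, ev (fun e i j => i = 0%nat -> j = 0%nat -> p k e i j = p' k e i j)) ->
  forall k, sim N none (p k) (p' k).
Proof.
intros Ht Ht' Hn Hp Hnp He Sn Sv Hp' Ha' He' H0.
pose (l := flat_map (fun k => [(ax1, quot (p k) (p' k)); (ax2, quot (p k) (p' k))]) ks).
assert (I1 : forall k b, In (b, quot (p k) (p' k)) l).
{ intros k b. apply in_flat_map. exists k. split; [apply in_ks|]. destruct b; simpl; auto. }
assert (S1 : forall k, sim N (members l) (p k) (p' k)).
{ intros k. split; [apply Hp|split; [apply Hp'|]]. apply span_gen. exists ax1. apply I1. }
assert (main : forall b y, In (b, y) l -> B N y).
{ apply goursat. intros b y Hy. apply in_flat_map in Hy. destruct Hy as [k [_ Hy]].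
  assert (E : y = quot (p k) (p' k)) by (destruct Hy as [h|[h|[]]]; congruence). subst y. split.
  - rewrite dl_quot.
    apply (quot_trans_span _ _ _ (rhs_B b (fcst 0) n' (v' b) p' k)); [|apply sim_none, sim_sym, He'].
    apply (span_quot_eq _ _ (rhs_B b feps n (vdl b n) p k) _ (rhs_B b (fcst 0) n' (v' b) p' k) _).
    + apply feq_sym, He.
    + apply feq_refl.
    + apply sim_rhs_B; auto.
      * apply (den_B_away b n (vdl b n) p t); auto; intros k'; [apply (B_bd _ 0), B_dl, Hn|apply (B_bd _ 0), Hp].
      * apply sim_eps.
      * intros. apply sim_none, Sn.
      * intros. apply sim_none, Sv.
  - apply (both_axes N l _ (I1 k) (fcst 0) (bd_cst _ _)). generalize (H0 k). apply ev_mono.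
    intros e i j _ h hi hj. unfold quot, fmul, fadd, fopp. rewrite (h hi hj). unfold fcst. ring. }
intros k. apply sim_of_quot; auto. apply (main ax1), I1.
Qed.

Theorem F_compare N (n n' f f' : vfam) (v' : axis -> vfam) :
  (forall M k, B M (f k)) -> (forall b k, feq (dl b (f k)) (rhs_F b n (vdl b n) k)) ->
  (forall k, sim N none (n k) (n' k)) -> (forall b k, sim N none (dl b (n k)) (v' b k)) ->
  (forall k, B N (f' k)) -> (forall b k, sim N none (dl b (f' k)) (rhs_F b n' (v' b) k)) ->
  (forall k, ev (fun e i j => i = 0%nat -> j = 0%nat -> f k e i j = f' k e i j)) ->
  forall k, sim N none (f k) (f' k).
Proof.
intros Hf He Sn Sv Hf' He' H0 k. apply sim_of_quot; auto.
apply (integrate N _ (fcst 0)); [|apply bd_cst|].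
- intros b. rewrite dl_quot. apply span_none.
  apply (quot_trans_span _ _ _ (rhs_F b n' (v' b) k)); [|exact (proj2 (proj2 (sim_sym _ _ _ _ _ (He' b k))))].
  apply (span_quot_eq _ _ (rhs_F b n (vdl b n) k) _ (rhs_F b n' (v' b) k) _);
   [apply feq_sym, He|apply feq_refl|]. apply sim_rhs_F; [exact Sn|exact (Sv b)].
- generalize (H0 k). apply ev_mono. intros e i j _ h hi hj.
  unfold quot, fmul, fadd, fopp. rewrite (h hi hj). unfold fcst. ring.
Qed.
End Systems.

(** * Smooth surfaces as limits of discrete ones *)

Definition flimv (n : vfam) (u : vec2) : vec3 := (flim (n cx) u, flim (n cy) u, flim (n cz) u).
Lemma co_flimv k n u : co k (flimv n u) = flim (n k) u.
Proof. destruct k; reflexivity. Qed.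

Section SmoothLimits.
Variable R0 : R.
Notation bd := (bd R0).
Notation B := (B R0).
Notation feq := (feq R0).

Ltac bdt := repeat match goal with
  | |- ?P (fadd _ _) => apply bd_add
  | |- ?P (fopp _) => apply bd_opp
  | |- ?P (fmul _ _) => apply bd_mul
  | |- ?P (fcst _) => apply bd_cst
  | |- ?P feps => apply bd_eps
  end; auto.

Lemma flim_fdot a b u : inq R0 u -> (forall k, bd (a k)) -> (forall k, bd (b k)) ->
  flim (fdot a b) u = dot (flimv a u) (flimv b u).
Proof.
intros Hu Ha Hb. unfold fdot. rewrite dot_co, !co_flimv.
rewrite !(flim_add R0), !(flim_mul R0) by (bdt; auto). reflexivity.
Qed.
Lemma flim_fcross a b u k : inq R0 u -> (forall k, bd (a k)) -> (forall k, bd (b k)) ->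
  flim (fcross a b k) u = co k (cross (flimv a u) (flimv b u)).
Proof.
intros Hu Ha Hb. rewrite co_cross, !co_flimv.
destruct k; unfold fcross; rewrite (flim_add R0), (flim_opp R0), !(flim_mul R0) by (bdt; auto); ring.
Qed.
Lemma flimv_fcross a b u : inq R0 u -> (forall k, bd (a k)) -> (forall k, bd (b k)) ->
  flimv (fcross a b) u = cross (flimv a u) (flimv b u).
Proof. intros Hu Ha Hb. apply vec_ext. intros k. rewrite co_flimv. now apply flim_fcross. Qed.
Lemma flimv_dl_fcross b p q u : inq R0 u -> (forall k, B 1 (p k)) -> (forall k, B 1 (q k)) ->
  flimv (vdl b (fcross p q)) u =
  (cross (flimv (vdl b p) u) (flimv q u) + cross (flimv p u) (flimv (vdl b q) u))%V.
Proof.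
intros Hu Hp Hq. apply vec_ext. intros k. rewrite co_add, !co_cross, !co_flimv. unfold vdl.
assert (Hp' : forall k, bd (dl b (p k))) by (intros; apply (B_bd _ 0), B_dl, Hp).
assert (Hq' : forall k, bd (dl b (q k))) by (intros; apply (B_bd _ 0), B_dl, Hq).
assert (Hp0 : forall k, bd (p k)) by (intros; apply (B_bd _ 1), Hp).
assert (Hq0 : forall k, bd (q k)) by (intros; apply (B_bd _ 1), Hq).
assert (Hpq : forall k k', bd (dl b (p k * q k')%fam)).
{ intros k1 k2. apply (B_bd _ 0), B_dl, B_mul; auto. }
destruct k; unfold fcross; rewrite dl_add, dl_opp, (flim_add R0), (flim_opp R0), !(flim_dl_mul R0) by (bdt; auto); ring.
Qed.
Lemma flimv_feq p q u : inq R0 u -> (forall k, bd (p k)) -> (forall k, feq (p k) (q k)) -> flimv p u = flimv q u.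
Proof. intros Hu Hp H. apply vec_ext. intros k. rewrite !co_flimv. now apply (flim_feq R0). Qed.

Lemma flim_vstep n v u k : inq R0 u -> (forall k, bd (n k)) -> (forall k, bd (v k)) ->
  flim (vstep feps n v k) u = flim (n k) u.
Proof. intros Hu Hn Hv. unfold vstep. rewrite (flim_add R0), (flim_mul R0), (flim_eps R0) by (bdt; auto). ring. Qed.
Lemma flimv_vstep n v u : inq R0 u -> (forall k, bd (n k)) -> (forall k, bd (v k)) ->
  flimv (vstep feps n v) u = flimv n u.
Proof. intros. apply vec_ext. intros k. rewrite !co_flimv. now apply flim_vstep. Qed.
Lemma bd_vstep n v k : (forall k, bd (n k)) -> (forall k, bd (v k)) -> bd (vstep feps n v k).
Proof. intros. unfold vstep. bdt. Qed.
Lemma bd_fdot a b : (forall k, bd (a k)) -> (forall k, bd (b k)) -> bd (fdot a b).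
Proof. intros. unfold fdot. bdt. Qed.

Lemma flimv_unit n u : inq R0 u -> units R0 n -> dot (flimv n u) (flimv n u) = 1.
Proof.
intros Hu Hn. assert (Hb := units_bd R0 n Hn). rewrite <- flim_fdot by auto.
rewrite (flim_feq R0 _ (fcst 1)) by (auto using bd_fdot). now apply (flim_cst R0).
Qed.

Lemma flimv_rhs_K n v1 v2 u : inq R0 u -> units R0 n -> (forall k, bd (v1 k)) -> (forall k, bd (v2 k)) ->
  flimv (rhs_K feps n v1 v2) u = ((- dot (flimv v1 u) (flimv v2 u))%R *: flimv n u)%V.
Proof.
intros Hu Hn H1 H2. assert (Hb := units_bd R0 n Hn).
assert (Haw := den_K_away R0 n v1 v2 Hn H1 H2).
assert (Hs1 := fun k => bd_vstep n v1 k Hb H1). assert (Hs2 := fun k => bd_vstep n v2 k Hb H2).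
assert (Hd : bd (den_K feps n v1 v2)) by (unfold den_K; bdt; now apply bd_fdot).
destruct (flim_inv R0 _ u Hu Hd Haw) as [Hi _].
assert (Hden : flim (den_K feps n v1 v2) u = 2).
{ unfold den_K. rewrite (flim_add R0), (flim_cst R0), flim_fdot, !flimv_vstep, flimv_unit by (bdt; auto using bd_fdot). ring. }
apply vec_ext. intros k. rewrite co_scal, !co_flimv. unfold rhs_K.
assert (Hinv : bd (finv (den_K feps n v1 v2))) by apply Haw.
assert (Hf := bd_fdot v1 v2 H1 H2).
rewrite !(flim_mul R0), (flim_opp R0), (flim_add R0), !flim_vstep, flim_fdot, Hi, Hden by (bdt; auto).
field.
Qed.

Lemma flimv_rhs_B b n v p u t : inq R0 u -> units R0 n -> t <> 1 -> t <> -1 -> feq (fdot n p) (fcst t) ->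
  (forall k, bd (v k)) -> (forall k, bd (p k)) ->
  1 + sg b * dot (flimv n u) (flimv p u) <> 0 /\
  flimv (rhs_B b feps n v p) u =
  (sg b *: flimv v u + (- (sg b * dot (flimv v u) (flimv p u)) / (1 + sg b * dot (flimv n u) (flimv p u)))%R *:
     (flimv p u + sg b *: flimv n u))%V.
Proof.
intros Hu Hn Ht Ht' Hnp Hv Hp. assert (Hb := units_bd R0 n Hn).
assert (Haw := den_B_away R0 b n v p t Ht Ht' Hnp Hv Hp).
assert (Hs := fun k => bd_vstep n v k Hb Hv).
assert (Hd : bd (den_B b feps n v p)) by (unfold den_B; bdt; now apply bd_fdot).
destruct (flim_inv R0 _ u Hu Hd Haw) as [Hi Hne].
assert (Hden : flim (den_B b feps n v p) u = 1 + sg b * dot (flimv n u) (flimv p u)).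
{ unfold den_B. rewrite (flim_add R0), (flim_mul R0), !(flim_cst R0), flim_fdot, !flimv_vstep by (bdt; auto using bd_fdot). ring. }
rewrite Hden in Hi, Hne. split; [exact Hne|].
apply vec_ext. intros k. autorewrite with vec. rewrite !co_flimv. unfold rhs_B.
assert (Hinv : bd (finv (den_B b feps n v p))) by apply Haw.
assert (Hf := bd_fdot v p Hv Hp). assert (Hf' := bd_fdot v v Hv Hv).
rewrite !(flim_add R0), !(flim_mul R0), !(flim_opp R0), !(flim_add R0), !(flim_mul R0), !(flim_cst R0), (flim_eps R0), !flim_vstep, !flim_fdot, Hi by (bdt; auto).
unfold Rdiv. ring.
Qed.

Lemma vpartial_flimv r b g n u : (forall N k, B N (n k)) -> 0 < r < R0 -> square r u ->
  (forall v, square r v -> g v = flimv n v) -> vpartial (square r) b g u = flimv (vdl b n) u.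
Proof.
intros Hn Hr Hu Hg.
assert (H : forall k, partial (square r) b (fun v => co k (g v)) u = flim (dl b (n k)) u).
{ intros k. apply partial_pd; [lra|exact Hu|].
  apply (pd_ext r b (flim (n k))); [exact Hu| |].
  - intros v Hv. rewrite Hg by exact Hv. now rewrite co_flimv.
  - apply (flim_pd R0); [apply Hn|lra|exact Hu]. }
apply vec_ext. intros k. rewrite co_flimv. unfold vdl. rewrite <- H. destruct k; reflexivity.
Qed.
Lemma vsmooth_flimv r n : (forall N k, B N (n k)) -> 0 < r < R0 -> vsmooth_on (square r) (flimv n).
Proof.
intros Hn Hr. split; [|split]; unfold flimv, vx, vy, vz; cbn [fst snd];
 (apply (flim_smooth_on R0); [intros N; apply Hn|exact Hr]).
Qed.

Lemma flimv_orth b n u : inq R0 u -> units R0 n -> (forall N k, B N (n k)) ->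
  dot (flimv n u) (flimv (vdl b n) u) = 0.
Proof.
intros Hu Hn HB.
assert (Hb := units_bd R0 n Hn).
assert (H : flim (dl b (fdot n n)) u = 0).
{ rewrite (flim_feq R0 _ (dl b (fcst 1))).
  - rewrite dl_cst. now apply (flim_cst R0).
  - exact Hu.
  - apply (B_bd _ 0), B_dl, B_fdot; auto.
  - now apply feq_dl. }
assert (Hpq : forall k k', bd (dl b (n k * n k')%fam)) by (intros; apply (B_bd _ 0), B_dl, B_mul; auto).
unfold fdot in H. rewrite !dl_add, !(flim_add R0), !(flim_dl_mul R0) in H by (bdt; auto).
rewrite dot_co, !co_flimv. unfold vdl. lra.
Qed.

Record discrete_K (n f : vfam) : Prop := {
  dKn : forall N k, B N (n k);
  dKf : forall N k, B N (f k);
  dKu : units R0 n;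
  dKg : gauss_eq R0 n;
  dKe : forall b k, feq (dl b (f k)) (rhs_F b n (vdl b n) k) }.

(** On the plane orthogonal to N the cross product with N is a quarter-turn, so f_1 and f_2 have the
    same Gram determinant as V1 and V2. The Gram determinant of (V1, V2, N) identifies it with a
    squared triple product. *)
Lemma triple_metric (N V1 V2 : vec3) : dot N N = 1 -> dot N V1 = 0 -> dot N V2 = 0 ->
  dot (cross V1 N) (cross V1 N) * dot (cross N V2) (cross N V2)
   - dot (cross V1 N) (cross N V2) * dot (cross V1 N) (cross N V2)
  = dot (cross V1 V2) N * dot (cross V1 V2) N.
Proof.
intros H H1 H2.
assert (E1 : dot (cross V1 N) (cross V1 N) = dot V1 V1 * dot N N - dot N V1 * dot N V1)
  by (rewrite !dot_co, !co_cross; ring).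
assert (E2 : dot (cross N V2) (cross N V2) = dot V2 V2 * dot N N - dot N V2 * dot N V2)
  by (rewrite !dot_co, !co_cross; ring).
assert (E3 : dot (cross V1 N) (cross N V2) = dot N V1 * dot N V2 - dot V1 V2 * dot N N)
  by (rewrite !dot_co, !co_cross; ring).
assert (E4 : dot (cross V1 V2) N * dot (cross V1 V2) N =
  dot V1 V1 * (dot V2 V2 * dot N N - dot N V2 * dot N V2)
  - dot V1 V2 * (dot V1 V2 * dot N N - dot N V2 * dot N V1)
  + dot N V1 * (dot V1 V2 * dot N V2 - dot V2 V2 * dot N V1))
  by (rewrite !dot_co, !co_cross; ring).
rewrite E1, E2, E3, E4, H, H1, H2. ring.
Qed.

Section LimitIdentities.
Variables n f : vfam.
Hypothesis D : discrete_K n f.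

Lemma dK_bd k : bd (n k) /\ bd (f k) /\ forall b, bd (dl b (n k)) /\ bd (dl b (f k)).
Proof.
destruct D as [Hn Hf _ _ _].
repeat split; apply (B_bd _ 0); try apply B_dl; first [apply Hn | apply Hf].
Qed.
Lemma dK_gauss_limit b u : inq R0 u -> flimv (vdl (other b) (vdl b n)) u
  = ((- dot (flimv (vdl ax1 n) u) (flimv (vdl ax2 n) u))%R *: flimv n u)%V.
Proof.
intros Hi. rewrite <- flimv_rhs_K by (try apply D; auto; intros k; apply dK_bd).
apply flimv_feq; [exact Hi| |intros k; apply gauss_eq_b, D].
intros k. apply (B_bd _ 0), B_dl, B_dl, D.
Qed.
Lemma dK_f_limit b u : inq R0 u -> flimv (vdl b f) u =
  match b with ax1 => cross (flimv (vdl ax1 n) u) (flimv n u) | ax2 => cross (flimv n u) (flimv (vdl ax2 n) u) end.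
Proof.
intros Hi. transitivity (flimv (rhs_F b n (vdl b n)) u).
- apply flimv_feq; [exact Hi|intros k; apply dK_bd|intros k; apply D].
- destruct b; apply flimv_fcross; auto; intros k; apply dK_bd.
Qed.
Lemma dK_ff_limit a b u : inq R0 u -> flimv (vdl a (vdl b f)) u =
  match b with
  | ax1 => cross (flimv (vdl a (vdl ax1 n)) u) (flimv n u) + cross (flimv (vdl ax1 n) u) (flimv (vdl a n) u)
  | ax2 => cross (flimv (vdl a n) u) (flimv (vdl ax2 n) u) + cross (flimv n u) (flimv (vdl a (vdl ax2 n)) u)
  end%V.
Proof.
intros Hi. transitivity (flimv (vdl a (rhs_F b n (vdl b n))) u).
- apply flimv_feq; [exact Hi| |intros k; apply feq_dl, D].
  intros k. apply (B_bd _ 0), B_dl, B_dl, D.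
- destruct b; apply flimv_dl_fcross; auto; intros k; try apply B_dl; apply D.
Qed.

Theorem K_limit r : 0 < r < R0 -> K_surface (square r) (flimv n) (flimv f).
Proof.
intros Hr. assert (Hn := dKn _ _ D). assert (Hf := dKf _ _ D). assert (Hu := dKu _ _ D).
assert (Hin : forall u, square r u -> inq R0 u) by (intros; apply (square_inq R0 r); lra || auto).
assert (P1 : forall b u, square r u -> vpartial (square r) b (flimv n) u = flimv (vdl b n) u)
  by (intros b u Hs; apply vpartial_flimv; auto).
assert (Q1 : forall b u, square r u -> vpartial (square r) b (flimv f) u = flimv (vdl b f) u)
  by (intros b u Hs; apply vpartial_flimv; auto).
assert (Q2 : forall a b u, square r u -> vpartial (square r) a (vpartial (square r) b (flimv f)) u = flimv (vdl a (vdl b f)) u)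
  by (intros a b u Hs; apply vpartial_flimv; auto; intros; apply B_dl, Hf).
assert (S0 : forall b u, square r u -> second_form (square r) (flimv n) (flimv f) b b u = 0).
{ intros b u Hs. unfold second_form. rewrite Q2, dK_ff_limit by auto. destruct b;
  rewrite !dot_co; autorewrite with vec; rewrite !co_cross; ring. }
constructor.
- now apply vsmooth_flimv.
- now apply vsmooth_flimv.
- intros u Hs. apply sphere_dot. apply flimv_unit; auto.
- intros u b Hs. rewrite Q1, dK_f_limit by auto. destruct b; rewrite dot_co, !co_cross; ring.
- intros u b Hs. now apply S0.
- intros u Hs Hm. unfold gauss_curvature. rewrite S0 by exact Hs.
  (* The mixed coefficient of the second form is the triple product T of n_1, n_2, n, and the metric
     determinant is T^2; hence K = - T^2 / T^2 = -1. *)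
  assert (S12 : second_form (square r) (flimv n) (flimv f) ax1 ax2 u
    = dot (cross (flimv (vdl ax1 n) u) (flimv (vdl ax2 n) u)) (flimv n u)).
  { unfold second_form. rewrite Q2, dK_ff_limit by auto. assert (W := dK_gauss_limit ax2 u (Hin u Hs)). simpl in W. rewrite W.
    rewrite !dot_co. autorewrite with vec. rewrite !co_cross. autorewrite with vec. ring. }
  assert (M : metric_det (square r) (flimv f) u =
    dot (cross (flimv (vdl ax1 n) u) (flimv (vdl ax2 n) u)) (flimv n u) *
    dot (cross (flimv (vdl ax1 n) u) (flimv (vdl ax2 n) u)) (flimv n u)).
  { unfold metric_det. rewrite !Q1, !dK_f_limit by auto.
    apply triple_metric; [apply flimv_unit|apply flimv_orth|apply flimv_orth]; auto. }
  rewrite S12, M in *. field. intros h. rewrite h in Hm. apply Hm. ring.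
- intros u Hs. rewrite (vpartial_flimv r ax1 _ (vdl ax2 n)) by (auto; intros; apply B_dl, Hn).
  rewrite !P1 by exact Hs. apply (dK_gauss_limit ax2 u), Hin, Hs.
- intros u Hs. rewrite Q1, P1, dK_f_limit by auto. reflexivity.
- intros u Hs. rewrite Q1, P1, dK_f_limit by auto. reflexivity.
Qed.
End LimitIdentities.

Record discrete_B (t : R) (n f p g : vfam) : Prop := {
  dBt1 : t <> 1;
  dBt2 : t <> -1;
  dBK : discrete_K n f;
  dBK' : discrete_K p g;
  dBdot : feq (fdot n p) (fcst t);
  dBe : forall b, B_eq R0 b n p;
  dBf : forall k, g k = (f k + fcross p n k)%fam }.

Section BacklundLimit.
Variables (t : R) (n f p g : vfam).
Hypothesis D : discrete_B t n f p g.

Lemma dB_dot_limit u : inq R0 u -> dot (flimv n u) (flimv p u) = t.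
Proof.
intros Hi. assert (bn := fun k => proj1 (dK_bd n f (dBK _ _ _ _ _ D) k)).
assert (bp := fun k => proj1 (dK_bd p g (dBK' _ _ _ _ _ D) k)).
rewrite <- flim_fdot by auto. rewrite (flim_feq R0 _ (fcst t)); [now apply (flim_cst R0)|exact Hi| |apply D].
now apply bd_fdot.
Qed.
Lemma dB_p_limit b u : inq R0 u ->
  1 + sg b * dot (flimv n u) (flimv p u) <> 0 /\
  flimv (vdl b p) u =
  (sg b *: flimv (vdl b n) u + (- (sg b * dot (flimv (vdl b n) u) (flimv p u)) / (1 + sg b * dot (flimv n u) (flimv p u)))%R *:
     (flimv p u + sg b *: flimv n u))%V.
Proof.
intros Hi. destruct D as [Ht Ht' DK DK' Hdot He _].
destruct (flimv_rhs_B b n (vdl b n) p u t) as [h1 h2]; auto.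
- apply DK.
- intros k. apply (dK_bd n f DK).
- intros k. apply (dK_bd p g DK').
- split; [exact h1|]. rewrite <- h2. apply flimv_feq; [exact Hi|intros k; apply (dK_bd p g DK')|intros k; apply He].
Qed.

Theorem B_limit r : 0 < r < R0 -> backlund (square r) (flimv n) (flimv f) (flimv p) (flimv g).
Proof.
intros Hr. assert (DK := dBK _ _ _ _ _ D). assert (DK' := dBK' _ _ _ _ _ D).
assert (Hin : forall u, square r u -> inq R0 u) by (intros; apply (square_inq R0 r); lra || auto).
assert (bn := fun k => proj1 (dK_bd n f DK k)). assert (bp := fun k => proj1 (dK_bd p g DK' k)).
assert (bf := fun k => proj1 (proj2 (dK_bd n f DK k))).
assert (Hfc : forall u, square r u -> flimv g u = (flimv f u + cross (flimv p u) (flimv n u))%V).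
{ intros u Hs. rewrite <- flimv_fcross by auto. apply vec_ext. intros k. rewrite co_add, !co_flimv, (dBf _ _ _ _ _ D).
  apply (flim_add R0); auto. destruct k; simpl; bdt. }
assert (Hsub : forall u, square r u -> (flimv g u - flimv f u)%V = cross (flimv p u) (flimv n u)).
{ intros u Hs. rewrite Hfc by exact Hs. vec. }
assert (P1 : forall b u, square r u -> vpartial (square r) b (flimv n) u = flimv (vdl b n) u)
  by (intros b u Hs; apply vpartial_flimv; auto; apply DK).
assert (P2 : forall b u, square r u -> vpartial (square r) b (flimv p) u = flimv (vdl b p) u)
  by (intros b u Hs; apply vpartial_flimv; auto; apply DK').
constructor.
- now apply K_limit.
- intros u Hs. rewrite Hsub by exact Hs. rewrite !dot_co, !co_cross. split; ring.
(* |n+ x n|^2 = 1 - <n, n+>^2, which is constant. *)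
- exists (sqrt (1 - t * t)). intros u Hs. rewrite Hsub, norm_dot by exact Hs. f_equal.
  rewrite <- (dB_dot_limit u (Hin u Hs)).
  transitivity (dot (flimv n u) (flimv n u) * dot (flimv p u) (flimv p u) - dot (flimv n u) (flimv p u) * dot (flimv n u) (flimv p u)).
  + rewrite !dot_co, !co_cross. ring.
  + rewrite !flimv_unit by (auto; first [apply DK | apply DK']). ring.
- exact Hfc.
- intros u Hs. simpl. destruct (dB_p_limit ax1 u (Hin u Hs)) as [h1 h2]. simpl sg in *.
  rewrite P1, P2, h2 by exact Hs. split; [lra|]. apply vec_ext. intros k. autorewrite with vec.
  replace (1 + -1 * dot (flimv n u) (flimv p u)) with (1 - dot (flimv n u) (flimv p u)) by ring. field. lra.
- intros u Hs. simpl. destruct (dB_p_limit ax2 u (Hin u Hs)) as [h1 h2]. simpl sg in *.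
  rewrite P1, P2, h2 by exact Hs. split; [lra|]. apply vec_ext. intros k. autorewrite with vec.
  rewrite !Rmult_1_l. field. lra.
Qed.
End BacklundLimit.
End SmoothLimits.

(** * Comparison with smooth surfaces and uniqueness *)

Definition contin (r : R) (g : vec2 -> R) (u : vec2) : Prop :=
  filterlim g (within (square r) (locally u)) (locally (g u)).

Lemma tends_contin r g u (x y : nat -> R) : contin r g u ->
  (forall k, square r (x k, y k)) -> tends x (fst u) -> tends y (snd u) ->
  tends (fun k => g (x k, y k)) (g u).
Proof.
intros H Hs Hx Hy P HP. destruct (H P HP) as [del Hd].
rewrite tends_iff in Hx, Hy.
change (hyper (fun k => P (g (x k, y k)))).
generalize (hyper_and _ _ (Hx del (cond_pos del)) (Hy del (cond_pos del))). apply hyper_imp.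
intros k [h1 h2]. apply Hd; [|apply Hs]. split; [exact h1|exact h2].
Qed.

(** Compactness by the ultrafilter: points with |g| > k would have coordinates converging along it
    to a point of the closed square, where g is finite and continuous. *)
Lemma contin_bounded r g : (forall u, square r u -> contin r g u) ->
  exists C, forall u, square r u -> Rabs (g u) <= C.
Proof.
intros Hg. destruct (classic (exists C, forall u, square r u -> Rabs (g u) <= C)) as [h|h]; [exact h|exfalso].
assert (H : forall k, exists u, square r u /\ INR k < Rabs (g u)).
{ intros k. destruct (classic (exists u, square r u /\ INR k < Rabs (g u))) as [h'|h']; [exact h'|exfalso].
  apply h. exists (INR k). intros u Hu. destruct (Rle_dec (Rabs (g u)) (INR k)) as [l|l]; [exact l|exfalso].
  apply h'. exists u. split; [exact Hu|lra]. }
pose (s := fun k => proj1_sig (constructive_indefinite_description _ (H k))).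
assert (Hs : forall k, square r (s k) /\ INR k < Rabs (g (s k))).
{ intros k. exact (proj2_sig (constructive_indefinite_description _ (H k))). }
destruct (tends_exists (fun k => fst (s k)) r) as [x Hx].
{ apply hyper_all. intros k. destruct (Hs k) as [[h1 _] _]. rewrite Rabs_pos_eq; lra. }
destruct (tends_exists (fun k => snd (s k)) r) as [y Hy].
{ apply hyper_all. intros k. destruct (Hs k) as [[_ h1] _]. rewrite Rabs_pos_eq; lra. }
assert (Hu : square r (x, y)).
{ split; simpl; split;
  [apply (tends_le (fun _ => 0) (fun k => fst (s k)))|apply (tends_le (fun k => fst (s k)) (fun _ => r))
  |apply (tends_le (fun _ => 0) (fun k => snd (s k)))|apply (tends_le (fun k => snd (s k)) (fun _ => r))];
  try assumption; try apply tends_const; apply hyper_all; intros k; destruct (Hs k) as [[h1 h2] _]; lra. }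
assert (Ht := tends_contin r g (x, y) _ _ (Hg _ Hu)
  (fun k => eq_ind (s k) (square r) (proj1 (Hs k)) _ (surjective_pairing (s k))) Hx Hy).
rewrite tends_iff in Ht. specialize (Ht 1 ltac:(lra)).
destruct (INR_unbounded (Rabs (g (x, y)) + 1)) as [m Hm].
destruct (hyper_ex _ (hyper_and _ _ Ht (hyper_large m))) as [k [h1 h2]].
destruct (Hs k) as [_ h3]. rewrite (surjective_pairing (s k)) in h3.
apply le_INR in h2. pose proof (Rabs_triang_inv (g (fst (s k), snd (s k))) (g (x, y))). lra.
Qed.

Lemma contin_const r c u : contin r (fun _ => c) u.
Proof. apply filterlim_const. Qed.
Lemma contin_add r g h u : contin r g u -> contin r h u -> contin r (fun v => g v + h v) u.
Proof. intros Hg Hh. exact (filterlim_comp_2 _ _ _ Hg Hh (filterlim_plus (g u) (h u))). Qed.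
Lemma contin_mul r g h u : contin r g u -> contin r h u -> contin r (fun v => g v * h v) u.
Proof. intros Hg Hh. exact (filterlim_comp_2 _ _ _ Hg Hh (filterlim_mult (K := R_AbsRing) (g u) (h u))). Qed.
Lemma contin_inv r g u : g u <> 0 -> contin r g u -> contin r (fun v => / g v) u.
Proof. intros H0 Hg. exact (filterlim_comp _ _ _ _ _ _ _ _ Hg (continuous_Rinv (g u) H0)). Qed.

(** Comparison yields identities on the half-open square only. The points (1 - ek k) u lie in it and
    tend to u, so continuity reaches the two missing edges. *)
Lemma contin_closure r g g' : 0 < r -> (forall u, square r u -> contin r g u) ->
  (forall u, square r u -> contin r g' u) -> (forall u, inq r u -> g u = g' u) ->
  forall u, square r u -> g u = g' u.
Proof.
intros Hr Hg Hg' H u Hu.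
set (x := fun k => (1 - ek k) * fst u). set (y := fun k => (1 - ek k) * snd u).
assert (He : forall k, 0 < ek k <= 1).
{ intros k. split; [apply ek_pos|]. unfold ek. rewrite <- Rinv_1 at 2. apply Rinv_le_contravar; [lra|].
  pose proof (pos_INR k). lra. }
assert (Hin : forall k z, 0 <= z <= r -> 0 <= (1 - ek k) * z < r).
{ intros k z Hz. specialize (He k). split; [apply Rmult_le_pos; lra|]. nra. }
assert (Hxy : forall k, inq r (x k, y k)).
{ intros k. destruct Hu. split; now apply Hin. }
assert (Hs : forall k, square r (x k, y k)).
{ intros k. destruct (Hxy k). unfold square. lra. }
assert (Hl : forall z, tends (fun k => (1 - ek k) * z) z).
{ intros z. assert (h : tends (fun k => (1 - ek k) * z) ((1 + - 0) * z)).
  { apply tends_mul; [|apply tends_const]. apply tends_add; [apply tends_const|]. apply tends_opp, ek_tends. }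
  now replace ((1 + - 0) * z) with z in h by ring. }
apply (tends_unique (fun k => g (x k, y k))).
- apply (tends_contin r); auto; apply Hl.
- apply (tends_eq (fun k => g' (x k, y k))); [apply hyper_all; intros k; symmetry; apply H, Hxy|].
  apply (tends_contin r); auto; apply Hl.
Qed.

Lemma smooth_on_contin r g w u : smooth_on (square r) g -> square r u -> contin r (partials (square r) w g) u.
Proof. intros H Hu. now apply H. Qed.
Lemma smooth_on_pd r g w b u : 0 < r -> smooth_on (square r) g -> square r u ->
  pd r b (partials (square r) w g) u (partials (square r) (b :: w) g u).
Proof.
intros Hr H Hu. destruct (H w u Hu) as [_ Hd]. destruct (Hd b) as [d Hd'].
apply is_partial_pd in Hd'; [|exact Hu]. simpl.
now rewrite (partial_pd r b _ u d Hr Hu Hd').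
Qed.
Lemma smooth_on_jet r g : 0 < r -> smooth_on (square r) g ->
  smooth_jet r (fun _ w => partials (square r) w g).
Proof.
intros Hr H R' w HR.
destruct (contin_bounded r (partials (square r) w g)) as [C HC]; [intros; now apply smooth_on_contin|].
exists C, 1. split; [lra|]. intros e _ u Hu.
assert (Hu' : square r u) by (apply (square_le R'); lra || auto).
split; [now apply HC|]. intros b. apply (pd_le R' r); [lra|]. now apply smooth_on_pd.
Qed.

(** The double difference is symmetric in the two directions, while the estimate holds with either
    order of differentiation; this yields the symmetry of second derivatives. *)
Lemma mixed_difference r g b u : 0 < r -> smooth_on (square r) g -> inq r u ->
  forall eta, 0 < eta -> exists del, 0 < del /\ forall h, 0 < h < del ->
  Rabs (g (move b h (move (other b) h u)) - g (move b h u) - g (move (other b) h u) + g u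
        - h * h * partials (square r) [b; other b] g u) <= eta * h * h.
Proof.
intros Hr Hg Hu eta He.
assert (Hus : square r u) by (unfold inq, square in *; lra).
set (c := partials (square r) [b; other b] g u).
destruct (Hg [b; other b] u Hus) as [Hc _].
destruct (Hc (fun y => Rabs (y - c) < eta)) as [d0 Hd0].
{ exists (mkposreal eta He). intros y Hy. exact Hy. }
set (m := Rmax (fst u) (snd u)).
assert (Hm : m < r) by (destruct Hu; apply Rmax_lub_lt; lra).
assert (Hm1 : fst u <= m) by apply Rmax_l. assert (Hm2 : snd u <= m) by apply Rmax_r.
exists (Rmin d0 ((r - m) / 2)). split; [apply Rmin_glb_lt; [apply cond_pos|lra]|].
intros h Hh. rmins.
set (r' := r - h).
assert (Hur' : square r' u) by (unfold r'; unfold inq, square in *; lra).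
assert (Hur'' : square r' (move (other b) h u)) by (unfold r'; unfold inq, square in *; destruct b; simpl; lra).
(* The difference in direction b minus the expected linear growth. Its derivative across b is an
   increment of [psi], to which the mean value theorem applies again. It is considered on the side r
   - h, so that v displaced by h stays in the square. *)
pose (phi := fun v => 1 * (1 * g (move b h v) + (-1) * g v) + (- (h * c)) * axval (other b) v).
pose (phi' := fun v => 1 * (1 * partials (square r) [other b] g (move b h v) +
   (-1) * partials (square r) [other b] g v) + (- (h * c)) * 1).
assert (Hphi : forall v, square r' v -> pd r' (other b) phi v (phi' v)).
{ intros v Hv. assert (Hv' : square r v) by (apply (square_le r'); [unfold r'; lra|exact Hv]).
  unfold phi, phi'. apply pd_lin; [|apply pd_axval]. apply pd_lin.
  - apply (pd_shift r' r); [unfold r'; lra|]. apply (smooth_on_pd r g []); auto.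
    apply (square_move r'); unfold r'; lra || auto.
  - apply (pd_le r' r); [unfold r'; lra|]. now apply (smooth_on_pd r g []). }
assert (M := mean_value r' (other b) phi phi' Hphi u h (eta * h) ltac:(lra) Hur' Hur'').
replace (g (move b h (move (other b) h u)) - g (move b h u) - g (move (other b) h u) + g u - h * h * c)
  with (phi (move (other b) h u) - phi u) by (unfold phi; destruct b; simpl; ring).
apply M. intros t Ht.
pose (psi := fun v => 1 * partials (square r) [other b] g v + (- c) * axval b v).
pose (psi' := fun v => 1 * partials (square r) [b; other b] g v + (- c) * 1).
assert (Hpsi : forall v, square r v -> pd r b psi v (psi' v)).
{ intros v Hv. unfold psi, psi'. apply pd_lin; [|apply pd_axval]. now apply (smooth_on_pd r g [other b]). }
set (v := move (other b) t u).
assert (Hv : square r v) by (unfold v; unfold inq, square in *; destruct b; simpl; lra).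
assert (Hv' : square r (move b h v)) by (unfold v; unfold inq, square in *; destruct b; simpl; lra).
replace (phi' v) with (psi (move b h v) - psi v) by (unfold phi', psi; destruct b; simpl; ring).
apply (mean_value r b psi psi' Hpsi); auto; [lra|]. intros s Hs. unfold psi'.
replace (1 * partials (square r) [b; other b] g (move b s v) + - c * 1) with
  (partials (square r) [b; other b] g (move b s v) - c) by ring.
left. apply Hd0.
- assert (Hb : forall z : R, 0 <= z <= h -> Rabs z < d0) by (intros z Hz; rewrite Rabs_pos_eq; lra).
  unfold v. destruct b; simpl; split; simpl.
  + change (Rabs (fst u + s - fst u) < d0). replace (fst u + s - fst u) with s by ring. now apply Hb.
  + change (Rabs (snd u + t - snd u) < d0). replace (snd u + t - snd u) with t by ring. now apply Hb.
  + change (Rabs (fst u + t - fst u) < d0). replace (fst u + t - fst u) with t by ring. now apply Hb.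
  + change (Rabs (snd u + s - snd u) < d0). replace (snd u + s - snd u) with s by ring. now apply Hb.
- apply (square_between r b s h); auto.
Qed.

(* K_gauss_eq gives d1 d2 n only, while the Goursat problem for d1 n needs d2 d1 n. *)
Lemma clairaut r g u : 0 < r -> smooth_on (square r) g -> inq r u ->
  partials (square r) [ax1; ax2] g u = partials (square r) [ax2; ax1] g u.
Proof.
intros Hr Hg Hu. apply Rminus_diag_uniq, cond_eq. intros eta He.
destruct (mixed_difference r g ax1 u Hr Hg Hu (eta / 4)) as [d1 [Hd1 H1]]; [lra|].
destruct (mixed_difference r g ax2 u Hr Hg Hu (eta / 4)) as [d2 [Hd2 H2]]; [lra|].
assert (0 < Rmin d1 d2) by now apply Rmin_glb_lt.
rmins. set (h := Rmin d1 d2 / 2).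
specialize (H1 h ltac:(unfold h; lra)). specialize (H2 h ltac:(unfold h; lra)).
unfold other in H1, H2. rewrite (move_comm ax2 ax1) in H2.
set (c := partials (square r) [ax1; ax2] g u) in *. set (c' := partials (square r) [ax2; ax1] g u) in *.
assert (h0 : 0 < h) by (unfold h; lra).
set (D := g (move ax1 h (move ax2 h u))) in *. set (D1 := g (move ax1 h u)) in *. set (D2 := g (move ax2 h u)) in *.
apply Rabs_le_between in H1. apply Rabs_le_between in H2.
rewrite Rminus_0_r. assert (0 < h * h) by nra.
apply Rabs_def1; nra.
Qed.

(** The curve as a function on the plane that is constant across direction b: words containing the
    other letter give 0. In this form the initial curves fall under the estimates for jets. *)
Definition curve_jet (b : axis) (c : R -> R) : jet := fun _ w u =>
  if forallb (fun a => match a, b with ax1, ax1 => true | ax2, ax2 => true | _, _ => false end) w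
  then Derive_n c (length w) (axval b u) else 0.

Lemma curve_contin r b c m u : (forall k t, ex_derive_n c k t) -> contin r (fun v => Derive_n c m (axval b v)) u.
Proof.
intros Hc. assert (Hd : continuous (Derive_n c m) (axval b u)).
{ exact (ex_derive_continuous (K := R_AbsRing) (V := R_NormedModule) (Derive_n c m) (axval b u) (Hc (S m) (axval b u))). }
intros P HP. destruct (Hd P HP) as [del Hdel]. exists del. intros v Hv _. apply Hdel.
destruct b; apply Hv.
Qed.
Lemma curve_jet_smooth R0 b c : (forall k t, ex_derive_n c k t) -> smooth_jet R0 (curve_jet b c).
Proof.
intros Hc R' w _. unfold curve_jet. simpl forallb.
set (tst := fun a => match a, b with ax1, ax1 => true | ax2, ax2 => true | _, _ => false end).
destruct (contin_bounded R' (fun v => Derive_n c (length w) (axval b v))) as [C HC]; [intros; now apply curve_contin|].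
exists (Rabs C), 1. split; [lra|]. intros e _ u Hu. split.
- destruct (forallb tst w); [apply Rle_trans with (1 := HC u Hu), Rle_abs|rewrite Rabs_R0; apply Rabs_pos].
- intros a. fold (tst a). destruct (forallb tst w); [|].
  + destruct (tst a) eqn:Ea; simpl.
    * assert (a = b) by (unfold tst in Ea; destruct a, b; congruence). subst a.
      assert (Hd : is_derive (Derive_n c (length w)) (axval b u) (Derive_n c (S (length w)) (axval b u))).
      { apply Derive_correct. exact (Hc (S (length w)) (axval b u)). }
      apply is_derive_Reals in Hd. intros eta He. destruct (Hd eta He) as [del Hdel].
      exists del. split; [apply cond_pos|]. intros h Hh Hs.
      destruct (Req_dec h 0) as [->|h0].
      { rewrite move_0. match goal with |- Rabs ?x <= _ => replace x with 0 by ring end. rewrite Rabs_R0. lra. }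
      specialize (Hdel h h0 Hh).
      assert (Em : axval b (move b h u) = axval b u + h) by (destruct b; reflexivity). rewrite Em.
      simpl in Hdel |- *.
      match goal with |- Rabs (?A - ?B - h * ?D) <= _ =>
        replace (A - B - h * D) with (((A - B) / h - D) * h) by (field; exact h0) end.
      rewrite Rabs_mult. apply Rmult_le_compat_r; [apply Rabs_pos|]. left. exact Hdel.
    * intros eta He. exists 1. split; [lra|]. intros h _ _.
      assert (Em : axval b (move a h u) = axval b u) by (unfold tst in Ea; destruct a, b; try discriminate; reflexivity).
      rewrite Em. match goal with |- Rabs ?x <= _ => replace x with 0 by ring end. rewrite Rabs_R0.
      pose proof (Rabs_pos h). nra.
  + rewrite Bool.andb_false_r. intros eta He. exists 1. split; [lra|]. intros h _ _.
    match goal with |- Rabs ?x <= _ => replace x with 0 by ring end. rewrite Rabs_R0.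
    pose proof (Rabs_pos h). nra.
Qed.

(* A vector jet: G k w is the partial derivative along the word w of component k. *)
Definition vjet : Type := c3 -> list axis -> vec2 -> R.
Definition at_jet (G : vjet) (w : list axis) (u : vec2) : vec3 := (G cx w u, G cy w u, G cz w u).
Lemma co_at_jet k G w u : co k (at_jet G w u) = G k w u.
Proof. destruct k; reflexivity. Qed.
Definition rst (g : vec2 -> R) : fam := rho (fun _ => g).

(** * Comparison of lattice families with jets *)

Section Comparison.
Variable R0 : R.
Notation ev := (ev R0).
Notation bd := (bd R0).
Notation B := (B R0).
Notation feq := (feq R0).
Notation sim := (sim R0).
Notation none := (fun _ : fam => False).

Lemma ev_inq (Q : vec2 -> Prop) : (forall u, inq R0 u -> Q u) -> ev (fun e i j => Q (INR i * e, INR j * e)).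
Proof.
intros H R' HR. exists 1. split; [lra|]. intros e He i j Hi Hj. apply H.
apply (square_inq R0 R'); [exact HR|]. apply square_grid; lra.
Qed.

Definition good_jet (N : nat) (G : vjet) : Prop := forall k,
  smooth_jet R0 (fun _ => G k) /\
  forall b w, sim N none (dl b (rst (G k w))) (rst (G k (b :: w))).

Lemma good_jet_commuting N G : (forall k, smooth_jet R0 (fun _ => G k)) ->
  (forall k, commuting (fun _ => G k)) -> good_jet N G.
Proof. intros H Hc k. split; [apply H|]. intros b w. apply (rho_err R0 N (fun _ => G k)); auto. Qed.
Lemma good_jet_0 G : (forall k, smooth_jet R0 (fun _ => G k)) -> good_jet 0 G.
Proof. intros H k. split; [apply H|]. intros b w. apply (rho_err0 R0 (fun _ => G k)); auto. Qed.
Lemma good_jet_B N M G k w : good_jet N G -> B M (rst (G k w)).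
Proof. intros H. apply (rho_B R0 M (fun _ => G k)), H. Qed.
Lemma sim_feq_r N Y p q q' : feq q q' -> sim N Y p q -> sim N Y p q'.
Proof. intros H. apply sim_feq; [apply feq_refl|exact H]. Qed.

Lemma K_compare_smooth N n G :
  (forall M k, B M (n k)) -> units R0 n -> gauss_eq R0 n -> good_jet N G ->
  (forall u, inq R0 u -> dot (at_jet G [] u) (at_jet G [] u) = 1) ->
  (forall u b, inq R0 u -> at_jet G [other b; b] u =
     ((- dot (at_jet G [ax1] u) (at_jet G [ax2] u))%R *: at_jet G [] u)%V) ->
  (forall b k, ev (fun e i j => coord (other b) i j = 0%nat -> n k e i j = rst (G k []) e i j)) ->
  (forall k, sim N none (n k) (rst (G k []))) /\ (forall b k, sim N none (dl b (n k)) (rst (G k [b]))).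
Proof.
intros Hn Hu Hg HG HGu HGg H0.
apply (K_compare R0 N n (fun k => rst (G k [])) (fun b k => rst (G k [b]))); auto.
- generalize (ev_inq _ HGu). apply ev_mono. intros e i j _ h. exact h.
- intros b k. apply (HG k).
- intros k. now apply (good_jet_B N).
- intros b k. apply (sim_feq_r _ _ _ (rst (G k [other b; b]))); [|apply (HG k)].
  generalize (ev_inq _ (fun u Hu => conj (HGg u b Hu) (HGu u Hu))). apply ev_mono.
  intros e i j _ [h h1]. apply (f_equal (co k)) in h. rewrite co_scal, !co_at_jet in h.
  unfold rhs_K, den_K, vstep, fdot, fmul, fadd, fopp, finv, fcst, rst, rho. rewrite h.
  rewrite dot_co, !co_at_jet in h1. rewrite dot_co, !co_at_jet.
  set (u := (INR i * e, INR j * e)) in *.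
  replace (1 + _) with (1 + (G cx [] u * G cx [] u + G cy [] u * G cy [] u + G cz [] u * G cz [] u)) by ring.
  rewrite h1. field.
Qed.

Lemma B_compare_smooth N t n p G H : t <> 1 -> t <> -1 ->
  (forall M k, B M (n k)) -> (forall M k, B M (p k)) -> feq (fdot n p) (fcst t) ->
  (forall b, B_eq R0 b n p) -> good_jet N G -> good_jet N H ->
  (forall k, sim N none (n k) (rst (G k []))) -> (forall b k, sim N none (dl b (n k)) (rst (G k [b]))) ->
  (forall b u, inq R0 u -> 1 + sg b * dot (at_jet G [] u) (at_jet H [] u) <> 0) ->
  (forall b, bd (rst (fun u => / (1 + sg b * dot (at_jet G [] u) (at_jet H [] u))))) ->
  (forall b u, inq R0 u -> at_jet H [b] u =
    (sg b *: at_jet G [b] u + (- (sg b * dot (at_jet G [b] u) (at_jet H [] u)) /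
        (1 + sg b * dot (at_jet G [] u) (at_jet H [] u)))%R *: (at_jet H [] u + sg b *: at_jet G [] u))%V) ->
  (forall k, ev (fun e i j => i = 0%nat -> j = 0%nat -> p k e i j = rst (H k []) e i j)) ->
  forall k, sim N none (p k) (rst (H k [])).
Proof.
intros Ht Ht' Hn Hp Hnp He HG HH Sn Sv Hne Hbd HHe H0.
assert (Eden : forall b e i j, den_B b (fcst 0) (fun k => rst (G k [])) (fun k => rst (G k [b])) (fun k => rst (H k [])) e i j
  = 1 + sg b * dot (at_jet G [] (INR i * e, INR j * e)) (at_jet H [] (INR i * e, INR j * e))).
{ intros b e i j. rewrite dot_co, !co_at_jet. unfold den_B, vstep, fdot, fmul, fadd, fcst, rst, rho. ring. }
apply (B_compare R0 N n (fun k => rst (G k [])) p (fun k => rst (H k [])) (fun b k => rst (G k [b])) t); auto.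
- intros k. now apply (good_jet_B N).
- intros b. split.
  + generalize (ev_inq _ (Hne b)). apply ev_mono. intros e i j _ h.
    unfold fmul, finv. rewrite Eden. now apply Rinv_r.
  + apply (bd_feq R0 (rst (fun u => / (1 + sg b * dot (at_jet G [] u) (at_jet H [] u))))); [|apply Hbd].
    apply ev_all. intros e i j _. unfold finv. rewrite Eden. reflexivity.
- intros b k. apply (sim_feq_r _ _ _ (rst (H k [b]))); [|apply (HH k)].
  generalize (ev_inq _ (HHe b)). apply ev_mono. intros e i j _ h.
  apply (f_equal (co k)) in h. autorewrite with vec in h. rewrite !co_at_jet in h.
  unfold rst at 1, rho at 1. rewrite h. unfold rhs_B.
  unfold fadd at 1, fmul at 2, fmul at 2, finv. rewrite Eden. rewrite !dot_co, !co_at_jet.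
  unfold vstep, fdot, fmul, fadd, fopp, fcst, rst, rho. unfold Rdiv. ring.
Qed.

Lemma F_compare_smooth N n f G H :
  (forall M k, B M (f k)) -> (forall b k, feq (dl b (f k)) (rhs_F b n (vdl b n) k)) ->
  good_jet N G -> good_jet N H ->
  (forall k, sim N none (n k) (rst (G k []))) -> (forall b k, sim N none (dl b (n k)) (rst (G k [b]))) ->
  (forall u, inq R0 u -> at_jet H [ax1] u = cross (at_jet G [ax1] u) (at_jet G [] u)) ->
  (forall u, inq R0 u -> at_jet H [ax2] u = cross (at_jet G [] u) (at_jet G [ax2] u)) ->
  (forall k, ev (fun e i j => i = 0%nat -> j = 0%nat -> f k e i j = rst (H k []) e i j)) ->
  forall k, sim N none (f k) (rst (H k [])).
Proof.
intros Hf He HG HH Sn Sv H1 H2 H0.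
apply (F_compare R0 N n (fun k => rst (G k [])) f (fun k => rst (H k [])) (fun b k => rst (G k [b]))); auto.
- intros k. now apply (good_jet_B N).
- intros b k. apply (sim_feq_r _ _ _ (rst (H k [b]))); [|apply (HH k)].
  destruct b; [generalize (ev_inq _ H1)|generalize (ev_inq _ H2)]; apply ev_mono; intros e i j _ h;
  apply (f_equal (co k)) in h; rewrite co_cross, !co_at_jet in h; unfold rst at 1, rho at 1; rewrite h;
  destruct k; unfold rhs_F, fcross, fmul, fadd, fopp, rst, rho; ring.
Qed.

(** p equals g at the node below u plus e times a bounded quotient; the second term tends to 0 and
    continuity of g settles the first. *)
Lemma sim_limit N p g u : sim N none p (rst g) -> inq R0 u ->
  (forall r, r < R0 -> square r u -> contin r g u) -> flim p u = g u.
Proof.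
intros [Hp [_ Hs]] Hu Hg. destruct (inq_square R0 u Hu) as [R' [HR HRu]].
assert (Hbp := B_bd _ _ _ Hp). apply (flim_eq R0); auto.
assert (Hq := B_bd _ _ _ (span_none R0 N _ Hs)).
destruct (Hq R' HR) as [C HC].
set (x := fun k => INR (idx (fst u) k) * ek k). set (y := fun k => INR (idx (snd u) k) * ek k).
assert (Hu0 : 0 <= fst u /\ 0 <= snd u) by (destruct HRu; lra).
assert (Hsq : forall k, square R' (x k, y k)).
{ intros k. destruct (idx_spec (fst u) k (proj1 Hu0)) as [h1 _]. destruct (idx_spec (snd u) k (proj2 Hu0)) as [h2 _].
  destruct HRu as [h3 h4]. apply square_grid; [apply ek_pos| |]; lra. }
assert (Hg' := tends_contin R' g u x y (Hg R' HR HRu) Hsq (tends_idx _ (proj1 Hu0)) (tends_idx _ (proj2 Hu0))).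
assert (Hd : tends (fun k => ek k * quot p (rst g) (ek k) (idx (fst u) k) (idx (snd u) k)) 0).
{ apply (tends_squeeze _ (fun k => ek k * C)).
  - replace 0 with (0 * C) by ring. apply tends_mul; [apply ek_tends|apply tends_const].
  - generalize (near_hyper R' (fun e i j => Rabs (quot p (rst g) e i j) <= C) u HRu HC). apply hyper_imp.
    intros k h. pose proof (ek_pos k). rewrite Rminus_0_r, Rabs_mult, (Rabs_pos_eq (ek k)) by lra.
    apply Rmult_le_compat_l; lra. }
apply (tends_eq (fun k => ek k * quot p (rst g) (ek k) (idx (fst u) k) (idx (snd u) k) + g (x k, y k))).
- apply hyper_all. intros k. pose proof (ek_pos k). unfold quot, fmul, fadd, fopp, finv, feps, rst, rho, val.
  fold (x k) (y k). field. lra.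
- rewrite <- (Rplus_0_l (g u)). now apply tends_add.
Qed.
End Comparison.

Lemma ev_weaken R0 R1 Q : R0 <= R1 -> ev R1 Q -> ev R0 Q.
Proof. intros H HQ R' HR. apply HQ. lra. Qed.
Lemma B_weaken R0 R1 N p : R0 <= R1 -> B R1 N p -> B R0 N p.
Proof.
intros H. revert p. induction N as [|N IH]; intros p [Hp Hd]; (split; [intros R' HR; apply Hp; lra|]); [exact I|].
intros b. apply IH, Hd.
Qed.

Definition lim_vjet (n : vfam) : vjet := fun k w u => flim (dlw w (n k)) u.
Definition smooth_vjet (r : R) (g : vec2 -> vec3) : vjet := fun k w => partials (square r) w (fun u => co k (g u)).

Section Convergence.
Variable R0 : R.
Notation none := (fun _ : fam => False).

Lemma lim_good N n : (forall M k, B R0 M (n k)) -> good_jet R0 N (lim_vjet n).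
Proof.
intros Hn. apply good_jet_commuting; intros k; [|exact (flim_jet_commuting (n k))].
apply (flim_jet_smooth R0 (n k)). intros M. apply Hn.
Qed.

Definition exact_on_axes (n : vfam) : Prop := forall b k,
  ev R0 (fun e i j => coord (other b) i j = 0%nat -> n k e i j = rst (flim (n k)) e i j).
Definition exact_at_0 (n : vfam) : Prop := forall k,
  ev R0 (fun e i j => i = 0%nat -> j = 0%nat -> n k e i j = rst (flim (n k)) e i j).

(** The limit, although taken along an ultrafilter, solves the smooth equations with the same data
    and has commuting derivatives. Comparing the whole discrete family with it therefore gives O(e)
    in every C^N, for all small meshes. *)
Theorem discrete_B_converges t n f p g : discrete_B R0 t n f p g ->
  exact_on_axes n -> exact_at_0 f -> exact_at_0 p ->
  forall N k, sim R0 N none (g k) (rst (flim (g k))).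
Proof.
intros D Hn0 Hf0 Hp0 N.
assert (Dl := dB_p_limit R0 t n f p g D). assert (Dd := dB_dot_limit R0 t n f p g D).
destruct D as [Ht Ht' DK DK' Hdot He Hg].
assert (bn := fun k => proj1 (dK_bd R0 n f DK k)). assert (bp := fun k => proj1 (dK_bd R0 p g DK' k)).
assert (bf := fun k => proj1 (proj2 (dK_bd R0 n f DK k))).
assert (Hn := dKn _ _ _ DK). assert (Hp := dKn _ _ _ DK'). assert (Hf := dKf _ _ _ DK).
destruct (K_compare_smooth R0 N n (lim_vjet n)) as [Sn Sv]; auto.
- apply DK.
- apply DK.
- now apply lim_good.
- intros u Hi. exact (flimv_unit R0 n u Hi (dKu _ _ _ DK)).
- intros u b Hi. exact (dK_gauss_limit R0 n f DK b u Hi).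
- assert (Sp : forall k, sim R0 N none (p k) (rst (flim (p k)))).
  { apply (B_compare_smooth R0 N t n p (lim_vjet n) (lim_vjet p)); auto.
    - now apply lim_good.
    - now apply lim_good.
    - intros b u Hi. exact (proj1 (Dl b u Hi)).
    - intros b. apply (bd_feq R0 (fcst (/ (1 + sg b * t)))); [|apply bd_cst].
      generalize (ev_inq R0 _ Dd). apply ev_mono. intros e i j _ h. unfold fcst, rst, rho.
      change (at_jet (lim_vjet n) []) with (flimv n). change (at_jet (lim_vjet p) []) with (flimv p). now rewrite h.
    - intros b u Hi. exact (proj2 (Dl b u Hi)). }
  assert (Sf : forall k, sim R0 N none (f k) (rst (flim (f k)))).
  { apply (F_compare_smooth R0 N n f (lim_vjet n) (lim_vjet f)); auto.
    - apply DK.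
    - now apply lim_good.
    - now apply lim_good.
    - exact (dK_f_limit R0 n f DK ax1).
    - exact (dK_f_limit R0 n f DK ax2). }
  intros k. rewrite Hg.
  apply (sim_feq_r R0 _ _ _ (rst (flim (f k)) + fcross (fun k => rst (flim (p k))) (fun k => rst (flim (n k))) k)%fam).
  + apply (ev_mono R0 (fun e i j => inq R0 (INR i * e, INR j * e))).
    2: exact (ev_inq R0 (fun u => inq R0 u) (fun u h => h)).
    intros e i j _ Hi.
    match goal with |- _ = rst (flim ?X) e i j => change (rst (flim X) e i j) with (flim X (INR i * e, INR j * e)) end.
    rewrite (flim_add R0), (flim_fcross R0) by (auto; destruct k; simpl; repeat first [apply bd_add | apply bd_opp | apply bd_mul]; auto).
    rewrite co_cross, !co_flimv. destruct k; reflexivity.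
  + apply sim_add; [apply Sf|]. apply sim_fcross; [exact Sp|exact Sn].
Qed.

End Convergence.

Lemma vsmooth_comp r g : vsmooth_on (square r) g -> forall k, smooth_on (square r) (fun u => co k (g u)).
Proof. intros [h1 [h2 h3]] k. destruct k; assumption. Qed.

Lemma smooth_good r g : 0 < r -> vsmooth_on (square r) g -> good_jet r 0 (smooth_vjet r g).
Proof.
intros Hr Hg. apply good_jet_0. intros k. apply (smooth_on_jet r (fun u => co k (g u))); [exact Hr|].
now apply vsmooth_comp.
Qed.

(** * Uniqueness among smooth solutions *)

Section Uniqueness.
Variable r : R.
Hypothesis Hr : 0 < r.
Notation none := (fun _ : fam => False).

Lemma inq_sq u : inq r u -> square r u.
Proof. unfold inq, square. lra. Qed.

Theorem K_smooth_compare n n' f' : (forall M k, B r M (n k)) -> units r n -> gauss_eq r n ->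
  K_surface (square r) n' f' ->
  (forall b k, ev r (fun e i j => coord (other b) i j = 0%nat -> n k e i j = co k (n' (INR i * e, INR j * e)))) ->
  (forall k, sim r 0 none (n k) (rst (smooth_vjet r n' k []))) /\
  (forall b k, sim r 0 none (dl b (n k)) (rst (smooth_vjet r n' k [b]))).
Proof.
intros Hn Hu Hg HK H0. apply K_compare_smooth; auto.
- apply smooth_good; [exact Hr|apply HK].
- intros u Hi. apply sphere_dot, HK. now apply inq_sq.
- intros u b Hi.
  assert (E := K_gauss_eq _ _ _ HK u (inq_sq u Hi)).
  destruct b; [|exact E].
  transitivity (at_jet (smooth_vjet r n') [ax1; ax2] u); [|exact E]. apply vec_ext. intros k. rewrite !co_at_jet.
  symmetry. apply clairaut; auto. apply vsmooth_comp, HK.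
Qed.

Lemma sim_flimv n n' : (forall k, sim r 0 none (n k) (rst (fun u => co k (n' u)))) ->
  vsmooth_on (square r) n' -> vsmooth_on (square r) (flimv n) -> forall u, square r u -> n' u = flimv n u.
Proof.
intros Hs Hs' Hn u Hu. apply vec_ext. intros k.
apply (contin_closure r (fun u => co k (n' u)) (fun u => co k (flimv n u))); auto.
- intros v Hv. apply (smooth_on_contin r _ [] v (vsmooth_comp _ _ Hs' k) Hv).
- intros v Hv. apply (smooth_on_contin r _ [] v (vsmooth_comp _ _ Hn k) Hv).
- intros v Hv. rewrite co_flimv. symmetry. apply (sim_limit r 0 (n k) (fun u => co k (n' u))); auto.
  intros r' Hr' Hv'. intros P HP.
  assert (Hc := smooth_on_contin r _ [] v (vsmooth_comp _ _ Hs' k) (square_le r' r v ltac:(lra) Hv')).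
  destruct (Hc P HP) as [del Hd]. exists del. intros x Hx Hx'. apply Hd; [exact Hx|]. apply (square_le r'); lra || auto.
Qed.

Lemma smooth_vpartial_pd g k b u : vsmooth_on (square r) g -> square r u ->
  pd r b (fun u => co k (g u)) u (co k (vpartial (square r) b g u)).
Proof.
intros Hg Hu. assert (H := smooth_on_pd r _ [] b u Hr (vsmooth_comp _ _ Hg k) Hu).
destruct k; exact H.
Qed.

Lemma vpartial_ext g g' b u : vsmooth_on (square r) g -> (forall v, square r v -> g v = g' v) -> square r u ->
  vpartial (square r) b g u = vpartial (square r) b g' u.
Proof.
intros Hg H Hu. apply vec_ext. intros k.
assert (E : partial (square r) b (fun u => co k (g' u)) u = co k (vpartial (square r) b g u)).
{ apply partial_pd; auto. apply (pd_ext r b (fun u => co k (g u))); auto.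
  - intros v Hv. now rewrite H.
  - now apply smooth_vpartial_pd. }
rewrite <- E. destruct k; reflexivity.
Qed.

Lemma equal_partials g g' : vsmooth_on (square r) g -> vsmooth_on (square r) g' ->
  (forall b u, square r u -> vpartial (square r) b g u = vpartial (square r) b g' u) ->
  g (0, 0) = g' (0, 0) -> forall u, square r u -> g u = g' u.
Proof.
intros Hg Hg' Hb H0 u Hu. apply vec_ext. intros k.
set (phi := fun v => 1 * co k (g v) + (-1) * co k (g' v)).
assert (Hphi : forall b v, square r v -> pd r b phi v 0).
{ intros b v Hv. replace 0 with (1 * co k (vpartial (square r) b g v) + (-1) * co k (vpartial (square r) b g' v)) by (rewrite Hb by exact Hv; ring).
  apply pd_lin; now apply smooth_vpartial_pd. }
assert (S0 : square r (0, 0)) by (unfold square; simpl; lra).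
assert (Eu : u = move ax2 (snd u) (move ax1 (fst u) (0, 0))) by (destruct u; simpl; f_equal; ring).
assert (S1 : square r (move ax1 (fst u) (0, 0))) by (unfold square in *; simpl; lra).
assert (Hpos : 0 <= fst u /\ 0 <= snd u) by (unfold square in Hu; lra).
assert (M1 := mean_value r ax1 phi (fun _ => 0) (Hphi ax1) (0, 0) (fst u) 0 (proj1 Hpos) S0 S1
   (fun _ _ => Req_le _ _ Rabs_R0)).
assert (M2 := mean_value r ax2 phi (fun _ => 0) (Hphi ax2) (move ax1 (fst u) (0, 0)) (snd u) 0 (proj2 Hpos) S1
   ltac:(rewrite <- Eu; exact Hu) (fun _ _ => Req_le _ _ Rabs_R0)).
rewrite <- Eu in M2. rewrite Rmult_0_l in M1, M2.
assert (E0 : phi (0, 0) = 0) by (unfold phi; rewrite H0; ring).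
apply Rabs_le_between in M1. apply Rabs_le_between in M2. unfold phi in *. lra.
Qed.

Theorem B_smooth_compare t n p n' f' p' g' : t <> 1 -> t <> -1 ->
  (forall M k, B r M (n k)) -> units r n -> gauss_eq r n ->
  (forall M k, B r M (p k)) -> feq r (fdot n p) (fcst t) -> (forall b, B_eq r b n p) ->
  K_surface (square r) n' f' -> backlund (square r) n' f' p' g' ->
  (forall b k, ev r (fun e i j => coord (other b) i j = 0%nat -> n k e i j = co k (n' (INR i * e, INR j * e)))) ->
  (forall k, ev r (fun e i j => i = 0%nat -> j = 0%nat -> p k e i j = co k (p' (INR i * e, INR j * e)))) ->
  forall k, sim r 0 none (p k) (rst (smooth_vjet r p' k [])).
Proof.
intros Ht Ht' Hn Hu Hg Hp Hnp He HK HB Hn0 Hp0.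
destruct (K_smooth_compare n n' f' Hn Hu Hg HK Hn0) as [Sn Sv].
assert (HK' := B_K_surface _ _ _ _ _ HB).
assert (Hne : forall b u, square r u -> 1 + sg b * dot (n' u) (p' u) <> 0).
{ intros b u Hs. destruct b; simpl; intros h.
  - apply (proj1 (B_d1 _ _ _ _ _ HB u Hs)). lra.
  - apply (proj1 (B_d2 _ _ _ _ _ HB u Hs)). lra. }
apply (B_compare_smooth r 0 t n p (smooth_vjet r n') (smooth_vjet r p')); auto.
- apply smooth_good; [exact Hr|apply HK].
- apply smooth_good; [exact Hr|apply HK'].
- intros b u Hi. apply (Hne b u). now apply inq_sq.
(* For an arbitrary transform the denominators are only known not to vanish; compactness of the
   closed square bounds their inverses. *)
- intros b.
  destruct (contin_bounded r (fun u => / (1 + sg b * dot (n' u) (p' u)))) as [C HC].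
  { intros u Hs.
    assert (c1 : forall k, contin r (fun u => co k (n' u)) u)
      by (intros k; apply (smooth_on_contin r _ [] u (vsmooth_comp _ _ (K_smooth_n _ _ _ HK) k) Hs)).
    assert (c2 : forall k, contin r (fun u => co k (p' u)) u)
      by (intros k; apply (smooth_on_contin r _ [] u (vsmooth_comp _ _ (K_smooth_n _ _ _ HK') k) Hs)).
    apply contin_inv; [now apply Hne|]. apply contin_add; [apply contin_const|].
    apply contin_mul; [apply contin_const|].
    apply (contin_add r (fun u => co cx (n' u) * co cx (p' u) + co cy (n' u) * co cy (p' u)) (fun u => co cz (n' u) * co cz (p' u)));
     [apply contin_add|]; apply contin_mul; auto. }
  intros R' HR. exists C. exists 1. split; [lra|]. intros e He' i j Hi Hj.
  apply (HC (INR i * e, INR j * e)). apply (square_le R'); [lra|]. apply square_grid; lra.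
- intros b u Hi. assert (Hs := inq_sq u Hi). assert (Hn1 := Hne b u Hs).
  change (vpartial (square r) b p' u = (sg b *: vpartial (square r) b n' u +
     (- (sg b * dot (vpartial (square r) b n' u) (p' u)) / (1 + sg b * dot (n' u) (p' u)))%R *: (p' u + sg b *: n' u))%V).
  apply vec_ext. intros k. autorewrite with vec. destruct b; simpl sg in *.
  + destruct (B_d1 _ _ _ _ _ HB u Hs) as [_ h]. apply (f_equal (co k)) in h. autorewrite with vec in h.
    replace (1 + -1 * dot (n' u) (p' u)) with (1 - dot (n' u) (p' u)) in * by ring.
    apply (Rplus_eq_reg_r (co k (vpartial (square r) ax1 n' u))). rewrite h. field. exact Hn1.
  + destruct (B_d2 _ _ _ _ _ HB u Hs) as [_ h]. apply (f_equal (co k)) in h. autorewrite with vec in h.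
    replace (1 + 1 * dot (n' u) (p' u)) with (1 + dot (n' u) (p' u)) in * by ring.
    apply (Rplus_eq_reg_r (- co k (vpartial (square r) ax2 n' u))).
    change (co k (vpartial (square r) ax2 p' u) - co k (vpartial (square r) ax2 n' u) = 
      1 * co k (vpartial (square r) ax2 n' u) +
      - (1 * dot (vpartial (square r) ax2 n' u) (p' u)) / (1 + dot (n' u) (p' u)) * (co k (p' u) + 1 * co k (n' u)) 
      - co k (vpartial (square r) ax2 n' u)).
    rewrite h. field. exact Hn1.
Qed.
End Uniqueness.

(** * The canonical discrete surfaces *)

Definition cf (A : R -> nat -> nat -> vec3) : vfam := fun k e i j => co k (A e i j).
Definition shift (b : axis) (A : R -> nat -> nat -> vec3) (e : R) (i j : nat) : vec3 :=
  match b with ax1 => A e (S i) j | ax2 => A e i (S j) end.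
Lemma tn_cf b A k e i j : tn b (cf A k) e i j = co k (shift b A e i j).
Proof. destruct b; reflexivity. Qed.

Section ArrayFamilies.
Variable R0 : R.
Variables A P F : R -> nat -> nat -> vec3.

Lemma cf_units : ev R0 (fun e i j => dot (A e i j) (A e i j) = 1) -> units R0 (cf A).
Proof. apply ev_mono. intros e i j _ h. exact h. Qed.

Lemma cf_gauss : ev R0 (fun e i j => dot (A e i j) (A e i j) = 1 /\
    1 + dot (A e (S i) j) (A e i (S j)) <> 0 /\
    A e (S i) (S j) = step_K (A e i j) (A e (S i) j) (A e i (S j))) -> gauss_eq R0 (cf A).
Proof.
intros H k. revert H. apply ev_mono. intros e i j He [h1 [h2 h3]].
assert (E1 : forall k, vstep feps (cf A) (vdl ax1 (cf A)) k e i j = co k (A e (S i) j)).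
{ intros k'. unfold vstep, vdl, dl, tn, cf, fadd, fmul, feps. field. lra. }
assert (E2 : forall k, vstep feps (cf A) (vdl ax2 (cf A)) k e i j = co k (A e i (S j))).
{ intros k'. unfold vstep, vdl, dl, tn, cf, fadd, fmul, feps. field. lra. }
unfold rhs_K, den_K, fmul, fopp, finv, fadd at 1, fdot, fmul, fadd. rewrite !E1, !E2.
unfold vdl, dl, tn, cf, fcst.
apply (f_equal (co k)) in h3. unfold step_K in h3. autorewrite with vec dot in h3. rewrite h3. clear h3.
rewrite <- dot_co. rewrite !dot_co in *.
set (D := 1 + (co cx (A e (S i) j) * co cx (A e i (S j)) + co cy (A e (S i) j) * co cy (A e i (S j)) + co cz (A e (S i) j) * co cz (A e i (S j)))) in *.
set (S1 := co cx (A e i j) * co cx (A e (S i) j) + co cy (A e i j) * co cy (A e (S i) j) + co cz (A e i j) * co cz (A e (S i) j)).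
set (S2 := co cx (A e i j) * co cx (A e i (S j)) + co cy (A e i j) * co cy (A e i (S j)) + co cz (A e i j) * co cz (A e i (S j))).
(* On the unit sphere e^2 <v_1, v_2> = 1 + <n1,n2> - <n,n1> - <n,n2>. With this the rational formula
   for the fourth vertex turns into the difference equation. *)
match goal with |- ?l = - (?x) * _ * _ => replace x with ((D - S1 - S2) / (e * e)) end.
- field. lra.
- transitivity ((D - 1 + 1 - S1 - S2) / (e * e)); [f_equal; ring|]. rewrite <- h1 at 2. unfold D, S1, S2. field. lra.
Qed.

Lemma cf_B_eq b : ev R0 (fun e i j => dot (A e i j) (A e i j) = 1 /\ dot (shift b A e i j) (shift b A e i j) = 1 /\
    1 + sg b * dot (shift b A e i j) (P e i j) <> 0 /\
    shift b P e i j = step_B b (A e i j) (shift b A e i j) (P e i j)) -> B_eq R0 b (cf A) (cf P).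
Proof.
intros H k. revert H. apply ev_mono. intros e i j He [h1 [h0 [h2 h3]]].
assert (E1 : forall k, vstep feps (cf A) (vdl b (cf A)) k e i j = co k (shift b A e i j)).
{ intros k'. unfold vstep, vdl, dl, fadd, fmul, feps. rewrite tn_cf. unfold cf. field. lra. }
assert (Ev : forall k, vdl b (cf A) k e i j = (co k (shift b A e i j) - co k (A e i j)) / e).
{ intros k'. unfold vdl, dl. now rewrite tn_cf. }
unfold dl. rewrite tn_cf, h3.
unfold rhs_B, den_B, fadd, fopp, fmul, finv, fcst, fdot, fadd, fmul, feps. rewrite !E1, !Ev.
set (a := A e i j) in *. set (a1 := shift b A e i j) in *. unfold cf. set (p := P e i j) in *.
clearbody a a1 p. clear E1 Ev h3.
set (D := 1 + sg b * (co cx a1 * co cx p + co cy a1 * co cy p + co cz a1 * co cz p)).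
assert (HD : D <> 0) by exact h2.
(* The numerator is the denominator minus <n, tau n> + sg <n, n+>, divided by e, because 1 - <n, tau
   n> is half the squared chord. *)
match goal with |- _ = _ + - (?x) * _ * _ =>
  replace x with ((1 + sg b * (co cx a1 * co cx p + co cy a1 * co cy p + co cz a1 * co cz p)
     - (dot a a1 + sg b * dot a p)) / e) end.
- fold D. destruct b; unfold step_B, step_B1, step_B2; autorewrite with vec dot; simpl sg in *.
  + replace (1 - dot a1 p) with D by (unfold D; rewrite dot_co; ring). field. split; lra.
  + replace (1 + dot a1 p) with D by (unfold D; rewrite dot_co; ring). field. split; lra.
- rewrite dot_co in h1, h0. rewrite !dot_co.
  transitivity (((co cx a * co cx a + co cy a * co cy a + co cz a * co cz a + (co cx a1 * co cx a1 + co cy a1 * co cy a1 + co cz a1 * co cz a1)) / 2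
    + sg b * (co cx a1 * co cx p + co cy a1 * co cy p + co cz a1 * co cz p)
     - (co cx a * co cx a1 + co cy a * co cy a1 + co cz a * co cz a1 + sg b * (co cx a * co cx p + co cy a * co cy p + co cz a * co cz p))) / e).
  + rewrite h1, h0. field. lra.
  + field. lra.
Qed.

Lemma cf_F_eq : ev R0 (fun e i j => F e (S i) j = (F e i j + cross (A e (S i) j) (A e i j))%V /\
    F e i (S j) = (F e i j + cross (A e i j) (A e i (S j)))%V) ->
  forall b k, feq R0 (dl b (cf F k)) (rhs_F b (cf A) (vdl b (cf A)) k).
Proof.
intros H b k. revert H. apply ev_mono. intros e i j He [h1 h2].
destruct b; [apply (f_equal (co k)) in h1; rewrite co_add in h1|apply (f_equal (co k)) in h2; rewrite co_add in h2];
 unfold dl, tn, cf; rewrite ?h1, ?h2, co_cross; destruct k; unfold rhs_F, fcross, vdl, dl, tn, cf, fmul, fadd, fopp; field; lra.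
Qed.
End ArrayFamilies.

(** The squared chord is 2 (1 - <a, a1>), so a deficit of order e^2 bounds the difference quotient.
    Since chords are conserved, the deficit is read off from the initial curves. *)
Lemma bd_cf_dl R0 A b : ev R0 (fun e i j => dot (A e i j) (A e i j) = 1 /\ dot (shift b A e i j) (shift b A e i j) = 1) ->
  (exists C, ev R0 (fun e i j => 1 - dot (A e i j) (shift b A e i j) <= C * C * (e * e))) ->
  forall k, bd R0 (dl b (cf A k)).
Proof.
intros Hu [C HC] k R' HR. exists (2 * Rabs C). generalize (near_and _ _ _ (Hu R' HR) (HC R' HR)). apply near_mono.
intros e i j He [[h1 h2] h3]. unfold dl. rewrite tn_cf. unfold cf.
set (a := A e i j) in *. set (a1 := shift b A e i j) in *.
assert (h4 : (co k a1 - co k a) * (co k a1 - co k a) <= 2 * (1 - dot a a1)).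
{ replace (2 * (1 - dot a a1)) with (dot (a1 - a)%V (a1 - a)%V)
   by (autorewrite with dot; rewrite h1, h2, (dot_comm a1 a); ring).
  rewrite dot_co, !co_sub. pose proof (Rle_0_sqr (co cx a1 - co cx a)) as s1.
  pose proof (Rle_0_sqr (co cy a1 - co cy a)) as s2. pose proof (Rle_0_sqr (co cz a1 - co cz a)) as s3.
  unfold Rsqr in s1, s2, s3. destruct k; lra. }
unfold Rdiv. rewrite Rabs_mult, Rabs_inv, (Rabs_pos_eq e) by lra.
apply Rmult_le_reg_r with e; [lra|]. rewrite Rmult_assoc, Rinv_l, Rmult_1_r by lra.
assert (HC0 := Rabs_pos C).
apply Rsqr_incr_0_var; [|repeat apply Rmult_le_pos; lra]. rewrite <- Rsqr_abs. unfold Rsqr.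
assert (Rabs C * Rabs C = C * C) by (rewrite <- Rabs_mult; apply Rabs_pos_eq; nra).
assert (0 <= C * C * (e * e)) by (apply Rmult_le_pos; nra).
replace (2 * Rabs C * e * (2 * Rabs C * e)) with (4 * (C * C * (e * e))) by (rewrite <- H; ring). lra.
Qed.

(** * Lattice points, lattice functions and arrays *)

Definition node (e : R) (i j : nat) : vec2 := (INR i * e, INR j * e).

Lemma node_move1 e i j : move ax1 e (node e i j) = node e (S i) j.
Proof. unfold node, move. rewrite S_INR. simpl. f_equal. ring. Qed.
Lemma node_move2 e i j : move ax2 e (node e i j) = node e i (S j).
Proof. unfold node, move. rewrite S_INR. simpl. f_equal. ring. Qed.
Lemma grid_node e r i j : 0 < e -> INR i * e <= r -> INR j * e <= r -> grid e r (node e i j).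
Proof.
intros He Hi Hj. split; [|now apply square_grid].
exists (Z.of_nat i), (Z.of_nat j). unfold node. now rewrite <- !INR_IZR_INZ.
Qed.
Lemma node_grid e r u : 0 < e -> grid e r u ->
  exists i j, u = node e i j /\ INR i * e <= r /\ INR j * e <= r.
Proof.
intros He [[k [l ->]] [H1 H2]]. simpl in *.
assert (Hz : forall z : Z, 0 <= IZR z * e -> IZR z = INR (Z.to_nat z)).
{ intros z Hz. rewrite INR_IZR_INZ, Z2Nat.id; [reflexivity|]. apply le_IZR. nra. }
exists (Z.to_nat k), (Z.to_nat l). unfold node. rewrite <- !Hz by lra. repeat split; lra.
Qed.
Lemma node_inj e i j i' j' : 0 < e -> node e i j = node e i' j' -> i = i' /\ j = j'.
Proof.
intros He H. injection H as h1 h2. split; apply INR_eq; nra.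
Qed.
Lemma node_square_inv e r i j : 0 < e -> grid e r (node e i j) -> INR i * e <= r /\ INR j * e <= r.
Proof. intros He [_ [h1 h2]]. simpl in *. lra. Qed.

(** For e > 0 distinct indices give distinct nodes, so the choice has one candidate at a node; off
    the nodes the value is arbitrary. *)
Definition lat (e : R) (A : nat -> nat -> vec3) (u : vec2) : vec3 :=
  epsilon (inhabits (0, 0, 0)) (fun v => exists i j, u = node e i j /\ v = A i j).
Lemma lat_node e A i j : 0 < e -> lat e A (node e i j) = A i j.
Proof.
intros He. assert (H : exists v, exists i' j', node e i j = node e i' j' /\ v = A i' j') by now exists (A i j), i, j.
apply (epsilon_spec (inhabits (0, 0, 0))) in H. destruct H as [i' [j' [h1 h2]]].
apply node_inj in h1; [|exact He]. destruct h1 as [<- <-]. exact h2.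
Qed.

Definition agree (e : R) (g : vec2 -> vec3) (A : nat -> nat -> vec3) : Prop :=
  forall i j, INR i * e <= 1 -> INR j * e <= 1 -> g (node e i j) = A i j.

Lemma agree_pred e m : 0 < e -> INR (S m) * e <= 1 -> INR m * e <= 1.
Proof. intros He H. rewrite S_INR in H. nra. Qed.

Lemma solve_delta e (x y w : vec3) : e <> 0 -> (/ e *: (x - y))%V = (/ e *: w)%V -> x = (y + w)%V.
Proof.
intros He H. apply vec_ext. intros k. apply (f_equal (co k)) in H. autorewrite with vec in *.
apply Rmult_eq_reg_l in H; [lra|now apply Rinv_neq_0_compat].
Qed.

Lemma discrete_K_of_arrays e N F n f : 0 < e ->
  (forall i j, INR i * e <= 1 -> INR j * e <= 1 -> dot (N i j) (N i j) = 1 /\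
     1 + dot (N (S i) j) (N i (S j)) <> 0 /\ N (S i) (S j) = step_K (N i j) (N (S i) j) (N i (S j)) /\
     F (S i) j = (F i j + cross (N (S i) j) (N i j))%V /\ F i (S j) = (F i j + cross (N i j) (N i (S j)))%V) ->
  agree e n N -> agree e f F -> discrete_K_surface e 1 n f.
Proof.
intros He H Hn Hf. constructor.
- intros u Hu. destruct (node_grid e 1 u He Hu) as [i [j [-> [Hi Hj]]]]. rewrite Hn by assumption.
  apply sphere_dot. now apply H.
- intros u Hu Hu'. destruct (node_grid e 1 u He Hu) as [i [j [-> [Hi Hj]]]].
  rewrite node_move2, node_move1 in Hu'. apply node_square_inv in Hu'; [|exact He]. destruct Hu' as [Hi' Hj'].
  unfold tau. rewrite node_move1, !node_move2, !Hn by assumption.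
  destruct (H i j Hi Hj) as [_ [h1 [h2 _]]]. split; [exact h1|]. rewrite h2. unfold step_K. vec.
- intros u Hu Hu'. destruct (node_grid e 1 u He Hu) as [i [j [-> [Hi Hj]]]].
  rewrite node_move1 in Hu'. apply node_square_inv in Hu'; [|exact He]. destruct Hu' as [Hi' Hj'].
  unfold delta, tau. rewrite node_move1, !Hn, !Hf by assumption.
  destruct (H i j Hi Hj) as [_ [_ [_ [h _]]]]. rewrite h. vec.
- intros u Hu Hu'. destruct (node_grid e 1 u He Hu) as [i [j [-> [Hi Hj]]]].
  rewrite node_move2 in Hu'. apply node_square_inv in Hu'; [|exact He]. destruct Hu' as [Hi' Hj'].
  unfold delta, tau. rewrite node_move2, !Hn, !Hf by assumption.
  destruct (H i j Hi Hj) as [_ [_ [_ [_ h]]]]. rewrite h. vec.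
Qed.

Lemma delta_iter e b k : forall m h p i j,
  (forall m', (m' <= m)%nat -> co k (h (let '(i', j') := tnm b m' i j in node e i' j')) = ap p e (tnm b m' i j)) ->
  co k (Nat.iter m (delta e b) h (node e i j)) = Nat.iter m (dl b) p e i j.
Proof.
induction m as [|m IH]; intros h p i j H.
- specialize (H 0%nat (Nat.le_refl _)). unfold ap in H. destruct b; simpl in H; rewrite Nat.add_0_r in H; exact H.
- simpl. unfold delta at 1, tau. rewrite co_scal, co_sub. unfold dl at 1.
  assert (h1 : co k (Nat.iter m (delta e b) h (node e i j)) = Nat.iter m (dl b) p e i j).
  { apply IH. intros m' Hm. apply H. lia. }
  rewrite h1. unfold Rdiv. rewrite Rmult_comm. f_equal. f_equal.
  destruct b.
  + rewrite node_move1. apply IH. intros m' Hm. specialize (H (S m') ltac:(lia)).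
    unfold tnm in *. replace (S i + m')%nat with (i + S m')%nat by lia. exact H.
  + rewrite node_move2. apply IH. intros m' Hm. specialize (H (S m') ltac:(lia)).
    unfold tnm in *. replace (S j + m')%nat with (j + S m')%nat by lia. exact H.
Qed.

(** Only the nodes from (i, j) to (i + a1, j + a2) are read, so the values of the lattice function
    outside the square do not matter. *)
Lemma delta_multi_iter e k a1 a2 h p i j :
  (forall m1 m2, (m1 <= a1)%nat -> (m2 <= a2)%nat -> co k (h (node e (i + m1) (j + m2))) = p e (i + m1)%nat (j + m2)%nat) ->
  co k (delta_multi e a1 a2 h (node e i j)) = Nat.iter a1 (dl ax1) (Nat.iter a2 (dl ax2) p) e i j.
Proof.
intros H. unfold delta_multi. apply delta_iter. intros m1 Hm1. unfold tnm, ap. cbn [fst snd].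
apply delta_iter. intros m2 Hm2. unfold tnm, ap. cbn [fst snd]. now apply H.
Qed.

Lemma iter_dl_eps b m p : Nat.iter m (dl b) (feps * p)%fam = (feps * Nat.iter m (dl b) p)%fam.
Proof.
induction m as [|m IH]; [reflexivity|]. simpl. rewrite IH. fam_ext. unfold dl, fmul, feps.
destruct b; unfold tn, Rdiv; ring.
Qed.
Lemma iter_dl_B R0 b m p : (forall N, B R0 N p) -> forall N, B R0 N (Nat.iter m (dl b) p).
Proof. intros Hp. induction m as [|m IH]; intros N; [apply Hp|]. simpl. apply B_dl, IH. Qed.

Lemma flim_axis R0 p b (c : R -> R) t : bd R0 p -> 0 <= t < R0 -> (forall m s, ex_derive_n c m s) ->
  (forall e i j, coord (other b) i j = 0%nat -> p e i j = c (INR (coord b i j) * e)) ->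
  flim p (match b with ax1 => (t, 0) | ax2 => (0, t) end) = c t.
Proof.
intros Hp Ht Hc H. apply (flim_eq R0); [destruct b; unfold inq; simpl; lra|exact Hp|].
set (u := (match b with ax1 => (t, 0) | ax2 => (0, t) end) : vec2).
assert (Hu : axval b u = t) by (destruct b; reflexivity).
apply (tends_eq (fun k => c (INR (idx t k) * ek k))).
- apply hyper_all. intros k. unfold val. symmetry.
  destruct b; simpl; rewrite idx_0; apply H; reflexivity.
- replace (c t) with (c (axval b u)) by (now rewrite Hu). destruct b.
  + apply (tends_contin t (fun v => c (axval ax1 v)) u (fun k => INR (idx t k) * ek k) (fun _ => 0)).
    * exact (curve_contin t ax1 c 0 u Hc).
    * intros k. destruct (idx_spec t k (proj1 Ht)) as [h _]. pose proof (ek_pos k). pose proof (pos_INR (idx t k)).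
      unfold square. simpl. repeat split; try lra. apply Rmult_le_pos; lra.
    * apply tends_idx, Ht.
    * apply tends_const.
  + apply (tends_contin t (fun v => c (axval ax2 v)) u (fun _ => 0) (fun k => INR (idx t k) * ek k)).
    * exact (curve_contin t ax2 c 0 u Hc).
    * intros k. destruct (idx_spec t k (proj1 Ht)) as [h _]. pose proof (ek_pos k). pose proof (pos_INR (idx t k)).
      unfold square. simpl. repeat split; try lra. apply Rmult_le_pos; lra.
    * apply tends_const.
    * apply tends_idx, Ht.
Qed.
Lemma flim_origin R0 p c : 0 < R0 -> bd R0 p -> (forall e, p e 0%nat 0%nat = c) -> flim p (0, 0) = c.
Proof.
intros HR Hp H. apply (flim_eq R0); [unfold inq; simpl; lra|exact Hp|].
apply (tends_eq (fun _ => c)); [|apply tends_const]. apply hyper_all. intros k. unfold val. simpl.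
now rewrite idx_0, H.
Qed.

(** * The surfaces with the given initial data *)

Section Canonical.
Variables (n1 n2 : R -> vec3) (f0 np0 : vec3).
Hypotheses (smooth_n1 : smooth_curve n1) (smooth_n2 : smooth_curve n2).
Hypotheses (sphere_n1 : forall t : R, sphere (n1 t)) (sphere_n2 : forall t : R, sphere (n2 t)).
Hypothesis common_point : n1 0 = n2 0.
Hypothesis sphere_np0 : sphere np0.
Hypotheses (np0_neq : np0 <> n1 0) (np0_neq_opp : np0 <> vopp (n1 0)).

Definition gridc (c : R -> vec3) (e : R) (i : nat) : vec3 := c (INR i * e).
Definition dN (e : R) : nat -> nat -> vec3 := arrN (gridc n1 e) (gridc n2 e).
Definition dF (e : R) : nat -> nat -> vec3 := arrF (gridc n1 e) (gridc n2 e) f0.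
Definition dP (e : R) : nat -> nat -> vec3 := arrP (gridc n1 e) (gridc n2 e) np0.
Definition dG (e : R) : nat -> nat -> vec3 := arrG (gridc n1 e) (gridc n2 e) f0 np0.

Definition angle : R := dot (n1 0) np0.
(** The equality cases of the Cauchy-Schwarz inequality are n+(0) = n(0) and n+(0) = - n(0), which
    the hypotheses exclude. *)
Lemma angle_bounds : -1 < angle < 1.
Proof.
assert (U := proj1 (sphere_dot _) (sphere_n1 0)). assert (V := proj1 (sphere_dot _) sphere_np0).
assert (h1 : angle <> 1).
{ intros h. apply np0_neq. assert (dot (np0 - n1 0)%V (np0 - n1 0)%V = 0).
  { autorewrite with dot. rewrite U, V, (dot_comm np0). fold angle. lra. }
  apply dot_zero in H. apply vec_ext. intros k. apply (f_equal (co k)) in H. rewrite co_sub in H.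
  replace (co k (0, 0, 0)) with 0 in H by (destruct k; reflexivity). lra. }
assert (h2 : angle <> -1).
{ intros h. apply np0_neq_opp. assert (dot (np0 + n1 0)%V (np0 + n1 0)%V = 0).
  { autorewrite with dot. rewrite U, V, (dot_comm np0). fold angle. lra. }
  apply dot_zero in H. apply vec_ext. intros k. apply (f_equal (co k)) in H. rewrite co_add in H. rewrite co_opp.
  replace (co k (0, 0, 0)) with 0 in H by (destruct k; reflexivity). lra. }
assert (h3 := cauchy_schwarz_unit (n1 0) np0 V). fold angle in h3. rewrite U in h3. split; nra.
Qed.
Definition gap : R := Rmin (1 - angle) (1 + angle).
Lemma gap_pos : 0 < gap.
Proof. pose proof angle_bounds. unfold gap. apply Rmin_glb_lt; lra. Qed.
(** The largest admissible deficit of an edge: 1/8 serves the cells of n, and gap^2 / 8 keeps the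
    Baecklund denominators above gap / 2. *)
Definition tol : R := Rmin (1 / 8) (gap * gap / 8).

Lemma smooth_comp (c : R -> vec3) : smooth_curve c -> forall k m t, ex_derive_n (fun s => co k (c s)) m t.
Proof. intros H k m t. destruct (H m t) as [h1 [h2 h3]]. destruct k; assumption. Qed.

Lemma chord_bound c : smooth_curve c -> (forall t, sphere (c t)) ->
  exists C e1, 0 < e1 /\ forall e, 0 < e < e1 -> forall i, INR i * e <= 2 ->
    1 - dot (gridc c e i) (gridc c e (S i)) <= C * C * (e * e).
Proof.
intros Hc Hs.
destruct (near_list ks (fun k C e i j => Rabs (co k (gridc c e (S i)) - co k (gridc c e i)) <= C * e \/ e <= 0) 2)
  as [C [HC [e1 [He1 H]]]].
{ intros k C C' e i j HCC [h|h]; [|now right]. destruct (Rle_dec e 0); [now right|left; nra]. }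
{ intros k _.
  (* Taking R0 = 3 leaves room for the shifted index when the first one reaches 2. *)
  assert (HB := rho_B 3 1 (curve_jet ax1 (fun s => co k (c s))) [] (curve_jet_smooth 3 ax1 _ (smooth_comp c Hc k))).
  destruct (B_bd _ _ _ (B_dl _ _ ax1 _ HB) 2 ltac:(lra)) as [C HC]. exists C.
  revert HC. apply near_mono. intros e i j He h. left.
  unfold dl, tn, rho, curve_jet in h. cbn [forallb length Derive_n axval fst] in h. unfold gridc.
  unfold Rdiv in h. rewrite Rabs_mult, Rabs_inv, (Rabs_pos_eq e) in h by lra.
  apply Rmult_le_reg_r with (/ e); [now apply Rinv_0_lt_compat|]. rewrite Rmult_assoc, Rinv_r, Rmult_1_r by lra. exact h. }
(* Three components contribute at most 3 C^2 e^2 to twice the deficit, and (2 C)^2 covers half of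
   that. *)
exists (2 * C), e1. split; [exact He1|]. intros e He i Hi.
assert (sq : forall k, (co k (gridc c e (S i)) - co k (gridc c e i)) * (co k (gridc c e (S i)) - co k (gridc c e i)) <= C * e * (C * e)).
{ intros k. destruct (H e He i 0%nat Hi ltac:(simpl; lra) k (in_ks k)) as [h|h]; [|lra].
  apply Rabs_le_between in h. nra. }
assert (U : forall t, dot (c t) (c t) = 1) by (intros; apply sphere_dot, Hs).
assert (E : 2 * (1 - dot (gridc c e i) (gridc c e (S i))) = dot (gridc c e (S i) - gridc c e i)%V (gridc c e (S i) - gridc c e i)%V).
{ autorewrite with dot. unfold gridc. rewrite !U, (dot_comm (c (INR (S i) * e))). ring. }
rewrite (dot_co (_ - _)%V), !co_sub in E. pose proof (sq cx). pose proof (sq cy). pose proof (sq cz).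
assert (0 <= C * e * (C * e)) by nra. nra.
Qed.

Lemma chord_tol c : smooth_curve c -> (forall t, sphere (c t)) ->
  exists e1, 0 < e1 /\ forall e, 0 < e < e1 -> forall i, INR i * e <= 2 ->
    1 - dot (gridc c e i) (gridc c e (S i)) <= tol.
Proof.
intros Hc Hs. destruct (chord_bound c Hc Hs) as [C [e1 [He1 H]]].
assert (Ht : 0 < tol) by (pose proof gap_pos; unfold tol; apply Rmin_glb_lt; nra).
exists (Rmin (Rmin e1 1) (tol / (C * C + 1))).
assert (0 <= C * C) by nra.
split; [repeat apply Rmin_glb_lt; try lra; apply Rdiv_lt_0_compat; lra|].
intros e He i Hi. rmins.
apply Rle_trans with (1 := H e ltac:(lra) i Hi).
assert ((C * C + 1) * (tol / (C * C + 1)) = tol) by (field; lra).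
assert ((C * C + 1) * e <= (C * C + 1) * (tol / (C * C + 1))) by (apply Rmult_le_compat_l; lra).
assert (C * C * (e * e) <= C * C * e) by (apply Rmult_le_compat_l; nra). lra.
Qed.

Definition cell (e : R) : nat -> nat -> Prop := arr_cell (gridc n1 e) (gridc n2 e) f0 np0.

Lemma cells : exists e1, 0 < e1 /\ forall e, 0 < e < e1 ->
  forall i j, INR i * e <= 2 -> INR j * e <= 2 -> cell e i j.
Proof.
destruct (chord_tol n1 smooth_n1 sphere_n1) as [e1 [He1 H1]].
destruct (chord_tol n2 smooth_n2 sphere_n2) as [e2 [He2 H2]].
exists (Rmin e1 e2). split; [now apply Rmin_glb_lt|]. intros e He i j Hi Hj. rmins.
assert (Hd : forall m m' : nat, INR m * e <= 2 -> (m' < S m)%nat -> INR m' * e <= 2).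
{ intros m m' h h'. apply Rle_trans with (2 := h). apply Rmult_le_compat_r; [lra|]. apply le_INR. lia. }
assert (E : forall c, gridc c e 0 = c 0) by (intros c; unfold gridc; simpl; now rewrite Rmult_0_l).
(* The array is cut just beyond the cell in question, so the edge bounds are needed only up to its
   indices. *)
apply (arr_cells _ _ (S i) (S j) tol) with (kappa := gap); auto using gap_pos; rewrite ?E; auto.
- intros i'. apply sphere_dot, sphere_n1.
- intros j'. apply sphere_dot, sphere_n2.
- apply Rmin_l.
- intros i' h. apply H1; [lra|]. now apply (Hd i).
- intros j' h. apply H2; [lra|]. now apply (Hd j).
- now apply sphere_dot.
- apply Rmin_l.
- apply Rmin_r.
- unfold tol. rmins. lra.
Qed.

Lemma ev_cell : ev 2 cell.
Proof.
destruct cells as [e1 [He1 H]]. intros R' HR. exists e1. split; [exact He1|].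
intros e He i j Hi Hj. apply H; auto; lra.
Qed.

Lemma dN_x e i : dN e i 0 = n1 (INR i * e).
Proof. apply arrN_x. unfold gridc. simpl. now rewrite Rmult_0_l. Qed.
Lemma dN_y e j : dN e 0 j = n2 (INR j * e).
Proof. reflexivity. Qed.

Lemma dN_regular : forall N k, B 2 N (cf dN k).
Proof.
apply (K_regular 2 (cf dN) (fun b k => rho (fun e => curve_jet b (fun s => co k (match b with ax1 => n1 | ax2 => n2 end s)) e []))).
- apply cf_units. generalize ev_cell. apply ev_mono. intros e i j _ h. apply h.
- intros b. apply bd_cf_dl.
  + generalize ev_cell. apply ev_mono. intros e i j _ h. split; [apply h|destruct b; apply h].
  + assert (H : exists C e1, 0 < e1 /\ forall e, 0 < e < e1 -> forall i, INR i * e <= 2 ->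
      1 - dot (gridc (match b with ax1 => n1 | ax2 => n2 end) e i) (gridc (match b with ax1 => n1 | ax2 => n2 end) e (S i)) <= C * C * (e * e))
      by (destruct b; now apply chord_bound).
    destruct H as [C [e1 [He1 H]]]. exists C. intros R' HR.
    assert (H' : near R' (fun e i j => 1 - dot (gridc (match b with ax1 => n1 | ax2 => n2 end) e (coord b i j)) (gridc (match b with ax1 => n1 | ax2 => n2 end) e (S (coord b i j))) <= C * C * (e * e))).
    { exists e1. split; [exact He1|]. intros e He i j Hi Hj. apply H; [exact He|]. destruct b; simpl; lra. }
    generalize (near_and _ _ _ (ev_cell R' HR) H'). apply near_mono. intros e i j _ [h h'].
    destruct b; unfold shift, dN; [rewrite (c_ch1 _ _ _ _ _ _ h)|rewrite (c_ch2 _ _ _ _ _ _ h)]; exact h'.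
- apply cf_gauss. generalize ev_cell. apply ev_mono. intros e i j _ h. split; [|split]; apply h.
- intros N b k. apply rho_B, curve_jet_smooth. intros m t. apply smooth_comp. destruct b; assumption.
- intros b k. apply ev_all. intros e i j _ h. unfold cf, rho, curve_jet. simpl.
  destruct b; simpl in h; subst; [now rewrite dN_x|now rewrite dN_y].
Qed.

Lemma dN_discrete : discrete_K 2 (cf dN) (cf dF).
Proof.
assert (HF : forall b k, feq 2 (dl b (cf dF k)) (rhs_F b (cf dN) (vdl b (cf dN)) k)).
{ apply cf_F_eq. generalize ev_cell. apply ev_mono. intros e i j _ h. split; apply h. }
constructor.
- exact dN_regular.
- apply (F_regular 2 (cf dN) (cf dF) f0); auto using dN_regular.
- apply cf_units. generalize ev_cell. apply ev_mono. intros e i j _ h. apply h.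
- apply cf_gauss. generalize ev_cell. apply ev_mono. intros e i j _ h. split; [|split]; apply h.
- exact HF.
Qed.

Lemma dP_B_eq b : B_eq 2 b (cf dN) (cf dP).
Proof.
apply cf_B_eq. generalize ev_cell. apply ev_mono. intros e i j _ h.
destruct b; cbn [shift sg step_B]; (split; [apply h|split; [apply h|split; [|apply h]]]).
- intros h'. unfold dN, dP in h'. apply (c_Bd1 _ _ _ _ _ _ h). lra.
- intros h'. unfold dN, dP in h'. apply (c_Bd2 _ _ _ _ _ _ h). lra.
Qed.

Lemma dP_dot : feq 2 (fdot (cf dN) (cf dP)) (fcst angle).
Proof.
generalize ev_cell. apply ev_mono. intros e i j _ h.
transitivity (dot (gridc n1 e 0%nat) np0); [exact (c_NP _ _ _ _ _ _ h)|].
unfold gridc, fcst, angle. simpl. now rewrite Rmult_0_l.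
Qed.

Lemma dP_units : units 2 (cf dP).
Proof. apply cf_units. generalize ev_cell. apply ev_mono. intros e i j _ h. apply h. Qed.

Lemma dP_regular : forall N k, B 2 N (cf dP k).
Proof.
pose proof angle_bounds.
apply (B_regular 2 (cf dN) (cf dP) angle); try lra; auto using dN_regular, dP_units, dP_dot, dP_B_eq.
Qed.

Lemma dP_discrete : discrete_K 2 (cf dP) (cf dG).
Proof.
assert (HF : forall b k, feq 2 (dl b (cf dG k)) (rhs_F b (cf dP) (vdl b (cf dP)) k)).
{ apply cf_F_eq. generalize ev_cell. apply ev_mono. intros e i j _ h. split; apply h. }
constructor.
- exact dP_regular.
- apply (F_regular 2 (cf dP) (cf dG) (f0 + cross np0 (n1 0))%V); auto using dP_regular.
  intros k e. unfold cf, dG, arrG. f_equal. f_equal. f_equal. rewrite arrN_x; unfold gridc; simpl; now rewrite Rmult_0_l.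
- exact dP_units.
- apply cf_gauss. generalize ev_cell. apply ev_mono. intros e i j _ h. split; [|split]; apply h.
- exact HF.
Qed.

Lemma canonical_B : discrete_B 2 angle (cf dN) (cf dF) (cf dP) (cf dG).
Proof.
pose proof angle_bounds. constructor; try lra.
- exact dN_discrete.
- exact dP_discrete.
- exact dP_dot.
- exact dP_B_eq.
- intros k. fam_ext. unfold cf, dG, arrG. rewrite co_add, co_cross. destruct k; reflexivity.
Qed.
Lemma N_axis b t : 0 <= t < 2 ->
  flimv (cf dN) (match b with ax1 => (t, 0) | ax2 => (0, t) end) = match b with ax1 => n1 | ax2 => n2 end t.
Proof.
intros Ht. apply vec_ext. intros k. rewrite co_flimv.
apply (flim_axis 2 (cf dN k) b (fun s => co k (match b with ax1 => n1 | ax2 => n2 end s))); auto.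
- apply (B_bd _ 0). apply (dKn _ _ _ (dBK _ _ _ _ _ _ canonical_B)).
- intros m s. apply smooth_comp. destruct b; assumption.
- intros e i j h. unfold cf. destruct b; simpl in h; subst; [now rewrite dN_x|reflexivity].
Qed.
Lemma F_origin : flimv (cf dF) (0, 0) = f0.
Proof.
apply vec_ext. intros k. rewrite co_flimv. apply (flim_origin 2); [lra| |reflexivity].
apply (B_bd _ 0). apply (dKf _ _ _ (dBK _ _ _ _ _ _ canonical_B)).
Qed.
Lemma P_origin : flimv (cf dP) (0, 0) = np0.
Proof.
apply vec_ext. intros k. rewrite co_flimv. apply (flim_origin 2); [lra| |reflexivity].
apply (B_bd _ 0). apply (dKn _ _ _ (dBK' _ _ _ _ _ _ canonical_B)).
Qed.

Lemma node_axis b e i j : coord (other b) i j = 0%nat ->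
  node e i j = match b with ax1 => (INR (coord b i j) * e, 0) | ax2 => (0, INR (coord b i j) * e) end.
Proof. intros h. destruct b; simpl in *; subst; unfold node; simpl; now rewrite Rmult_0_l. Qed.

Lemma aN_coord b e i j : coord (other b) i j = 0%nat ->
  dN e i j = match b with ax1 => n1 | ax2 => n2 end (INR (coord b i j) * e).
Proof. intros h. destruct b; simpl in h; subst; [now apply dN_x|reflexivity]. Qed.

Lemma N_on_axes b k : ev 2 (fun e i j => coord (other b) i j = 0%nat ->
  cf dN k e i j = co k (flimv (cf dN) (node e i j))).
Proof.
intros R' HR. exists 1. split; [lra|]. intros e He i j Hi Hj h.
rewrite (node_axis b) by exact h. rewrite N_axis; [unfold cf; now rewrite (aN_coord b)|].
split; [apply Rmult_le_pos; [apply pos_INR|lra]|]. destruct b; simpl; lra.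
Qed.

Lemma G_converges : forall N k, sim 2 N (fun _ => False) (cf dG k) (rst (flim (cf dG k))).
Proof.
apply (discrete_B_converges 2 _ _ _ _ _ canonical_B).
- intros b k. generalize (N_on_axes b k). apply ev_mono. intros e i j _ H h. now rewrite H, co_flimv by exact h.
- intros k. apply ev_all. intros e i j _ -> ->. unfold rst, rho. simpl. rewrite Rmult_0_l, <- co_flimv, F_origin. reflexivity.
- intros k. apply ev_all. intros e i j _ -> ->. unfold rst, rho. simpl. rewrite Rmult_0_l, <- co_flimv, P_origin. reflexivity.
Qed.

Lemma canonical_surface : K_surface (square 1) (flimv (cf dN)) (flimv (cf dF)).
Proof. apply (K_limit 2); [exact dN_discrete|lra]. Qed.
Lemma canonical_backlund : backlund (square 1) (flimv (cf dN)) (flimv (cf dF)) (flimv (cf dP)) (flimv (cf dG)).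
Proof. apply (B_limit 2 angle); [exact canonical_B|lra]. Qed.

(** The discrete surface acts as intermediary: every smooth solution with these data is O(e)-close
    to it, hence equals its limit. The surface f then follows from its first derivatives and its
    value at the origin. *)
Lemma K_unique n' f' : K_surface (square 1) n' f' -> K_data 1 n1 n2 f0 n' f' ->
  forall u, square 1 u -> n' u = flimv (cf dN) u /\ f' u = flimv (cf dF) u.
Proof.
intros HK [Hd1 [Hd2 Hd0]].
destruct dN_discrete as [Hn _ Hu Hg _]. assert (HK0 := canonical_surface).
assert (EN : forall u, square 1 u -> n' u = flimv (cf dN) u).
{ apply (sim_flimv 1); try lra; [|apply HK|apply HK0].
  destruct (K_smooth_compare 1 ltac:(lra) (cf dN) n' f') as [Sn _]; auto.
  - intros M k. apply (B_weaken 1 2); [lra|apply Hn].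
  - apply (ev_weaken 1 2); [lra|exact Hu].
  - intros k. apply (ev_weaken 1 2); [lra|apply Hg].
  - intros b k R' HR. exists 1. split; [lra|]. intros e He' i j Hi Hj h.
    fold (node e i j). rewrite (node_axis b) by exact h. unfold cf. rewrite (aN_coord b) by exact h.
    assert (0 <= INR (coord b i j) * e <= 1).
    { split; [apply Rmult_le_pos; [apply pos_INR|lra]|]. destruct b; simpl; lra. }
    destruct b; [now rewrite Hd1|now rewrite Hd2]. }
intros u Hs. split; [now apply EN|].
apply (equal_partials 1 ltac:(lra) f' (flimv (cf dF))); [apply HK|apply HK0| |now rewrite F_origin|exact Hs].
intros b v Hv.
assert (Ev : forall b, vpartial (square 1) b n' v = vpartial (square 1) b (flimv (cf dN)) v).
{ intros b'. apply vpartial_ext; [lra|apply HK|exact EN|exact Hv]. }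
destruct b.
- rewrite (K_d1f _ _ _ HK), (K_d1f _ _ _ HK0), Ev, EN by exact Hv. reflexivity.
- rewrite (K_d2f _ _ _ HK), (K_d2f _ _ _ HK0), Ev, EN by exact Hv. reflexivity.
Qed.

Lemma B_unique np' fp' : backlund (square 1) (flimv (cf dN)) (flimv (cf dF)) np' fp' -> np' (0, 0) = np0 ->
  forall u, square 1 u -> np' u = flimv (cf dP) u /\ fp' u = flimv (cf dG) u.
Proof.
intros HB H0.
assert (HB0 := canonical_backlund). assert (HK0 := canonical_surface).
destruct canonical_B as [Ht Ht' [Hn _ Hu Hg _] [Hp _ _ _ _] Hdot HBe _].
assert (EP : forall u, square 1 u -> np' u = flimv (cf dP) u).
{ apply (sim_flimv 1); try lra; [|apply HB|apply HB0].
  apply (B_smooth_compare 1 ltac:(lra) (angle) (cf dN) (cf dP) (flimv (cf dN)) (flimv (cf dF)) np' fp'); auto.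
  - intros M k. apply (B_weaken 1 2); [lra|apply Hn].
  - apply (ev_weaken 1 2); [lra|exact Hu].
  - intros k. apply (ev_weaken 1 2); [lra|apply Hg].
  - intros M k. apply (B_weaken 1 2); [lra|apply Hp].
  - apply (ev_weaken 1 2); [lra|exact Hdot].
  - intros b k. apply (ev_weaken 1 2); [lra|apply HBe].
  - intros b k. apply (ev_weaken 1 2); [lra|exact (N_on_axes b k)].
  - intros k. apply ev_all. intros e i j _ -> ->. simpl. rewrite Rmult_0_l, H0. reflexivity. }
intros u Hs. split; [now apply EP|].
rewrite (B_formula _ _ _ _ _ HB), (B_formula _ _ _ _ _ HB0), EP by exact Hs. reflexivity.
Qed.

Lemma dN_K_surface e n f : 0 < e -> (forall i j, INR i * e <= 2 -> INR j * e <= 2 -> cell e i j) -> agree e n (dN e) -> agree e f (dF e) ->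
  discrete_K_surface e 1 n f.
Proof.
intros He H. apply discrete_K_of_arrays; [exact He|]. intros i j Hi Hj.
destruct (H i j ltac:(lra) ltac:(lra)). auto.
Qed.
Lemma dP_K_surface e n f : 0 < e -> (forall i j, INR i * e <= 2 -> INR j * e <= 2 -> cell e i j) -> agree e n (dP e) -> agree e f (dG e) ->
  discrete_K_surface e 1 n f.
Proof.
intros He H. apply discrete_K_of_arrays; [exact He|]. intros i j Hi Hj.
destruct (H i j ltac:(lra) ltac:(lra)). auto.
Qed.

Lemma discrete_exists e : 0 < e -> (forall i j, INR i * e <= 2 -> INR j * e <= 2 -> cell e i j) ->
  exists ne fe npe fpe : vec2 -> vec3,
    discrete_K_surface e 1 ne fe /\ discrete_K_data e 1 n1 n2 f0 ne fe /\
    discrete_backlund e 1 ne fe npe fpe /\ npe (0, 0) = np0.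
Proof.
intros He H. assert (L := fun A i j => lat_node e A i j He).
assert (L0 : forall A, lat e A (0, 0) = A 0%nat 0%nat).
{ intros A. rewrite <- L. unfold node. simpl. now rewrite Rmult_0_l. }
exists (lat e (dN e)), (lat e (dF e)), (lat e (dP e)), (lat e (dG e)).
split; [apply dN_K_surface; auto; intros i j _ _; apply L|].
split; [split; [|split]|].
- intros t Ht. destruct (node_grid e 1 _ He Ht) as [i [j [Eq [Hi Hj]]]].
  rewrite Eq, L. injection Eq as -> h. assert (j = 0%nat) by (apply INR_eq; simpl; nra). subst. now apply dN_x.
- intros t Ht. destruct (node_grid e 1 _ He Ht) as [i [j [Eq [Hi Hj]]]].
  rewrite Eq, L. injection Eq as h ->. assert (i = 0%nat) by (apply INR_eq; simpl; nra). subst. reflexivity.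
- rewrite L0. reflexivity.
- split; [|rewrite L0; reflexivity]. constructor.
  + intros u Hu. destruct (node_grid e 1 u He Hu) as [i [j [-> [Hi Hj]]]]. rewrite L.
    apply sphere_dot. apply (H i j); lra.
  + intros u Hu. destruct (node_grid e 1 u He Hu) as [i [j [-> [Hi Hj]]]]. rewrite !L. reflexivity.
  + intros u Hu _. destruct (node_grid e 1 u He Hu) as [i [j [-> [Hi Hj]]]].
    unfold tau. rewrite node_move1, !L. assert (h := H i j ltac:(lra) ltac:(lra)).
    split; [exact (c_Bd1 _ _ _ _ _ _ h)|]. unfold dP. rewrite (c_B1 _ _ _ _ _ _ h). unfold step_B1, dN. vec.
  + intros u Hu _. destruct (node_grid e 1 u He Hu) as [i [j [-> [Hi Hj]]]].
    unfold tau. rewrite node_move2, !L. assert (h := H i j ltac:(lra) ltac:(lra)).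
    split; [exact (c_Bd2 _ _ _ _ _ _ h)|]. unfold dP. rewrite (c_B2 _ _ _ _ _ _ h). unfold step_B2, dN. vec.
Qed.

(** Each equation expresses its last vertex through earlier ones, in the order of the array
    recursions; therefore any discrete solution has the array values at the nodes of the square. *)
Lemma discrete_agree e ne fe npe fpe : 0 < e ->
  discrete_K_surface e 1 ne fe -> discrete_K_data e 1 n1 n2 f0 ne fe ->
  discrete_backlund e 1 ne fe npe fpe -> npe (0, 0) = np0 ->
  agree e npe (dP e) /\ agree e fpe (dG e).
Proof.
intros He HK [D1 [D2 D0]] HB HP.
assert (pre := agree_pred e).
assert (G := fun i j => grid_node e 1 i j He).
assert (EN : agree e ne (dN e)).
{ intros i. induction i as [|i IHi]; intros j Hi Hj.
  - unfold dN. simpl. unfold node. simpl. rewrite Rmult_0_l. apply D2. 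
    replace (0, INR j * e) with (node e 0 j) by (unfold node; simpl; now rewrite Rmult_0_l). now apply G.
  - induction j as [|j IHj].
    + rewrite dN_x. unfold node. simpl (INR 0). rewrite Rmult_0_l. apply D1.
      replace (INR (S i) * e, 0) with (node e (S i) 0) by (unfold node; simpl (INR 0); now rewrite Rmult_0_l). now apply G.
    + assert (Hi0 := pre i He Hi). assert (Hj0 := pre j He Hj).
      destruct (dK_gauss_eq _ _ _ _ HK (node e i j)) as [_ h]; [now apply G| |].
      { rewrite node_move2, node_move1. now apply G. }
      unfold tau in h. rewrite node_move1, !node_move2 in h.
      rewrite (IHi j), (IHi (S j)), (IHj Hj0) in h by assumption.
      unfold dN. rewrite arrN_SS. apply vec_ext. intros k. apply (f_equal (co k)) in h.
      rewrite co_add in h. unfold step_K. rewrite co_sub. unfold dN in h. rewrite <- h. ring. }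
assert (EF : agree e fe (dF e)).
{ intros i j Hi. induction j as [|j IHj]; intros Hj.
  - induction i as [|i IHi]; [unfold node; simpl; rewrite Rmult_0_l; exact D0|].
    assert (Hi0 := pre i He Hi).
    assert (h := dK_d1f _ _ _ _ HK (node e i 0) ltac:(now apply G) ltac:(rewrite node_move1; now apply G)).
    unfold delta, tau in h. rewrite node_move1, !EN, IHi in h by assumption.
    unfold dF. rewrite arrF_1. apply (solve_delta e); [lra|]. refine (eq_trans h _). unfold dN. vec.
  - assert (Hj0 := pre j He Hj).
    assert (h := dK_d2f _ _ _ _ HK (node e i j) ltac:(now apply G) ltac:(rewrite node_move2; now apply G)).
    unfold delta, tau in h. rewrite node_move2, !EN, (IHj Hj0) in h by assumption.
    unfold dF. rewrite arrF_2. apply (solve_delta e); [lra|]. refine (eq_trans h _). unfold dN. vec. }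
assert (EP : agree e npe (dP e)).
{ intros i j Hi. induction j as [|j IHj]; intros Hj.
  - induction i as [|i IHi]; [unfold node; simpl; rewrite Rmult_0_l; exact HP|].
    assert (Hi0 := pre i He Hi).
    destruct (dB_1 _ _ _ _ _ _ HB (node e i 0) ltac:(now apply G) ltac:(rewrite node_move1; now apply G)) as [_ h].
    unfold tau in h. rewrite node_move1, !EN, IHi in h by assumption.
    unfold dP. rewrite arrP_10. unfold step_B1. change (arrN (gridc n1 e) (gridc n2 e)) with (dN e).
    fold (dP e i 0%nat). rewrite <- h. vec.
  - assert (Hj0 := pre j He Hj).
    destruct (dB_2 _ _ _ _ _ _ HB (node e i j) ltac:(now apply G) ltac:(rewrite node_move2; now apply G)) as [_ h].
    unfold tau in h. rewrite node_move2, !EN, (IHj Hj0) in h by assumption.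
    unfold dP. rewrite arrP_2. unfold step_B2. change (arrN (gridc n1 e) (gridc n2 e)) with (dN e).
    fold (dP e i j). rewrite <- h. vec. }
split; [exact EP|].
intros i j Hi Hj. rewrite (dB_formula _ _ _ _ _ _ HB) by now apply G. rewrite EF, EP, EN by assumption. reflexivity.
Qed.

Lemma G_converges_grid (e0 : R) (fpe : R -> vec2 -> vec3) : 0 < e0 ->
  (forall e, 0 < e < e0 -> agree e (fpe e) (dG e)) -> converges_Oeps_Cinf 1 fpe (flimv (cf dG)).
Proof.
intros He0 Hag a1 a2.
(* The error divided by e lies in B N for every N. Multiplication by e commutes with difference
   quotients, so all quotients of the error are O(e). *)
set (q := fun k => quot (cf dG k) (rst (flim (cf dG k)))).
set (d := fun k => Nat.iter a1 (dl ax1) (Nat.iter a2 (dl ax2) (q k))).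
assert (Hq : forall k, bd 2 (d k)).
{ intros k. apply (B_bd _ 0). unfold d. apply iter_dl_B. intros N. apply iter_dl_B. intros N'.
  apply (span_none 2 N'). exact (proj2 (proj2 (G_converges N' k))). }
destruct (near_list ks (fun k C e i j => Rabs (d k e i j) <= C) 1) as [C [HC [e1 [He1 H]]]].
{ intros; lra. }
{ intros k _. apply (Hq k 1). lra. }
(* Three components, each at most C e, by [norm_le_sum]. *)
exists (3 * C), (Rmin e0 e1). split; [now apply Rmin_glb_lt|].
intros e He u Hu Hu'.
rmins.
destruct (node_grid e 1 u ltac:(lra) Hu) as [i [j [-> [Hi Hj]]]].
destruct Hu' as [_ [hi hj]]. unfold node in hi, hj. simpl in hi, hj.
assert (E : forall k, co k (delta_multi e a1 a2 (fun v => (fpe e v - flimv (cf dG) v)%V) (node e i j)) = e * d k e i j).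
{ intros k. transitivity (Nat.iter a1 (dl ax1) (Nat.iter a2 (dl ax2) (feps * q k)%fam) e i j).
  - apply delta_multi_iter. intros m1 m2 Hm1 Hm2.
    assert (INR (i + m1) * e <= 1).
    { rewrite plus_INR. apply le_INR in Hm1. assert (INR m1 * e <= INR a1 * e) by (apply Rmult_le_compat_r; lra). lra. }
    assert (INR (j + m2) * e <= 1).
    { rewrite plus_INR. apply le_INR in Hm2. assert (INR m2 * e <= INR a2 * e) by (apply Rmult_le_compat_r; lra). lra. }
    rewrite co_sub, co_flimv, (Hag e) by lra.
    unfold q, quot, fmul, fadd, fopp, finv, feps, rst, rho, cf, node. field. lra.
  - rewrite !iter_dl_eps. reflexivity. }
apply Rle_trans with (1 := norm_le_sum _). rewrite !E, !Rabs_mult, (Rabs_pos_eq e) by lra.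
assert (h := fun k => H e ltac:(lra) i j Hi Hj k (in_ks k)).
pose proof (h cx). pose proof (h cy). pose proof (h cz). nra.
Qed.
End Canonical.
Theorem theorem3p17 (n1 n2 : R -> vec3) (f0 np0 : vec3)
    (smooth_n1 : smooth_curve n1) (smooth_n2 : smooth_curve n2)
    (sphere_n1 : forall t : R, sphere (n1 t)) (sphere_n2 : forall t : R, sphere (n2 t))
    (common_point : n1 0 = n2 0)
    (sphere_np0 : sphere np0)
    (np0_neq : np0 <> n1 0) (np0_neq_opp : np0 <> vopp (n1 0)) :
  exists r : R, 0 < r /\
  exists n f np fp : vec2 -> vec3,
    (* the K-surface f determined by the data (K) *)
    (K_surface (square r) n f /\ K_data r n1 n2 f0 n f) /\
    (forall n' f' : vec2 -> vec3,
       K_surface (square r) n' f' -> K_data r n1 n2 f0 n' f' ->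
       forall u, square r u -> n' u = n u /\ f' u = f u) /\
    (* its unique Baecklund transform with the data (B) *)
    (backlund (square r) n f np fp /\ np (0, 0) = np0) /\
    (forall np' fp' : vec2 -> vec3,
       backlund (square r) n f np' fp' -> np' (0, 0) = np0 ->
       forall u, square r u -> np' u = np u /\ fp' u = fp u) /\
    exists eps0 : R, 0 < eps0 /\
      (* the discrete surfaces are defined for small eps *)
      (forall eps : R, 0 < eps < eps0 ->
         exists ne fe npe fpe : vec2 -> vec3,
           discrete_K_surface eps r ne fe /\ discrete_K_data eps r n1 n2 f0 ne fe /\
           discrete_backlund eps r ne fe npe fpe /\ npe (0, 0) = np0) /\
      (* the transforms are discrete K-surfaces and converge *)
      (forall ne fe npe fpe : R -> vec2 -> vec3,
         (forall eps : R, 0 < eps < eps0 ->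
            discrete_K_surface eps r (ne eps) (fe eps) /\
            discrete_K_data eps r n1 n2 f0 (ne eps) (fe eps) /\
            discrete_backlund eps r (ne eps) (fe eps) (npe eps) (fpe eps) /\
            npe eps (0, 0) = np0) ->
         (forall eps : R, 0 < eps < eps0 ->
            discrete_K_surface eps r (npe eps) (fpe eps)) /\
         converges_Oeps_Cinf r fpe fp).
Proof.
destruct (cells n1 n2 f0 np0) as [e0 [He0 Hcells]]; auto.
(* The cells and estimates above cover every side R' < 2, which leaves room for the shifts around
   the unit square. *)
exists 1. split; [lra|].
exists (flimv (cf (dN n1 n2))), (flimv (cf (dF n1 n2 f0))), (flimv (cf (dP n1 n2 np0))), (flimv (cf (dG n1 n2 f0 np0))).
split; [split|split; [|split; [split|split]]].
- now apply (canonical_surface n1 n2 f0 np0).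
- split; [|split].
  + intros t Ht. apply (N_axis n1 n2 f0 np0) with (b := ax1); auto; lra.
  + intros t Ht. apply (N_axis n1 n2 f0 np0) with (b := ax2); auto; lra.
  + now apply (F_origin n1 n2 f0 np0).
- intros n' f' HK HD. now apply (K_unique n1 n2 f0 np0).
- now apply canonical_backlund.
- now apply (P_origin n1 n2 f0 np0).
- intros np' fp' HB H0. now apply (B_unique n1 n2 f0 np0).
- exists e0. split; [exact He0|]. split.
  + intros eps Heps. apply discrete_exists; auto; lra.
  + intros ne fe npe fpe H.
    assert (Hag : forall eps, 0 < eps < e0 -> agree eps (npe eps) (dP n1 n2 np0 eps) /\ agree eps (fpe eps) (dG n1 n2 f0 np0 eps)).
    { intros eps Heps. destruct (H eps Heps) as [h1 [h2 [h3 h4]]].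
      apply (discrete_agree n1 n2 f0 np0 common_point eps (ne eps) (fe eps)); auto; lra. }
    split.
    * intros eps Heps. destruct (Hag eps Heps) as [h1 h2].
      apply (dP_K_surface n1 n2 f0 np0); auto; lra.
    * apply (G_converges_grid n1 n2 f0 np0) with e0; auto. intros eps Heps. now apply Hag.
Qed.
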